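(* Let $T$ be an analytic full branch map on $[-1,1]$ as in the setting below with $r/R<1/\gamma$, where $\gamma=(1+\sqrt2)^2$, and take $\rho=\sqrt{rR/\gamma}$ (so $\rho\in(r,R)$). Then there exist $C_1,C_2>0$ such that for all $N\in\mathbb{N}_0$ and all $M\ge C_1N^2\gamma^N$ (and any $0\le\delta\le 2/M$), \[ \|V_N(H_N^{(M)})^\dagger G_N^{(M)}V_N^{-1}-L\|_{\ell^2}\le C_2\left(\frac{(\gamma rR)^{N/2}N^2}{M}+\left(\frac{\gamma r}{R}\right)^{N/2}\right). \]
   Context: $T\colon[-1,1]\to[-1,1]$ is an analytic full branch map: closed intervals $I_1,\dots,I_d$ with disjoint interiors covering $[-1,1]$, $T|_{\mathrm{int}(I_\ell)}$ an analytic diffeomorphism with $\overline{T(I_\ell)}=[-1,1]$; inverse branches $\varphi_\ell$ extend to bounded holomorphic functions on $D_R=\{|z|<R\}$ with $\bigcup_\ell\varphi_\ell(D_R)\subseteq D_r$, $1<r<R$. Transfer operator: $(\mathcal{L}f)(z)=\sum_\ell\sigma_\ell\varphi_\ell'(z)f(\varphi_\ell(z))$, $\sigma_\ell=\mathrm{sgn}(\varphi_\ell'(0))$. $H^2(D_\rho)$ is the Hardy space on $D_\rho$ with inner product $(\cdot,\cdot)$ and orthonormal basis $e_n(z)=(z/\rho)^n$; $L$ is the matrix $L_{k\ell}=(\mathcal{L}e_\ell,e_k)$ viewed as an operator on $\ell^2(\mathbb{N}_0)$. $V_N$ and $V_N^{-1}$ are the diagonal operators on $\ell^2(\mathbb{N}_0)$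 with entries $\rho^n$, resp. $\rho^{-n}$, for $n<N$ and $0$ for $n\ge N$. Nodes: $x_m=-1+\delta+2m/M$, $m=0,\dots,M-1$, $0\le\delta\le2/M$. $\hat H_N^{(M)}$, $\hat G_N^{(M)}$ are the $N\times N$ matrices $(\hat H_N^{(M)})_{k\ell}=\frac1M\sum_mx_m^kx_m^\ell$, $(\hat G_N^{(M)})_{k\ell}=\frac1M\sum_m(T(x_m))^kx_m^\ell$ ($k,\ell\in\{0,\dots,N-1\}$); $G_N^{(M)}$ is the lift of $\hat G_N^{(M)}$ to $\ell^2(\mathbb{N}_0)$ (zero outside the first $N\times N$ block), and $(H_N^{(M)})^\dagger$ is the lift of $(\hat H_N^{(M)})^{-1}$ (which exists for $M\ge N$). $\|\cdot\|_{\ell^2}$ is the operator norm. *)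

(* Defs.v *)
From Stdlib Require Import Reals.
From Coquelicot Require Import Coquelicot.
From mathcomp Require Import ssreflect ssrfun ssrbool eqtype ssrnat seq fintype bigop ssralg matrix.
From mathcomp Require Import Rstruct.

Open Scope R_scope.

Fixpoint Cpow (z : C) (n : nat) : C :=
  match n with O => RtoC 1 | S n' => Cmult z (Cpow z n') end.

Fixpoint Csum (n : nat) (f : nat -> C) : C :=
  match n with O => RtoC 0 | S n' => Cplus (Csum n' f) (f n') end.

Definition circle (s t : R) : C := (Rmult s (cos t), Rmult s (sin t)).

Definition CCS : CompleteSpace :=
  CompleteNormedModule.CompleteSpace _ C_R_CompleteNormedModule.

Definition ebasis (rho : R) (n : nat) (z : C) : C := Cpow (Cdiv z (RtoC rho)) n.

Definition hardy_ip (rho : R) (f g : C -> C) : C :=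
  @lim CCS (filtermap
    (fun s => Cmult (RtoC (/ (2 * PI)))
       (@RInt C_R_CompleteNormedModule
          (fun t => Cmult (f (circle s t)) (Cconj (g (circle s t)))) 0 (2 * PI)))
    (at_left rho)).

Definition sgnR (x : R) : R :=
  if Rlt_dec 0 x then 1 else if Rlt_dec x 0 then -1 else 0.

(* (L f)(z) = sum_l sigma_l phi_l'(z) f(phi_l(z)),  sigma_l = sgn(phi_l'(0));
   phi_l'(0) is real (phi_l is real on the real axis), we take the sign of its
   real part. *)
Definition transfer (d : nat) (Phi Phi' : nat -> C -> C) (f : C -> C) (z : C) : C :=
  Csum d (fun l => Cmult (RtoC (sgnR (fst (Phi' l (RtoC 0)))))
                         (Cmult (Phi' l z) (f (Phi l z)))).

Definition Lmat (d : nat) (Phi Phi' : nat -> C -> C) (rho : R) (k l : nat) : C :=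
  hardy_ip rho (transfer d Phi Phi' (ebasis rho l)) (ebasis rho k).

Definition node (M : nat) (delta : R) (m : nat) : R :=
  -1 + delta + 2 * INR m / INR M.

Definition Hhat (N M : nat) (delta : R) : 'M[R]_N :=
  \matrix_(k < N, l < N)
    (Rmult (/ INR M)
       (\sum_(m < M) Rmult (pow (node M delta m) k) (pow (node M delta m) l))%R).

Definition Ghat (T : R -> R) (N M : nat) (delta : R) : 'M[R]_N :=
  \matrix_(k < N, l < N)
    (Rmult (/ INR M)
       (\sum_(m < M) Rmult (pow (T (node M delta m)) k) (pow (node M delta m) l))%R).

(* Entries of V_N (H_N^(M))^dagger G_N^(M) V_N^{-1} as an infinite matrix:
   rho^k ((Hhat)^{-1} Ghat)_{kl} rho^{-l} for k,l < N, and 0 otherwise. *)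
Definition approx_mat (T : R -> R) (N M : nat) (delta rho : R) (k l : nat) : C :=
  match @insub nat (fun n => n < N)%N _ k, @insub nat (fun n => n < N)%N _ l with
  | Some i, Some j =>
      RtoC (Rmult (Rmult (pow rho k)
                 (mulmx (invmx (Hhat N M delta)) (Ghat T N M delta) i j))
                 (/ pow rho l))
  | _, _ => RtoC 0
  end.

Definition l2 (x : nat -> C) : Prop := ex_series (fun n => Cmod (x n) ^ 2).

Definition l2norm (x : nat -> C) : Rbar :=
  match Lim_seq (fun K => sum_n (fun n => Cmod (x n) ^ 2) K) with
  | Rbar.Finite s => Rbar.Finite (sqrt s)
  | p_infty => p_infty
  | m_infty => m_infty
  end.

Definition matapp (A : nat -> nat -> C) (x : nat -> C) (k : nat) : C :=
  (Series (fun l => fst (Cmult (A k l) (x l))),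
   Series (fun l => snd (Cmult (A k l) (x l)))).

Definition opnorm (A : nat -> nat -> C) : Rbar :=
  Lub_Rbar (fun t => exists x, l2 x /\ Rbar_le (l2norm x) 1 /\
                               Rbar_le t (l2norm (matapp A x))).

Definition real_analytic_at (f : R -> R) (y : R) : Prop :=
  exists (c : nat -> R) (eps : R), 0 < eps /\
    forall x, Rabs (x - y) < eps -> is_pseries c (x - y) (f x).

Definition in_closure (S : R -> Prop) (y : R) : Prop :=
  forall eps, 0 < eps -> exists s, S s /\ Rabs (s - y) < eps.

Definition gamma : R := (1 + sqrt 2) ^ 2.

(* Main.v *)
(** Write [t k l] for the Taylor coefficients of [L (z^l)].  Cauchy's estimates on a circle of
    radius [s] slightly below [R] give [|t k l| <= K r^l s^(-k)], and [L_(k,l) = rho^(k-l) t k l].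
    Full branches turn [int T^j x^l] into [int y^j (L x^l)(y)], so the rectangle rule gives
    [G = H t + E], where [H] also has columns of index [k >= N] and [E = O(r^l / M)].  Hence
    [H^-1 G - t_N = H^-1 (E + sum_(k >= N) H_k t_k)].

    Expanding in the Chebyshev polynomials [U_n], whose coefficients have l1 norm at most
    [(1 + sqrt 2)^n] and which are orthogonal for the weight [sqrt (1 - x^2) <= 1], bounds the least
    eigenvalue of the moment matrix below by [gamma^(-N)]; as [M >= C N^2 gamma^N], half of this
    survives discretisation.  So [H^-1] costs [gamma^N] on [E], while the tail, being a discrete
    least-squares projection, costs only [gamma^(N/2)].  All the resulting bounds on matrix
    entries are geometric, so the operator norm may be replaced by the sum of the entries. *)

Require Import Defs.
From Stdlib Require Import Reals Lra Lia Psatz Arith Ranalysis5 ClassicalEpsilon.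
From Coquelicot Require Import Coquelicot.
From mathcomp Require ssreflect ssrfun ssrbool eqtype ssrnat seq fintype bigop ssralg matrix mxalgebra Rstruct.
Open Scope R_scope.

(** * Finite sums *)

(** The branches are complex differentiable at each point, with nothing assumed on the continuity of
    [Phi']. Their Taylor expansions rest on a Goursat bisection in logarithmic polar coordinates
    around the point of evaluation, where a circle becomes an edge of a rectangle. The coefficients
    [t k l] are not estimated from [Phi'], which may be unbounded near the boundary of the disc, but
    from [Phi^(l+1) / (l+1)], whose derivative is [Phi' Phi^l]; this costs a factor [k], hence a
    radius [s < R].

    The given [rho] satisfies [gamma rho / R = r / rho = sqrt (gamma r / R)]. At cost [gamma^N] the
    tail [(rho / s)^N] would exceed this rate for every [s < R]; at cost [gamma^(N/2)] any
    [s >= R / sqrt gamma] will do. Hence the separate treatment of tail and [E]: the normal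
    equations bound the effect of the tail in the energy norm at no cost, and only the passage from
    that norm to coefficients is paid.

    Integrals over a branch are replaced by increments of a primitive in the image variable, which
    needs limits of [T] at the ends of the branch but not its values there. *)

Fixpoint rsum (n : nat) (f : nat -> R) : R :=
  match n with O => 0 | S m => rsum m f + f m end.

Lemma rsum_ext n f g : (forall i, (i < n)%nat -> f i = g i) -> rsum n f = rsum n g.
Proof. induction n as [|n IH]; intros H; simpl; [easy|]. rewrite IH, (H n); auto. Qed.

Lemma rsum_plus n f g : rsum n (fun i => f i + g i) = rsum n f + rsum n g.
Proof. induction n as [|n IH]; simpl; [ring|rewrite IH; ring]. Qed.

Lemma rsum_minus n f g : rsum n (fun i => f i - g i) = rsum n f - rsum n g.
Proof. induction n as [|n IH]; simpl; [ring|rewrite IH; ring]. Qed.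

Lemma rsum_scal n c f : rsum n (fun i => c * f i) = c * rsum n f.
Proof. induction n as [|n IH]; simpl; [ring|rewrite IH; ring]. Qed.

Lemma rsum_const n c : rsum n (fun _ => c) = INR n * c.
Proof. induction n as [|n IH]; [simpl; ring|]. rewrite S_INR; simpl; rewrite IH; ring. Qed.

Lemma rsum_le n f g : (forall i, (i < n)%nat -> f i <= g i) -> rsum n f <= rsum n g.
Proof.
  induction n as [|n IH]; intros H; simpl; [lra|].
  assert (A := H n (Nat.lt_succ_diag_r n)).
  assert (rsum n f <= rsum n g) by (apply IH; auto). lra.
Qed.

Lemma rsum_pos n f : (forall i, (i < n)%nat -> 0 <= f i) -> 0 <= rsum n f.
Proof.
  intros H. replace 0 with (rsum n (fun _ => 0)) by (rewrite rsum_const; ring).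
  now apply rsum_le.
Qed.

Lemma rsum_abs n f : Rabs (rsum n f) <= rsum n (fun i => Rabs (f i)).
Proof.
  induction n as [|n IH]; simpl; [rewrite Rabs_R0; lra|].
  eapply Rle_trans; [apply Rabs_triang|lra].
Qed.

Lemma rsum_swap n m (f : nat -> nat -> R) :
  rsum n (fun i => rsum m (fun j => f i j)) = rsum m (fun j => rsum n (fun i => f i j)).
Proof.
  induction n as [|n IH]; simpl.
  - symmetry. rewrite rsum_const; ring.
  - rewrite IH. symmetry. apply rsum_plus.
Qed.

Lemma rsum_split n m f : rsum (n + m) f = rsum n f + rsum m (fun i => f (n + i)%nat).
Proof.
  induction m as [|m IH]; simpl; [rewrite Nat.add_0_r; ring|].
  rewrite Nat.add_succ_r; simpl; rewrite IH; ring.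
Qed.

Lemma rsum_S_l n f : rsum (S n) f = f O + rsum n (fun k => f (S k)).
Proof. change (S n) with (1 + n)%nat. rewrite rsum_split. simpl. ring. Qed.

Lemma rsum_mono n m f : (n <= m)%nat -> (forall i, 0 <= f i) -> rsum n f <= rsum m f.
Proof.
  intros H Hf. replace m with (n + (m - n))%nat by lia. rewrite rsum_split.
  assert (0 <= rsum (m - n) (fun i => f (n + i)%nat)) by (apply rsum_pos; auto). lra.
Qed.

Lemma rsum_telescope n f : rsum n (fun i => f (S i) - f i) = f n - f O.
Proof. induction n as [|n IH]; simpl; [ring|rewrite IH; ring]. Qed.

Lemma rsum_term_le n f j :
  (j < n)%nat -> (forall i, (i < n)%nat -> 0 <= f i) -> f j <= rsum n f.
Proof.
  induction n as [|n IH]; intros Hj Hf; [lia|simpl].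
  destruct (Nat.eq_dec j n) as [->|E].
  - assert (0 <= rsum n f) by (apply rsum_pos; auto). lra.
  - assert (f j <= rsum n f) by (apply IH; auto; lia).
    assert (0 <= f n) by auto. lra.
Qed.

Lemma rsum_geom n q : q <> 1 -> rsum n (fun i => q ^ i) = (q ^ n - 1) / (q - 1).
Proof.
  intros Hq. induction n as [|n IH]; simpl; [field; lra|rewrite IH; field; lra].
Qed.

Lemma rsum_geom_lt1 n q : 0 <= q < 1 -> rsum n (fun i => q ^ i) <= / (1 - q).
Proof.
  intros Hq. rewrite rsum_geom by lra.
  replace ((q ^ n - 1) / (q - 1)) with (/ (1 - q) * (1 - q ^ n)) by (field; lra).
  rewrite <- (Rmult_1_r (/ (1 - q))) at 2.
  apply Rmult_le_compat_l; [apply Rlt_le, Rinv_0_lt_compat; lra|].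
  assert (0 <= q ^ n) by (apply pow_le; lra). lra.
Qed.

Lemma rsum_geom_gt1 n q : 1 < q -> rsum n (fun i => q ^ i) <= q ^ n / (q - 1).
Proof.
  intros Hq. rewrite rsum_geom by lra.
  apply Rmult_le_compat_r; [apply Rlt_le, Rinv_0_lt_compat; lra|lra].
Qed.

Lemma rsum_sqr_abs n f : rsum n (fun i => f i ^ 2) <= (rsum n (fun i => Rabs (f i))) ^ 2.
Proof.
  induction n as [|n IH]; [simpl; lra|].
  change (rsum n (fun i => f i ^ 2) + f n ^ 2
          <= (rsum n (fun i => Rabs (f i)) + Rabs (f n)) ^ 2).
  assert (0 <= rsum n (fun i => Rabs (f i))) by (apply rsum_pos; intros; apply Rabs_pos).
  assert (A := Rabs_pos (f n)). rewrite <- (pow2_abs (f n)). nra.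
Qed.

Lemma rsum_CS n f g :
  (rsum n (fun i => f i * g i)) ^ 2 <= rsum n (fun i => f i ^ 2) * rsum n (fun i => g i ^ 2).
Proof.
  assert (P : forall h, 0 <= rsum n (fun i => h i ^ 2)).
  { intros h. apply rsum_pos; intros; apply pow2_ge_0. }
  set (A := rsum n (fun i => f i ^ 2)). set (B := rsum n (fun i => g i ^ 2)).
  set (X := rsum n (fun i => f i * g i)).
  assert (Q : forall u v, 0 <= u ^ 2 * A - 2 * u * v * X + v ^ 2 * B).
  { intros u v. specialize (P (fun i => u * f i - v * g i)).
    rewrite (rsum_ext _ _ (fun i => u ^ 2 * f i ^ 2 + (- 2 * u * v) * (f i * g i) + v ^ 2 * g i ^ 2)) in P
      by (intros; ring).
    rewrite !rsum_plus, !rsum_scal in P. unfold A, B, X. lra. }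
  assert (0 <= A) by apply (P f). assert (0 <= B) by apply (P g).
  destruct (Req_dec B 0) as [E|E].
  - rewrite E in *. destruct (Req_dec X 0) as [EX|EX]; [rewrite EX; lra|].
    (* With [B = 0] the form is affine in [v], and this [v] brings it down to [-1]. *)
    assert (Q1 := Q 1 ((A + 1) / (2 * X))).
    replace (1 ^ 2 * A - 2 * 1 * ((A + 1) / (2 * X)) * X + ((A + 1) / (2 * X)) ^ 2 * 0)
      with (-1) in Q1 by (field; lra). lra.
  - assert (Q1 := Q B X).
    replace (B ^ 2 * A - 2 * B * X * X + X ^ 2 * B) with (B * (A * B - X ^ 2)) in Q1 by ring.
    assert (0 < B) by lra. assert (0 <= A * B - X ^ 2); [|lra].
    apply Rmult_le_reg_l with B; lra.
Qed.

Lemma sum_n_rsum (f : nat -> R) n : sum_n f n = rsum (S n) f.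
Proof.
  induction n as [|n IH]; [rewrite sum_O; simpl; ring|].
  rewrite sum_Sn, IH. reflexivity.
Qed.

Lemma is_series_rsum (f : nat -> R) l :
  is_series f l <-> is_lim_seq (fun n => rsum n f) l.
Proof.
  rewrite is_lim_seq_incr_1. unfold is_series, is_lim_seq. simpl.
  split; apply filterlim_ext; intros n; now rewrite sum_n_rsum.
Qed.

Lemma Rabs_le_inv x y : Rabs x <= y -> - y <= x <= y.
Proof. intros H. apply Rabs_le_between in H. lra. Qed.

Lemma Csum_fst n f : fst (Csum n f) = rsum n (fun i => fst (f i)).
Proof. induction n as [|n IH]; simpl; [easy|now rewrite IH]. Qed.

Lemma Csum_snd n f : snd (Csum n f) = rsum n (fun i => snd (f i)).
Proof. induction n as [|n IH]; simpl; [easy|now rewrite IH]. Qed.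

Lemma Csum_ext n f g : (forall i, (i < n)%nat -> f i = g i) -> Csum n f = Csum n g.
Proof. induction n as [|n IH]; intros H; simpl; [easy|]. rewrite IH, (H n); auto. Qed.

Lemma Csum_plus n f g : Csum n (fun i => f i + g i)%C = (Csum n f + Csum n g)%C.
Proof. induction n as [|n IH]; simpl; [ring|rewrite IH; ring]. Qed.

Lemma Csum_minus n f g : Csum n (fun i => f i - g i)%C = (Csum n f - Csum n g)%C.
Proof. induction n as [|n IH]; simpl; [ring|rewrite IH; ring]. Qed.

Lemma Csum_scal n (c : C) f : Csum n (fun i => c * f i)%C = (c * Csum n f)%C.
Proof. induction n as [|n IH]; simpl; [ring|rewrite IH; ring]. Qed.

Lemma Csum_swap n m (f : nat -> nat -> C) :
  Csum n (fun i => Csum m (fun j => f i j)) = Csum m (fun j => Csum n (fun i => f i j)).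
Proof.
  induction n as [|n IH]; simpl.
  - symmetry. induction m as [|m IHm]; simpl; [easy|rewrite IHm; ring].
  - rewrite IH. symmetry. apply Csum_plus.
Qed.

Lemma Csum_split n m f : Csum (n + m) f = (Csum n f + Csum m (fun i => f (n + i)%nat))%C.
Proof.
  induction m as [|m IH]; simpl; [rewrite Nat.add_0_r; ring|].
  rewrite Nat.add_succ_r; simpl; rewrite IH; ring.
Qed.

Lemma Cmod_Csum n f : Cmod (Csum n f) <= rsum n (fun i => Cmod (f i)).
Proof.
  induction n as [|n IH]; simpl; [rewrite Cmod_0; lra|].
  eapply Rle_trans; [apply Cmod_triangle|lra].
Qed.

Lemma Cpow_Defs z n : Defs.Cpow z n = (z ^ n)%C.
Proof. induction n as [|n IH]; simpl; [easy|now rewrite IH]. Qed.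

Lemma Cmod_fst_snd z : Cmod z <= Rabs (fst z) + Rabs (snd z).
Proof.
  unfold Cmod. assert (A := Rabs_pos (fst z)). assert (B := Rabs_pos (snd z)).
  apply Rsqr_incr_0_var; [|lra].
  rewrite Rsqr_sqrt by (generalize (pow2_ge_0 (fst z)) (pow2_ge_0 (snd z)); lra).
  unfold Rsqr. rewrite <- (pow2_abs (fst z)), <- (pow2_abs (snd z)). nra.
Qed.

Lemma fst_le_Cmod z : Rabs (fst z) <= Cmod z.
Proof. eapply Rle_trans; [apply Rmax_l|apply Rmax_Cmod]. Qed.

Lemma snd_le_Cmod z : Rabs (snd z) <= Cmod z.
Proof. eapply Rle_trans; [apply Rmax_r|apply Rmax_Cmod]. Qed.

Lemma Cmod_minus_sym z w : Cmod (z - w) = Cmod (w - z).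
Proof. rewrite <- Cmod_opp. f_equal. ring. Qed.

Lemma RtoC_neq0 x : x <> 0 -> RtoC x <> 0%C.
Proof. intros H F. injection F. exact H. Qed.

Lemma div_unit x y : 0 <= x < y -> 0 <= x / y < 1.
Proof.
  intros H. split; [apply Rdiv_le_0_compat; lra|].
  apply Rmult_lt_reg_r with y; [lra|]. unfold Rdiv. rewrite Rmult_assoc, Rinv_l; lra.
Qed.

Lemma is_lim_seq_geom_scal K q : 0 <= q < 1 -> is_lim_seq (fun m => K * q ^ m) 0.
Proof.
  intros Hq. replace (Finite 0) with (Rbar_mult K 0) by (simpl; f_equal; ring).
  apply is_lim_seq_scal_l, is_lim_seq_geom. rewrite Rabs_pos_eq; lra.
Qed.

Lemma Rabs_eps_zero x k : (forall eps, 0 < eps -> Rabs x <= k * eps) -> x = 0.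
Proof.
  intros H. destruct (Req_dec x 0) as [E|E]; [exact E|exfalso].
  assert (P := Rabs_pos_lt x E). assert (Q := Rabs_pos k). assert (Hk := Rle_abs k).
  set (e := Rabs x / (2 * (Rabs k + 1))).
  assert (e0 : 0 < e) by (apply Rdiv_lt_0_compat; lra).
  assert (Ex : Rabs x = 2 * (Rabs k + 1) * e) by (unfold e; field; lra).
  specialize (H e e0). nra.
Qed.

(** Supplies the subrectangle picked at each bisection step, and families of coefficients or
    primitives indexed by branch or power. *)
Lemma choice_fun {A B : Type} (P : A -> B -> Prop) :
  (forall x, exists y, P x y) -> exists f, forall x, P x (f x).
Proof.
  intros H. exists (fun x => proj1_sig (constructive_indefinite_description _ (H x))).
  intros x. apply proj2_sig.
Qed.

(** * Complex differentiability and integrals along paths *)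

(** Affine approximation with relative error [eps], the form in which the bisection argument
    consumes differentiability. The derivative is given at a single point, so no continuity of it is
    built in. *)
Definition cdiff (f : C -> C) (z l : C) : Prop :=
  forall eps, 0 < eps -> exists delta, 0 < delta /\ forall y,
    Cmod (y - z) < delta -> Cmod (f y - f z - l * (y - z)) <= eps * Cmod (y - z).

Lemma is_derive_cdiff (f : C -> C) (z l : C) :
  @is_derive C_AbsRing C_NormedModule f z l -> cdiff f z l.
Proof.
  intros [_ H] eps Heps.
  assert (Hz : is_filter_lim (locally (T := AbsRing_UniformSpace C_AbsRing) z) z) by (intros P HP; exact HP).
  specialize (H z Hz (mkposreal eps Heps)). destruct H as [d Hd].
  exists d. split; [apply cond_pos|]. intros y Hy.
  assert (B : @ball (AbsRing_UniformSpace C_AbsRing) z d y) by exact Hy.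
  specialize (Hd y B). simpl in Hd. rewrite (Cmult_comm l). exact Hd.
Qed.

Lemma continuous_eps (f : R -> R) t :
  continuous f t <-> forall eps, 0 < eps -> exists d, 0 < d /\
    forall y, Rabs (y - t) < d -> Rabs (f y - f t) < eps.
Proof.
  split.
  - intros H eps Heps. destruct (proj1 (filterlim_locally _ _) H (mkposreal eps Heps)) as [d Hd].
    exists d. split; [apply cond_pos|]. intros y Hy. apply Hd. exact Hy.
  - intros H. apply filterlim_locally. intros eps. destruct (H eps (cond_pos eps)) as [d [Hd Hf]].
    exists (mkposreal d Hd). intros y Hy. apply Hf. exact Hy.
Qed.

Definition ccont (p : R -> C) (t : R) : Prop :=
  continuous (fun x => fst (p x)) t /\ continuous (fun x => snd (p x)) t.

Lemma ccont_eps p t : ccont p t -> forall eps, 0 < eps -> exists d, 0 < d /\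
  forall y, Rabs (y - t) < d -> Cmod (p y - p t) < eps.
Proof.
  intros [H1 H2] eps Heps.
  destruct (proj1 (continuous_eps _ _) H1 (eps / 2)) as [d1 [D1 E1]]; [lra|].
  destruct (proj1 (continuous_eps _ _) H2 (eps / 2)) as [d2 [D2 E2]]; [lra|].
  exists (Rmin d1 d2). split; [now apply Rmin_glb_lt|]. intros y Hy.
  eapply Rle_lt_trans; [apply Cmod_fst_snd|].
  assert (A := E1 y (Rlt_le_trans _ _ _ Hy (Rmin_l _ _))).
  assert (B := E2 y (Rlt_le_trans _ _ _ Hy (Rmin_r _ _))). simpl in *. unfold Rminus in *. lra.
Qed.

Lemma eps_ccont p t : (forall eps, 0 < eps -> exists d, 0 < d /\
  forall y, Rabs (y - t) < d -> Cmod (p y - p t) < eps) -> ccont p t.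
Proof.
  intros H. split; apply continuous_eps; intros eps Heps; destruct (H eps Heps) as [d [Hd E]];
    exists d; (split; [exact Hd|]); intros y Hy; (eapply Rle_lt_trans; [|apply (E y Hy)]).
  - apply (fst_le_Cmod (p y - p t)%C).
  - apply (snd_le_Cmod (p y - p t)%C).
Qed.

Lemma cdiff_cont f z l : cdiff f z l -> forall eps, 0 < eps -> exists d, 0 < d /\
  forall y, Cmod (y - z) < d -> Cmod (f y - f z) < eps.
Proof.
  intros H eps Heps. destruct (H 1 Rlt_0_1) as [d [Hd E]].
  assert (P : 0 < eps / (2 + Cmod l)).
  { apply Rdiv_lt_0_compat; [lra|]. assert (A := Cmod_ge_0 l). lra. }
  exists (Rmin d (eps / (2 + Cmod l))). split; [now apply Rmin_glb_lt|]. intros y Hy.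
  specialize (E y (Rlt_le_trans _ _ _ Hy (Rmin_l _ _))).
  assert (Y := Rlt_le_trans _ _ _ Hy (Rmin_r _ _)).
  replace (f y - f z)%C with ((f y - f z - l * (y - z)) + l * (y - z))%C by ring.
  eapply Rle_lt_trans; [apply Cmod_triangle|]. rewrite Cmod_mult.
  assert (A := Cmod_ge_0 l).
  apply Rle_lt_trans with ((2 + Cmod l) * Cmod (y - z)).
  - assert (0 <= Cmod (y - z)) by apply Cmod_ge_0. nra.
  - apply Rmult_lt_reg_r with (/ (2 + Cmod l)); [apply Rinv_0_lt_compat; lra|].
    replace ((2 + Cmod l) * Cmod (y - z) * / (2 + Cmod l)) with (Cmod (y - z)) by (field; lra).
    exact Y.
Qed.

Lemma ccont_comp f p t l : ccont p t -> cdiff f (p t) l -> ccont (fun x => f (p x)) t.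
Proof.
  intros Hp Hf. apply eps_ccont. intros eps Heps.
  destruct (cdiff_cont _ _ _ Hf eps Heps) as [d1 [D1 E1]].
  destruct (ccont_eps _ _ Hp d1 D1) as [d [D E]].
  exists d; split; [exact D|]. intros y Hy. apply E1, E, Hy.
Qed.

Lemma ccont_const c t : ccont (fun _ => c) t.
Proof. split; apply continuous_const. Qed.

Lemma ccont_plus p q t : ccont p t -> ccont q t -> ccont (fun x => p x + q x)%C t.
Proof. intros [A B] [A' B']. split; simpl; now apply @continuous_plus. Qed.

Lemma ccont_minus p q t : ccont p t -> ccont q t -> ccont (fun x => p x - q x)%C t.
Proof. intros [A B] [A' B']. split; simpl; now apply @continuous_minus. Qed.

Lemma ccont_mult p q t : ccont p t -> ccont q t -> ccont (fun x => p x * q x)%C t.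
Proof.
  intros [A B] [A' B'].
  split; simpl; [apply @continuous_minus|apply @continuous_plus]; now apply @continuous_mult.
Qed.

Lemma ccont_inv (p : R -> C) t : p t <> 0 -> ccont p t -> ccont (fun x => / p x)%C t.
Proof.
  intros Hp [A B].
  assert (N : fst (p t) ^ 2 + snd (p t) ^ 2 <> 0).
  { intros E. apply Hp. apply Cmod_eq_0. unfold Cmod. now rewrite E, sqrt_0. }
  assert (I : continuous (fun x => / (fst (p x) ^ 2 + snd (p x) ^ 2)) t).
  { apply continuous_comp with (g := Rinv).
    - apply @continuous_plus; simpl; (apply @continuous_mult; [assumption|]);
        (apply @continuous_mult; [assumption|apply continuous_const]).
    - apply continuous_Rinv. exact N. }
  split; simpl; unfold Rdiv; apply @continuous_mult; try assumption.
  now apply @continuous_opp.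
Qed.

Lemma ccont_circle s t : ccont (circle s) t.
Proof.
  split; simpl; apply @continuous_mult; try apply continuous_const.
  - apply continuous_cos.
  - apply continuous_sin.
Qed.

(** * Integrals of complex functions over a full turn *)

Definition CI (f : R -> C) : C :=
  (RInt (fun t => fst (f t)) 0 (2 * PI), RInt (fun t => snd (f t)) 0 (2 * PI)).

Lemma ex_RInt_fst f a b : (forall t, ccont f t) -> ex_RInt (fun t => fst (f t)) a b.
Proof. intros H. apply (@ex_RInt_continuous R_CompleteNormedModule). intros t _. apply H. Qed.

Lemma ex_RInt_snd f a b : (forall t, ccont f t) -> ex_RInt (fun t => snd (f t)) a b.
Proof. intros H. apply (@ex_RInt_continuous R_CompleteNormedModule). intros t _. apply H. Qed.

Lemma CI_ext f g : (forall t, f t = g t) -> CI f = CI g.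
Proof. intros H. unfold CI. f_equal; apply RInt_ext; intros t _; now rewrite H. Qed.

Lemma CI_plus f g : (forall t, ccont f t) -> (forall t, ccont g t) ->
  CI (fun t => f t + g t)%C = (CI f + CI g)%C.
Proof.
  intros F G. unfold CI. apply injective_projections; simpl.
  - apply (RInt_plus (V := R_CompleteNormedModule)); now apply ex_RInt_fst.
  - apply (RInt_plus (V := R_CompleteNormedModule)); now apply ex_RInt_snd.
Qed.

Lemma CI_scal c f : (forall t, ccont f t) ->
  CI (fun t => c * f t)%C = (c * CI f)%C.
Proof.
  intros F. unfold CI. apply injective_projections; simpl.
  - apply is_RInt_unique, (is_RInt_minus (V := R_NormedModule));
      apply (is_RInt_scal (V := R_NormedModule)), (RInt_correct (V := R_CompleteNormedModule));
      [now apply ex_RInt_fst|now apply ex_RInt_snd].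
  - apply is_RInt_unique, (is_RInt_plus (V := R_NormedModule));
      apply (is_RInt_scal (V := R_NormedModule)), (RInt_correct (V := R_CompleteNormedModule));
      [now apply ex_RInt_snd|now apply ex_RInt_fst].
Qed.

(** The factor is [4 * PI] instead of [2 * PI] because real and imaginary parts are bounded
    separately. The spare 2 reappears in the Cauchy estimates. *)
Lemma CI_bound f M : (forall t, ccont f t) ->
  (forall t, Cmod (f t) <= M) -> Cmod (CI f) <= 4 * PI * M.
Proof.
  intros F H. assert (pi := PI_RGT_0). eapply Rle_trans; [apply Cmod_fst_snd|]. simpl.
  assert (Rabs (RInt (fun t => fst (f t)) 0 (2 * PI)) <= (2 * PI - 0) * M).
  { apply abs_RInt_le_const; [lra|now apply ex_RInt_fst|].
    intros t _. eapply Rle_trans; [apply fst_le_Cmod|apply H]. }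
  assert (Rabs (RInt (fun t => snd (f t)) 0 (2 * PI)) <= (2 * PI - 0) * M).
  { apply abs_RInt_le_const; [lra|now apply ex_RInt_snd|].
    intros t _. eapply Rle_trans; [apply snd_le_Cmod|apply H]. }
  lra.
Qed.

(* Goursat's bisection, for a subadditive function of rectangles that is
   o(diameter^2) at every point. *)
Lemma bisection (N : R -> R -> R -> R -> R) (u0 t0 A B : R) :
  0 < A -> 0 < B ->
  (forall u t a b, 0 < a -> 0 < b -> u0 <= u -> u + 2 * a <= u0 + A ->
     N u t (2 * a) (2 * b)
     <= N u t a b + N (u + a) t a b + N u (t + b) a b + N (u + a) (t + b) a b) ->
  (forall x y, u0 <= x <= u0 + A -> forall eps, 0 < eps ->
     exists delta, 0 < delta /\ forall u t a b, u0 <= u -> u + a <= u0 + A ->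
       0 < a < delta -> 0 < b < delta -> u <= x <= u + a -> t <= y <= t + b ->
       N u t a b <= eps * (a + b) ^ 2) ->
  forall eps, 0 < eps -> N u0 t0 A B <= eps * (A + B) ^ 2.
Proof.
  intros HA HB Hsub Hloc eps Heps. apply Rnot_lt_le. intros Hbad.
  set (al := fun k : nat => A / 2 ^ k). set (be := fun k : nat => B / 2 ^ k).
  assert (P2 : forall k, 0 < 2 ^ k) by (intros; apply pow_lt; lra).
  assert (al_pos : forall k, 0 < al k) by (intros; now apply Rdiv_lt_0_compat).
  assert (be_pos : forall k, 0 < be k) by (intros; now apply Rdiv_lt_0_compat).
  assert (al_S : forall k, al k = 2 * al (S k)).
  { intros k. unfold al. simpl. field. apply Rgt_not_eq, P2. }
  assert (be_S : forall k, be k = 2 * be (S k)).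
  { intros k. unfold be. simpl. field. apply Rgt_not_eq, P2. }
  set (bad := fun (k : nat) (p : R * R) => u0 <= fst p /\ fst p + al k <= u0 + A /\
    eps * (al k + be k) ^ 2 < N (fst p) (snd p) (al k) (be k)).
  (* If no quarter exceeded [eps * (a + b) ^ 2], subadditivity would bound the whole by four times
     this, which is [eps * (2 * a + 2 * b) ^ 2]; so badness passes to some quarter. Pairs that are
     not bad get the dummy [(0, 0)], which makes the choice total. *)
  assert (step : forall k p, exists p', bad k p ->
    bad (S k) p' /\ fst p <= fst p' <= fst p + al (S k) /\ snd p <= snd p' <= snd p + be (S k)).
  { intros k [u t]. destruct (classic (bad k (u, t))) as [[H1 [H2 H3]]|H];
      [|exists (0, 0); now intros].
    simpl in H1, H2, H3. rewrite (al_S k) in H2, H3. rewrite (be_S k) in H3.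
    assert (a0 := al_pos (S k)). assert (b0 := be_pos (S k)).
    set (a := al (S k)) in *. set (b := be (S k)) in *.
    assert (S0 := Hsub u t a b a0 b0 H1 H2).
    unfold bad. fold a b.
    destruct (Rlt_dec (eps * (a + b) ^ 2) (N u t a b)) as [L1|L1];
      [exists (u, t); simpl; intros _; repeat split; lra|].
    destruct (Rlt_dec (eps * (a + b) ^ 2) (N (u + a) t a b)) as [L2|L2];
      [exists (u + a, t); simpl; intros _; repeat split; lra|].
    destruct (Rlt_dec (eps * (a + b) ^ 2) (N u (t + b) a b)) as [L3|L3];
      [exists (u, t + b); simpl; intros _; repeat split; lra|].
    destruct (Rlt_dec (eps * (a + b) ^ 2) (N (u + a) (t + b) a b)) as [L4|L4];
      [exists (u + a, t + b); simpl; intros _; repeat split; lra|].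
    exfalso. lra. }
  destruct (choice_fun _ (fun kp => step (fst kp) (snd kp))) as [next Hnext].
  set (p := fix p k := match k with O => (u0, t0) | S k' => next (k', p k') end).
  assert (Pbad : forall k, bad k (p k)).
  { induction k as [|k IH].
    - unfold bad, al, be. simpl. unfold Rdiv. rewrite Rinv_1, !Rmult_1_r. repeat split; lra.
    - exact (proj1 (Hnext (k, p k) IH)). }
  assert (Pstep : forall k, fst (p k) <= fst (p (S k)) <= fst (p k) + al (S k)
                         /\ snd (p k) <= snd (p (S k)) <= snd (p k) + be (S k)).
  { intros k. exact (proj2 (Hnext (k, p k) (Pbad k))). }
  assert (shrink : forall X, is_lim_seq (fun k => X / 2 ^ k) 0).
  { intros X. apply is_lim_seq_ext with (fun k => X * (/ 2) ^ k).
    - intros k. unfold Rdiv. now rewrite pow_inv.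
    - replace (Finite 0) with (Rbar_mult X 0) by (simpl; f_equal; ring).
      apply is_lim_seq_scal_l, is_lim_seq_geom. rewrite Rabs_pos_eq; lra. }
  (* Nested intervals: left ends increase, right ends decrease and the widths vanish, so the common
     limit lies in every interval. *)
  assert (lim : forall (x w : nat -> R), (forall k, 0 < w k) -> (forall k, w k = 2 * w (S k)) ->
    is_lim_seq w 0 -> (forall k, x k <= x (S k) <= x k + w (S k)) ->
    exists l, forall k, x k <= l <= x k + w k).
  { intros x w w_pos w_S w_lim Hx.
    destruct (ex_lim_seq_adj x (fun k => x k + w k)) as [[l Hl] [[l' Hl'] E]].
    - intros k; apply Hx.
    - intros k. specialize (Hx k). rewrite (w_S k). lra.
    - apply is_lim_seq_ext with w; [intros; ring|exact w_lim].
    - rewrite (is_lim_seq_unique _ _ Hl), (is_lim_seq_unique _ _ Hl') in E.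
      injection E as <-. exists l. intros k. split.
      + apply (is_lim_seq_incr_compare x l Hl). intros n; apply Hx.
      + apply (is_lim_seq_decr_compare (fun k => x k + w k) l Hl').
        intros n. specialize (Hx n). rewrite (w_S n). lra. }
  destruct (lim (fun k => fst (p k)) al) as [x Hx]; auto; [apply shrink|intros; apply Pstep|].
  destruct (lim (fun k => snd (p k)) be) as [y Hy]; auto; [apply shrink|intros; apply Pstep|].
  assert (x_in : u0 <= x <= u0 + A).
  { generalize (Hx O). unfold al. simpl. unfold Rdiv. rewrite Rinv_1, Rmult_1_r. easy. }
  destruct (Hloc x y x_in eps Heps) as [d [Hd Hl]].
  assert (small : forall w : nat -> R, (forall k, 0 < w k) -> is_lim_seq w 0 ->
    exists k, forall n, (k <= n)%nat -> w n < d).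
  { intros w w_pos w_lim. destruct (proj2 (is_lim_seq_spec w 0) w_lim (mkposreal d Hd)) as [k Hk].
    exists k. intros n Hn. specialize (Hk n Hn). simpl in Hk.
    rewrite Rminus_0_r, Rabs_pos_eq in Hk; [exact Hk|apply Rlt_le, w_pos]. }
  destruct (small al al_pos (shrink A)) as [k1 Hk1].
  destruct (small be be_pos (shrink B)) as [k2 Hk2].
  set (k := Nat.max k1 k2).
  destruct (Pbad k) as [G1 [G2 G3]].
  assert (F := Hl (fst (p k)) (snd (p k)) (al k) (be k) G1 G2
    (conj (al_pos k) (Hk1 k (Nat.le_max_l _ _))) (conj (be_pos k) (Hk2 k (Nat.le_max_r _ _)))
    (Hx k) (Hy k)).
  lra.
Qed.

(** * Goursat's argument and Cauchy's formula *)

Lemma RIntR_Chasles (f : R -> R) a b c :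
  ex_RInt f a b -> ex_RInt f b c -> RInt f a c = RInt f a b + RInt f b c.
Proof. intros H1 H2. symmetry. exact (RInt_Chasles (V := R_CompleteNormedModule) f a b c H1 H2). Qed.

Lemma RIntR_plus (f g : R -> R) a b :
  ex_RInt f a b -> ex_RInt g a b -> RInt (fun x => f x + g x) a b = RInt f a b + RInt g a b.
Proof. exact (RInt_plus (V := R_CompleteNormedModule) f g a b). Qed.

Lemma RIntR_minus (f g : R -> R) a b :
  ex_RInt f a b -> ex_RInt g a b -> RInt (fun x => f x - g x) a b = RInt f a b - RInt g a b.
Proof. exact (RInt_minus (V := R_CompleteNormedModule) f g a b). Qed.

Lemma ex_RIntR_minus (f g : R -> R) a b :
  ex_RInt f a b -> ex_RInt g a b -> ex_RInt (fun x => f x - g x) a b.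
Proof. exact (ex_RInt_minus (V := R_NormedModule) f g a b). Qed.

Lemma ex_RInt_cont (f : R -> R) a b : a <= b ->
  (forall x, a <= x <= b -> continuous f x) -> ex_RInt f a b.
Proof.
  intros Hab H. apply (ex_RInt_continuous (V := R_CompleteNormedModule)). intros x Hx.
  apply H. now rewrite Rmin_left, Rmax_right in Hx.
Qed.

(** Compares the integral of [phi] with the exact increment of a primitive of a nearby [g]. In
    Goursat's argument [g] is the contribution of the affine part. *)
Lemma RInt_approx (phi G g : R -> R) a b eta : a <= b -> ex_RInt phi a b ->
  (forall x, is_derive G x (g x)) -> (forall x, continuous g x) ->
  (forall x, a <= x <= b -> Rabs (phi x - g x) <= eta) ->
  Rabs (RInt phi a b - (G b - G a)) <= (b - a) * eta.
Proof.
  intros Hab Hphi HG Hg H.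
  assert (Ig : is_RInt g a b (G b - G a)).
  { apply (is_RInt_derive (V := R_CompleteNormedModule)); intros x _; [apply HG|apply Hg]. }
  rewrite <- (is_RInt_unique _ _ _ _ Ig), <- RIntR_minus; [|exact Hphi|eexists; exact Ig].
  apply abs_RInt_le_const; [exact Hab| |exact H].
  apply ex_RIntR_minus; [exact Hphi|eexists; exact Ig].
Qed.

Lemma Cmod_circle s t : 0 <= s -> Cmod (circle s t) = s.
Proof.
  intros Hs. unfold Cmod, circle. simpl fst. simpl snd.
  replace ((s * cos t) ^ 2 + (s * sin t) ^ 2) with (s ^ 2 * (Rsqr (sin t) + Rsqr (cos t)))
    by (unfold Rsqr; ring).
  rewrite sin2_cos2, Rmult_1_r. now apply sqrt_pow2.
Qed.

Lemma lipschitz_derive (f f' : R -> R) k x y :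
  (forall z, Rmin x y <= z <= Rmax x y -> is_derive f z (f' z)) ->
  (forall z, Rmin x y <= z <= Rmax x y -> Rabs (f' z) <= k) ->
  Rabs (f y - f x) <= k * Rabs (y - x).
Proof.
  intros Hf Hk. destruct (MVT_gen f x y f') as [c [Hc E]].
  - intros z Hz. apply Hf. lra.
  - intros z Hz. apply continuity_pt_filterlim, (ex_derive_continuous f z).
    eexists; now apply Hf.
  - rewrite E, Rabs_mult. apply Rmult_le_compat_r; [apply Rabs_pos|now apply Hk].
Qed.

Lemma Cmod_circle_lipschitz s t t' : 0 <= s ->
  Cmod (circle s t - circle s t') <= 2 * s * Rabs (t - t').
Proof.
  intros Hs. eapply Rle_trans; [apply Cmod_fst_snd|]. simpl.
  assert (A : Rabs (cos t - cos t') <= 1 * Rabs (t - t')).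
  { apply (lipschitz_derive cos (fun z => - sin z)); intros z _.
    - auto_derive; [easy|ring].
    - rewrite Rabs_Ropp. apply Rabs_le. generalize (SIN_bound z); lra. }
  assert (B : Rabs (sin t - sin t') <= 1 * Rabs (t - t')).
  { apply (lipschitz_derive sin cos); intros z _.
    - auto_derive; [easy|ring].
    - apply Rabs_le. generalize (COS_bound z); lra. }
  replace (s * cos t + - (s * cos t')) with (s * (cos t - cos t')) by ring.
  replace (s * sin t + - (s * sin t')) with (s * (sin t - sin t')) by ring.
  rewrite !Rabs_mult, !(Rabs_pos_eq s) by exact Hs.
  assert (P := Rabs_pos (t - t')). nra.
Qed.

Lemma exp_lipschitz x x' : x <= 0 -> x' <= 0 -> Rabs (exp x - exp x') <= Rabs (x - x').
Proof.
  intros Hx Hx'. rewrite <- (Rmult_1_l (Rabs (x - x'))).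
  apply (lipschitz_derive exp exp); intros z Hz.
  - auto_derive; [easy|ring].
  - rewrite Rabs_pos_eq by (left; apply exp_pos). rewrite <- exp_0.
    assert (z <= 0) by (apply Rle_trans with (1 := proj2 Hz); now apply Rmax_lub).
    destruct (Req_dec z 0) as [->|E]; [lra|]. left; apply exp_increasing; lra.
Qed.

Lemma exp_le_1 x : x <= 0 -> exp x <= 1.
Proof.
  intros Hx. rewrite <- exp_0. destruct (Req_dec x 0) as [->|E]; [lra|].
  left; apply exp_increasing; lra.
Qed.

(* The disc of radius s seen from z0 in exponential polar coordinates:
   x = 0 is the circle |z| = s and x = -oo is the point z0. *)
Definition polar (z0 : C) (s x t : R) : C := (z0 + RtoC (exp x) * (circle s t - z0))%C.

(** This is [dz / (i (z - z0))] in the angle [t], as [dz = i z dt] on the circle. In the polar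
    coordinates above, [log (Z - z0)] has [x]-derivative 1 and [t]-derivative [i] times this kernel,
    independent of [x]. *)
Definition cauchy_kernel (z0 : C) (s t : R) : C := (circle s t / (circle s t - z0))%C.

Lemma polar_0 z0 s t : polar z0 s 0 t = circle s t.
Proof. unfold polar. rewrite exp_0. ring. Qed.

Lemma Cmod_polar z0 s x t : Cmod z0 <= s -> x <= 0 -> Cmod (polar z0 s x t) <= s.
Proof.
  intros Hz Hx. assert (0 <= s) by (eapply Rle_trans; [apply Cmod_ge_0|exact Hz]).
  replace (polar z0 s x t) with (RtoC (1 - exp x) * z0 + RtoC (exp x) * circle s t)%C
    by (unfold polar; rewrite RtoC_minus; ring).
  eapply Rle_trans; [apply Cmod_triangle|].
  assert (A := exp_pos x). assert (B := exp_le_1 x Hx).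
  rewrite !Cmod_mult, !Cmod_R, Cmod_circle, !Rabs_pos_eq by lra. nra.
Qed.

Lemma circle_minus_lower z0 s t : 0 <= s -> s - Cmod z0 <= Cmod (circle s t - z0).
Proof.
  intros Hs. assert (A := Cmod_triangle (circle s t - z0) z0).
  replace (circle s t - z0 + z0)%C with (circle s t) in A by ring.
  rewrite Cmod_circle in A by exact Hs. lra.
Qed.

Lemma circle_minus_neq0 z0 s t : Cmod z0 < s -> (circle s t - z0)%C <> 0.
Proof.
  intros Hz E. assert (0 <= s) by (generalize (Cmod_ge_0 z0); lra).
  assert (A := circle_minus_lower z0 s t H). rewrite E, Cmod_0 in A. lra.
Qed.

Lemma ccont_cauchy_kernel z0 s t : Cmod z0 < s -> ccont (cauchy_kernel z0 s) t.
Proof.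
  intros Hz. apply ccont_mult; [apply ccont_circle|].
  apply ccont_inv; [now apply circle_minus_neq0|].
  apply ccont_minus; [apply ccont_circle|apply ccont_const].
Qed.

Lemma Cmod_cauchy_kernel z0 s t : Cmod z0 < s ->
  Cmod (cauchy_kernel z0 s t) <= s / (s - Cmod z0).
Proof.
  intros Hz. assert (P := Cmod_ge_0 z0). assert (Hs : 0 <= s) by lra.
  unfold cauchy_kernel. rewrite Cmod_div by now apply circle_minus_neq0.
  rewrite Cmod_circle by exact Hs. apply Rmult_le_compat_l; [exact Hs|].
  apply Rinv_le_contravar; [lra|now apply circle_minus_lower].
Qed.

Lemma polar_lipschitz z0 s x x' t t' : Cmod z0 <= s -> x <= 0 -> x' <= 0 ->
  Cmod (polar z0 s x t - polar z0 s x' t') <= 2 * s * (Rabs (x - x') + Rabs (t - t')).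
Proof.
  intros Hz Hx Hx'. assert (P := Cmod_ge_0 z0). assert (Hs : 0 <= s) by lra.
  replace (polar z0 s x t - polar z0 s x' t')%C
    with (RtoC (exp x - exp x') * (circle s t - z0) + RtoC (exp x') * (circle s t - circle s t'))%C
    by (unfold polar; rewrite RtoC_minus; ring).
  eapply Rle_trans; [apply Cmod_triangle|]. rewrite !Cmod_mult, !Cmod_R.
  assert (A := exp_lipschitz x x' Hx Hx').
  assert (B := Cmod_circle_lipschitz s t t' Hs).
  rewrite (Rabs_pos_eq (exp x')) by (left; apply exp_pos).
  assert (D := exp_le_1 x' Hx'). assert (D' := exp_pos x').
  assert (E : Cmod (circle s t - z0) <= 2 * s).
  { unfold Cminus. eapply Rle_trans; [apply Cmod_triangle|].
    rewrite Cmod_opp, Cmod_circle by exact Hs. lra. }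
  assert (F := Cmod_ge_0 (circle s t - z0)). assert (F' := Cmod_ge_0 (circle s t - circle s t')).
  assert (Rabs (exp x - exp x') * Cmod (circle s t - z0) <= Rabs (x - x') * (2 * s))
    by (apply Rmult_le_compat; auto using Rabs_pos).
  assert (exp x' * Cmod (circle s t - circle s t') <= 1 * (2 * s * Rabs (t - t')))
    by (apply Rmult_le_compat; auto; lra).
  lra.
Qed.

Lemma ccont_polar_x z0 s x t : ccont (fun x => polar z0 s x t) x.
Proof.
  apply ccont_plus; [apply ccont_const|]. apply ccont_mult; [|apply ccont_const].
  split; simpl; [|apply continuous_const].
  apply (ex_derive_continuous exp). now auto_derive.
Qed.

Lemma ccont_polar_t z0 s x t : ccont (fun t => polar z0 s x t) t.
Proof.
  apply ccont_plus; [apply ccont_const|]. apply ccont_mult; [apply ccont_const|].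
  apply ccont_minus; [apply ccont_circle|apply ccont_const].
Qed.

Section Cauchy.

Variables (f f' : C -> C) (RR s : R) (z0 : C).
Hypothesis f_diff : forall z, Cmod z < RR -> cdiff f z (f' z).
Hypothesis s_lt : s < RR.
Hypothesis z0_lt : Cmod z0 < s.

Let Z := polar z0 s.
Let K := cauchy_kernel z0 s.
Let s_pos : 0 < s.
Proof. generalize (Cmod_ge_0 z0); lra. Qed.

Let Z_diff x t : x <= 0 -> cdiff f (Z x t) (f' (Z x t)).
Proof. intros Hx. apply f_diff. apply Rle_lt_trans with s; [apply Cmod_polar; lra|exact s_lt]. Qed.

Let fZ_x x t : x <= 0 -> ccont (fun x => f (Z x t)) x.
Proof. intros Hx. eapply ccont_comp; [apply ccont_polar_x|now apply Z_diff]. Qed.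

Let fZ_t x t : x <= 0 -> ccont (fun t => f (Z x t)) t.
Proof. intros Hx. eapply ccont_comp; [apply ccont_polar_t|now apply Z_diff]. Qed.

(** The integrand is paired across opposite edges of a rectangle: [side] takes the vertical edges at
    [u] and [v], [base] the horizontal ones at [t] and [w]. *)
Let side u v y := fst (K y * (f (Z v y) - f (Z u y)))%C.
Let base t w x := snd (f (Z x t)) - snd (f (Z x w)).

Let ex_side u v a b : u <= 0 -> v <= 0 -> ex_RInt (side u v) a b.
Proof.
  intros Hu Hv. apply (ex_RInt_fst (fun y => K y * (f (Z v y) - f (Z u y)))%C).
  intros t. apply ccont_mult; [now apply ccont_cauchy_kernel|].
  apply ccont_minus; now apply fZ_t.
Qed.

Let ex_base t w a b : a <= b -> b <= 0 -> ex_RInt (base t w) a b.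
Proof.
  intros Hab Hb. apply ex_RInt_cont; [exact Hab|]. intros x Hx.
  apply @continuous_minus; apply fZ_x; lra.
Qed.

(* Boundary integral of Im f dx + Re (K f) dt, i.e. of Im (f(Z) dZ / (Z - z0)). *)
Let J u t a b := RInt (base t (t + b)) u (u + a) + RInt (side u (u + a)) t (t + b).

(** Inner edges are traversed twice in opposite directions and cancel. *)
Let J_split u t a b : 0 < a -> 0 < b -> u + 2 * a <= 0 ->
  J u t (2 * a) (2 * b) = J u t a b + J (u + a) t a b + J u (t + b) a b + J (u + a) (t + b) a b.
Proof.
  intros Ha Hb Hu. unfold J.
  replace (u + 2 * a) with (u + a + a) in * by ring.
  replace (t + 2 * b) with (t + b + b) in * by ring.
  assert (S : forall l m, ex_RInt (side u (u + a + a)) l m) by (intros; apply ex_side; lra).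
  assert (S1 : forall l m, ex_RInt (side u (u + a)) l m) by (intros; apply ex_side; lra).
  assert (S2 : forall l m, ex_RInt (side (u + a) (u + a + a)) l m) by (intros; apply ex_side; lra).
  assert (E : forall l m, RInt (side u (u + a + a)) l m
              = RInt (side u (u + a)) l m + RInt (side (u + a) (u + a + a)) l m).
  { intros l m. rewrite <- RIntR_plus; [|apply S1|apply S2].
    apply RInt_ext. intros x _. unfold side. simpl. ring. }
  assert (E' : forall l m, l <= m -> m <= 0 -> RInt (base t (t + b + b)) l m
              = RInt (base t (t + b)) l m + RInt (base (t + b) (t + b + b)) l m).
  { intros l m Hlm Hm. rewrite <- RIntR_plus; [|now apply ex_base|now apply ex_base].
    apply RInt_ext. intros x _. unfold base. simpl. ring. }
  rewrite (RIntR_Chasles (side u (u + a + a)) t (t + b)); [|apply S|apply S].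
  rewrite (RIntR_Chasles (base t (t + b + b)) u (u + a)); [|apply ex_base; lra|apply ex_base; lra].
  rewrite !E, !E' by lra. ring.
Qed.

Let Kmax := s / (s - Cmod z0).

Let K_le y : Cmod (K y) <= Kmax.
Proof. now apply Cmod_cauchy_kernel. Qed.

Let Kmax_pos : 0 <= Kmax.
Proof. eapply Rle_trans; [apply Cmod_ge_0|apply (K_le 0)]. Qed.

(* The boundary integral of an affine function vanishes, so only the remainder counts. *)
Let J_affine (w c l : C) u t a b eta : 0 < a -> 0 < b -> u + a <= 0 ->
  (forall x y, u <= x <= u + a -> t <= y <= t + b ->
     Cmod (f (Z x y) - c - l * (Z x y - w)) <= eta) ->
  Rabs (J u t a b) <= a * (2 * eta) + b * (Kmax * (2 * eta)).
Proof.
  intros Ha Hb Hu H.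
  set (dc := (circle s t - circle s (t + b))%C).
  (* Between the horizontal edges the affine part differs by [exp x * (l * dc)], and [exp] is its
     own primitive. *)
  assert (A1 : Rabs (RInt (base t (t + b)) u (u + a)
     - (exp (u + a) * snd (l * dc)%C - exp u * snd (l * dc)%C)) <= (u + a - u) * (2 * eta)).
  { apply (RInt_approx _ (fun x => exp x * snd (l * dc)%C) (fun x => exp x * snd (l * dc)%C)).
    - lra.
    - apply ex_base; lra.
    - intros x. generalize (snd (l * dc)%C); intros k. auto_derive; [easy|ring].
    - intros x. generalize (snd (l * dc)%C); intros k.
      apply (ex_derive_continuous (fun x => exp x * k)). now auto_derive.
    - intros x Hx.
      replace (base t (t + b) x - exp x * snd (l * dc)%C)
        with (snd ((f (Z x t) - c - l * (Z x t - w)) - (f (Z x (t + b)) - c - l * (Z x (t + b) - w)))%C)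
        by (unfold base, dc, Z, polar; simpl; ring).
      eapply Rle_trans; [apply snd_le_Cmod|]. unfold Cminus at 1.
      eapply Rle_trans; [apply Cmod_triangle|]. rewrite Cmod_opp.
      assert (B1 := H x t Hx). assert (B2 := H x (t + b) Hx). lra. }
  set (de := exp (u + a) - exp u).
  assert (A2 : Rabs (RInt (side u (u + a)) t (t + b)
     - (de * snd (l * circle s (t + b))%C - de * snd (l * circle s t)%C)) <= (t + b - t) * (Kmax * (2 * eta))).
  { apply (RInt_approx _ (fun y => de * snd (l * circle s y)%C) (fun y => de * fst (l * circle s y)%C)).
    - lra.
    - apply ex_side; lra.
    - intros y. clearbody de. simpl. generalize (fst l) (snd l); intros l1 l2. auto_derive; [easy|ring].
    - intros y. clearbody de. apply (ex_derive_continuous (fun y => de * fst (l * circle s y)%C)). simpl.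
      generalize (fst l) (snd l); intros l1 l2. now auto_derive.
    - intros y Hy.
      (* Points with the same angle lie on one ray from [z0], so the denominator of the kernel
         cancels. What remains is a multiple of [circle s y], which has an explicit primitive. *)
      assert (E : (K y * (Z (u + a) y - Z u y) = RtoC de * circle s y)%C).
      { unfold K, cauchy_kernel, Z, polar, de. rewrite RtoC_minus. field.
        now apply circle_minus_neq0. }
      replace (side u (u + a) y - de * fst (l * circle s y)%C)
        with (fst (K y * ((f (Z (u + a) y) - c - l * (Z (u + a) y - w)) - (f (Z u y) - c - l * (Z u y - w))))%C).
      2:{ replace (K y * ((f (Z (u + a) y) - c - l * (Z (u + a) y - w)) - (f (Z u y) - c - l * (Z u y - w))))%C
            with (K y * (f (Z (u + a) y) - f (Z u y)) - l * (K y * (Z (u + a) y - Z u y)))%C by ring.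
          rewrite E. unfold side. simpl. ring. }
      eapply Rle_trans; [apply fst_le_Cmod|]. rewrite Cmod_mult.
      apply Rmult_le_compat; [apply Cmod_ge_0|apply Cmod_ge_0|apply K_le|].
      unfold Cminus at 1. eapply Rle_trans; [apply Cmod_triangle|]. rewrite Cmod_opp.
      assert (B1 := H (u + a) y). assert (B2 := H u y). lra. }
  (* The two affine contributions are opposite, and only the remainders are left. *)
  assert (E0 : exp (u + a) * snd (l * dc)%C - exp u * snd (l * dc)%C
     + (de * snd (l * circle s (t + b))%C - de * snd (l * circle s t)%C) = 0).
  { unfold dc, de. simpl. ring. }
  unfold J. apply Rabs_le_inv in A1. apply Rabs_le_inv in A2. apply Rabs_le. lra.
Qed.

(** Bisection applied to the modulus of [J]. The right edge is at [x = 0], that is on the circle, so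
    all subrectangles stay in the closed disc of radius [s]. *)
Let J_zero u t a b : 0 < a -> 0 < b -> u + a = 0 -> J u t a b = 0.
Proof.
  intros Ha Hb Hu.
  assert (B : forall eps, 0 < eps -> Rabs (J u t a b) <= eps * (a + b) ^ 2).
  { apply (bisection (fun u t a b => Rabs (J u t a b)) u t a b Ha Hb).
    - intros u' t' a' b' Ha' Hb' H1 H2. rewrite J_split by lra.
      eapply Rle_trans; [apply Rabs_triang|]. apply Rplus_le_compat_r.
      eapply Rle_trans; [apply Rabs_triang|]. apply Rplus_le_compat_r. apply Rabs_triang.
    - intros x y Hx eps Heps.
      assert (Hx0 : x <= 0) by lra.
      (* With this [q] the remainder, at most [4 * s * (1 + Kmax) * (eps / q) * (a' + b') ^ 2], is
         half of the allowed error. *)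
      set (q := (1 + Kmax) * 8 * s).
      assert (Hq : 0 < q) by (unfold q; nra).
      destruct (Z_diff x y Hx0 (eps / q)) as [d [Hd E]]; [now apply Rdiv_lt_0_compat|].
      exists (d / (8 * s)). split; [apply Rdiv_lt_0_compat; lra|].
      intros u' t' a' b' H1 H2 Ha' Hb' Hxu Hyt.
      assert (L : (a' + b') * (2 * s) < d).
      { apply Rlt_le_trans with ((d / (8 * s) + d / (8 * s)) * (2 * s)); [nra|].
        replace ((d / (8 * s) + d / (8 * s)) * (2 * s)) with (d / 2) by (field; lra). lra. }
      set (eta := eps / q * (2 * s * (a' + b'))).
      assert (Q : Rabs (J u' t' a' b') <= a' * (2 * eta) + b' * (Kmax * (2 * eta))).
      { apply (J_affine (Z x y) (f (Z x y)) (f' (Z x y))); [lra|lra|lra|].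
        intros x' y' Hx' Hy'.
        assert (D : Cmod (Z x' y' - Z x y) <= 2 * s * (a' + b')).
        { eapply Rle_trans; [apply polar_lipschitz; lra|].
          apply Rmult_le_compat_l; [lra|]. apply Rplus_le_compat; apply Rabs_le; lra. }
        eapply Rle_trans; [apply E; lra|]. unfold eta.
        apply Rmult_le_compat_l; [left; now apply Rdiv_lt_0_compat|exact D]. }
      eapply Rle_trans; [exact Q|].
      assert (Heta : 0 <= eta).
      { unfold eta. apply Rmult_le_pos; [left; now apply Rdiv_lt_0_compat|nra]. }
      apply Rle_trans with ((1 + Kmax) * 2 * eta * (a' + b')); [|].
      + assert (0 <= Kmax * eta * a') by (apply Rmult_le_pos; [now apply Rmult_le_pos|lra]).
        assert (0 <= eta * b') by (apply Rmult_le_pos; lra). nra.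
      + unfold eta. replace ((1 + Kmax) * 2 * (eps / q * (2 * s * (a' + b'))) * (a' + b'))
          with (eps * (a' + b') ^ 2 * / 2) by (unfold q; field; lra).
        assert (0 <= eps * (a' + b') ^ 2) by (apply Rmult_le_pos; [lra|apply pow2_ge_0]). lra. }
  apply (Rabs_eps_zero _ ((a + b) ^ 2)). intros eps Heps. rewrite Rmult_comm. now apply B.
Qed.

Let circle_2PI : circle s (2 * PI) = circle s 0.
Proof. unfold circle. now rewrite cos_2PI, sin_2PI, cos_0, sin_0. Qed.

(** [J] vanishes on the rectangle [[-U, 0] x [0, 2 PI]]. Its horizontal edges have the same image by
    periodicity and cancel, so the circle and the inner curve at [x = -U] carry the same integral;
    as [U] grows the inner curve shrinks to [z0], where [f] is continuous. The imaginary part will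
    follow by applying this to [- Ci * f]. *)
Lemma cauchy_re :
  RInt (fun t => fst (cauchy_kernel z0 s t * (f (circle s t) - f z0))%C) 0 (2 * PI) = 0.
Proof.
  assert (pi := PI_RGT_0).
  assert (Hc : forall t, ccont (fun t => f (circle s t)) t).
  { intros t. eapply ccont_comp; [apply ccont_circle|]. apply f_diff. rewrite Cmod_circle; lra. }
  assert (S0 : forall U, 0 < U -> RInt (side (- U) 0) 0 (2 * PI) = 0).
  { intros U HU. assert (E := J_zero (- U) 0 U (2 * PI) HU). unfold J in E.
    replace (- U + U) with 0 in E by ring. replace (0 + 2 * PI) with (2 * PI) in E by ring.
    rewrite (RInt_ext (base 0 (2 * PI)) (fun _ => 0)) in E.
    - rewrite RInt_const in E. unfold scal in E; simpl in E; unfold mult in E; simpl in E.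
      assert (F : (0 - - U) * 0 + RInt (side (- U) 0) 0 (2 * PI) = 0) by (apply E; lra). lra.
    - intros x _. unfold base, Z, polar. rewrite circle_2PI. apply Rplus_opp_r. }
  set (G := fun t => fst (cauchy_kernel z0 s t * (f (circle s t) - f z0))%C).
  assert (exG : ex_RInt G 0 (2 * PI)).
  { apply (ex_RInt_fst (fun t => cauchy_kernel z0 s t * (f (circle s t) - f z0))%C).
    intros t. apply ccont_mult; [now apply ccont_cauchy_kernel|].
    apply ccont_minus; [apply Hc|apply ccont_const]. }
  assert (B : forall eps, 0 < eps -> Rabs (RInt G 0 (2 * PI)) <= (2 * PI - 0) * (Kmax * eps)).
  { intros eps Heps.
    destruct (cdiff_cont f z0 _ (f_diff z0 (Rlt_trans _ _ _ z0_lt s_lt)) eps Heps) as [d [Hd E]].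
    (* [exp U > U >= 2 * s / d] puts the inner curve within [d] of [z0]. *)
    assert (HU : exists U, 0 < U /\ exp (- U) * (2 * s) < d).
    { exists (Rmax 1 (2 * s / d)). assert (M1 := Rmax_l 1 (2 * s / d)). assert (M2 := Rmax_r 1 (2 * s / d)).
      set (U := Rmax 1 (2 * s / d)) in *. split; [lra|].
      assert (X := exp_ineq1 U). rewrite exp_Ropp.
      apply Rmult_lt_reg_l with (exp U); [apply exp_pos|].
      replace (exp U * (/ exp U * (2 * s))) with (2 * s) by (field; apply Rgt_not_eq, exp_pos).
      assert (U * d >= 2 * s).
      { apply Rle_ge. apply Rmult_le_reg_r with (/ d); [now apply Rinv_0_lt_compat|].
        replace (U * d * / d) with U by (field; lra). exact M2. }
      assert (U < exp U) by lra. nra. }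
    destruct HU as [U [HU1 HU2]].
    replace (RInt G 0 (2 * PI)) with (RInt (fun t => G t - side (- U) 0 t) 0 (2 * PI)).
    2:{ rewrite RIntR_minus; [|exact exG|apply ex_side; lra]. rewrite (S0 U HU1). apply Rminus_0_r. }
    apply abs_RInt_le_const; [lra|apply ex_RIntR_minus; [exact exG|apply ex_side; lra]|].
    intros t _.
    replace (G t - side (- U) 0 t) with (fst (K t * (f (Z (- U) t) - f z0))%C).
    2:{ unfold G, side. unfold Z at 2. rewrite polar_0. unfold K. simpl. ring. }
    eapply Rle_trans; [apply fst_le_Cmod|]. rewrite Cmod_mult.
    apply Rmult_le_compat; [apply Cmod_ge_0|apply Cmod_ge_0|apply K_le|]. left. apply E.
    unfold Z, polar. replace (z0 + RtoC (exp (- U)) * (circle s t - z0) - z0)%C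
      with (RtoC (exp (- U)) * (circle s t - z0))%C by ring.
    rewrite Cmod_mult, Cmod_R, Rabs_pos_eq by (left; apply exp_pos).
    eapply Rle_lt_trans; [|exact HU2]. apply Rmult_le_compat_l; [left; apply exp_pos|].
    unfold Cminus. eapply Rle_trans; [apply Cmod_triangle|]. rewrite Cmod_opp, Cmod_circle; lra. }
  apply (Rabs_eps_zero _ ((2 * PI - 0) * Kmax)). intros eps Heps. rewrite Rmult_assoc. now apply B.
Qed.

End Cauchy.

(** * Power series of a bounded holomorphic function *)

Lemma circle_scal s t : circle s t = (RtoC s * circle 1 t)%C.
Proof. apply injective_projections; simpl; ring. Qed.

Lemma circle_add x y : (circle 1 x * circle 1 y)%C = circle 1 (x + y).
Proof. apply injective_projections; simpl; rewrite ?cos_plus, ?sin_plus; ring. Qed.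

Lemma circle_pow t n : (circle 1 t ^ n)%C = circle 1 (INR n * t).
Proof.
  induction n as [|n IH].
  - simpl. rewrite Rmult_0_l. apply injective_projections; simpl; rewrite ?cos_0, ?sin_0; ring.
  - rewrite Cpow_S, IH, circle_add, S_INR. f_equal; ring.
Qed.

Lemma circle_inv s t : s <> 0 -> (/ circle s t = RtoC (/ s) * circle 1 (- t))%C.
Proof.
  intros Hs. assert (E : (circle 1 t * circle 1 (- t) = 1)%C).
  { rewrite circle_add, Rplus_opp_r. apply injective_projections; simpl; rewrite ?cos_0, ?sin_0; ring. }
  assert (N : circle 1 t <> 0%C).
  { intros F. rewrite F, Cmult_0_l in E. injection E. lra. }
  assert (N' : RtoC s <> 0%C) by (apply RtoC_neq0; lra).
  rewrite circle_scal, RtoC_inv by exact Hs.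
  replace (circle 1 (- t)) with (/ circle 1 t)%C; [field; now split|].
  transitivity (circle 1 t * circle 1 (- t) * / circle 1 t)%C; [rewrite E; ring|now field].
Qed.

Lemma circle_neq0 s t : 0 < s -> circle s t <> 0%C.
Proof. intros Hs E. assert (A := Cmod_circle s t (Rlt_le _ _ Hs)). rewrite E, Cmod_0 in A. lra. Qed.

Lemma ccont_harmonic k t : ccont (fun t => circle 1 (k * t)) t.
Proof.
  split.
  - apply (ex_derive_continuous (fun t => 1 * cos (k * t))). now auto_derive.
  - apply (ex_derive_continuous (fun t => 1 * sin (k * t))). now auto_derive.
Qed.

Lemma CI_harmonic_0 : CI (fun t => circle 1 (0 * t)) = RtoC (2 * PI).
Proof.
  unfold CI. apply injective_projections; simpl.
  - rewrite (RInt_ext _ (fun _ => 1)).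
    + rewrite RInt_const. unfold scal; simpl; unfold mult; simpl. ring.
    + intros t _. rewrite Rmult_0_l, cos_0. apply Rmult_1_l.
  - rewrite (RInt_ext _ (fun _ => 0)).
    + rewrite RInt_const. unfold scal; simpl; unfold mult; simpl. ring.
    + intros t _. rewrite Rmult_0_l, sin_0. apply Rmult_0_r.
Qed.

Lemma sin_cos_2PI_Z (k : Z) : sin (IZR k * (2 * PI)) = 0 /\ cos (IZR k * (2 * PI)) = 1.
Proof.
  assert (S : sin (IZR k * (2 * PI)) = 0).
  { apply sin_eq_0_1. exists (2 * k)%Z. rewrite mult_IZR. ring. }
  split; [exact S|].
  replace (IZR k * (2 * PI)) with (2 * (IZR k * PI)) by ring.
  rewrite cos_2a_sin, (sin_eq_0_1 (IZR k * PI)) by now exists k. ring.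
Qed.

Lemma CI_harmonic (k : Z) : k <> 0%Z -> CI (fun t => circle 1 (IZR k * t)) = 0%C.
Proof.
  intros Hk. assert (N : IZR k <> 0) by now apply not_0_IZR.
  destruct (sin_cos_2PI_Z k) as [S0 C0].
  unfold CI. apply injective_projections; simpl; apply is_RInt_unique.
  - replace 0 with (minus (sin (IZR k * (2 * PI)) / IZR k) (sin (IZR k * 0) / IZR k)) at 2.
    + apply (is_RInt_derive (V := R_CompleteNormedModule) (fun t => sin (IZR k * t) / IZR k)); intros t _.
      * auto_derive; [easy|now field].
      * apply (ex_derive_continuous (fun t => 1 * cos (IZR k * t))). now auto_derive.
    + rewrite S0, Rmult_0_r, sin_0. unfold minus, plus, opp; simpl. field. exact N.
  - replace 0 with (minus (- cos (IZR k * (2 * PI)) / IZR k) (- cos (IZR k * 0) / IZR k)) at 2.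
    + apply (is_RInt_derive (V := R_CompleteNormedModule) (fun t => - cos (IZR k * t) / IZR k)); intros t _.
      * auto_derive; [easy|now field].
      * apply (ex_derive_continuous (fun t => 1 * sin (IZR k * t))). now auto_derive.
    + rewrite C0, Rmult_0_r, cos_0. unfold minus, plus, opp; simpl. field. exact N.
Qed.

Lemma ccont_Csum m (h : nat -> R -> C) t : (forall n, ccont (h n) t) ->
  ccont (fun t => Csum m (fun n => h n t)) t.
Proof.
  intros H. induction m as [|m IH]; simpl; [apply ccont_const|now apply ccont_plus].
Qed.

Lemma CI_Csum m (h : nat -> R -> C) : (forall n t, ccont (h n) t) ->
  CI (fun t => Csum m (fun n => h n t)) = Csum m (fun n => CI (h n)).
Proof.
  intros H. induction m as [|m IH]; simpl.
  - unfold CI. simpl. rewrite !RInt_const. apply injective_projections; simpl;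
      unfold scal; simpl; unfold mult; simpl; ring.
  - rewrite CI_plus, IH; auto. intros t. apply ccont_Csum. auto.
Qed.

Definition Clim (u : nat -> C) (l : C) : Prop := is_lim_seq (fun m => Cmod (u m - l)) 0.

Lemma Clim_geom u l K q : 0 <= q < 1 -> (forall m, Cmod (u m - l) <= K * q ^ m) -> Clim u l.
Proof.
  intros Hq H. apply is_lim_seq_le_le with (fun _ => 0) (fun m => K * q ^ m).
  - intros m. split; [apply Cmod_ge_0|apply H].
  - apply is_lim_seq_const.
  - now apply is_lim_seq_geom_scal.
Qed.

Lemma Clim_unique u l l' : Clim u l -> Clim u l' -> l = l'.
Proof.
  intros H H'. assert (E : Cmod (l - l') = 0).
  { apply Rle_antisym; [|apply Cmod_ge_0].
    assert (L : is_lim_seq (fun m => Cmod (u m - l) + Cmod (u m - l')) (0 + 0)) by now apply is_lim_seq_plus'.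
    rewrite Rplus_0_r in L.
    apply (is_lim_seq_le (fun _ => Cmod (l - l')) _ (Cmod (l - l')) 0 ) with (2 := is_lim_seq_const _) (3 := L).
    intros m. replace (l - l')%C with ((u m - l') + - (u m - l))%C by ring.
    eapply Rle_trans; [apply Cmod_triangle|]. rewrite Cmod_opp. lra. }
  apply Cmod_eq_0 in E. replace l with (l - l' + l')%C by ring. rewrite E. ring.
Qed.

Lemma Cgeom (x : C) m : (Csum m (fun n => x ^ n) * (1 - x) = 1 - x ^ m)%C.
Proof.
  induction m as [|m IH]; simpl; [ring|]. rewrite Cmult_plus_distr_r, IH. ring.
Qed.

(** The kernel equals [1 / (1 - z0 / circle s t)]. This is the finite geometric sum with its exact
    remainder, in which the kernel occurs again. *)
Lemma cauchy_kernel_expansion z0 s t m : Cmod z0 < s ->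
  cauchy_kernel z0 s t
  = (Csum m (fun n => (z0 / RtoC s) ^ n * circle 1 (- INR n * t)%R)
     + (z0 / RtoC s) ^ m * circle 1 (- INR m * t)%R * cauchy_kernel z0 s t)%C.
Proof.
  intros Hz. assert (Hs : 0 < s) by (generalize (Cmod_ge_0 z0); lra).
  set (x := (z0 * / circle s t)%C).
  assert (X : forall n, ((z0 / RtoC s) ^ n * circle 1 (- INR n * t)%R = x ^ n)%C).
  { intros n. unfold x. rewrite circle_inv by lra.
    replace (- INR n * t) with (INR n * - t) by ring. rewrite <- circle_pow, <- Cpow_mult_l.
    f_equal. unfold Cdiv. rewrite RtoC_inv by lra. ring. }
  rewrite X, (Csum_ext _ _ (fun n => x ^ n)%C) by (intros; apply X).
  assert (Kx : (cauchy_kernel z0 s t * (1 - x) = 1)%C).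
  { unfold cauchy_kernel, x. field. split; [now apply circle_neq0|now apply circle_minus_neq0]. }
  transitivity (cauchy_kernel z0 s t * (1 - x ^ m) + x ^ m * cauchy_kernel z0 s t)%C; [ring|].
  rewrite <- Cgeom, (Cmult_comm (Csum _ _)), Cmult_assoc, Kx. ring.
Qed.

(** The sum is finite before integration, so only the remainder has to be bounded. Used with [h = 1]
    and with [h] the boundary values of a holomorphic function. *)
Lemma CI_kernel_expansion (h : R -> C) z0 s B m : Cmod z0 < s -> (forall t, ccont h t) ->
  (forall t, Cmod (h t) <= B) ->
  Cmod (CI (fun t => cauchy_kernel z0 s t * h t)%C
        - Csum m (fun n => (z0 / RtoC s) ^ n * CI (fun t => circle 1 (- INR n * t)%R * h t))%C)
  <= 4 * PI * (s / (s - Cmod z0)) * B * (Cmod z0 / s) ^ m.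
Proof.
  intros Hz Hh HB. assert (pi := PI_RGT_0). assert (P := Cmod_ge_0 z0).
  assert (Hs : 0 < s) by lra.
  set (r := fun t => ((z0 / RtoC s) ^ m * (circle 1 (- INR m * t)%R * (cauchy_kernel z0 s t * h t)))%C).
  assert (Hr : forall t, ccont r t).
  { intros t. apply ccont_mult; [apply ccont_const|]. apply ccont_mult; [apply ccont_harmonic|].
    apply ccont_mult; [now apply ccont_cauchy_kernel|apply Hh]. }
  assert (Hn : forall n t, ccont (fun t => circle 1 (- INR n * t)%R * h t)%C t).
  { intros n t. apply ccont_mult; [apply ccont_harmonic|apply Hh]. }
  assert (Hn' : forall n t, ccont (fun t => (z0 / RtoC s) ^ n * (circle 1 (- INR n * t)%R * h t))%C t).
  { intros n t. apply ccont_mult; [apply ccont_const|apply Hn]. }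
  rewrite (CI_ext _ (fun t => Csum m (fun n => (z0 / RtoC s) ^ n * (circle 1 (- INR n * t)%R * h t)) + r t)%C).
  2:{ intros t. rewrite (cauchy_kernel_expansion z0 s t m Hz) at 1. unfold r.
      rewrite Cmult_plus_distr_r. f_equal; [|ring].
      rewrite (Cmult_comm _ (h t)), <- Csum_scal. apply Csum_ext. intros; ring. }
  rewrite CI_plus; [|intros t; apply (ccont_Csum m _ t); intros; apply Hn'|exact Hr].
  rewrite CI_Csum by exact Hn'.
  rewrite (Csum_ext _ (fun n => CI (fun t => (z0 / RtoC s) ^ n * (circle 1 (- INR n * t)%R * h t))%C)
     (fun n => (z0 / RtoC s) ^ n * CI (fun t => circle 1 (- INR n * t)%R * h t))%C)
    by (intros n _; apply CI_scal, Hn).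
  match goal with |- Cmod (?a + ?b - ?a) <= _ => replace (a + b - a)%C with b by ring end.
  eapply Rle_trans; [apply CI_bound with (M := (Cmod z0 / s) ^ m * (1 * (s / (s - Cmod z0) * B)))|].
  - exact Hr.
  - intros t. unfold r. rewrite !Cmod_mult, Cmod_pow, Cmod_circle by lra.
    assert (Ns : RtoC s <> 0%C) by (apply RtoC_neq0; lra).
    rewrite Cmod_div, Cmod_R, (Rabs_pos_eq s) by (assumption || lra).
    apply Rmult_le_compat_l.
    + apply pow_le. apply Rdiv_le_0_compat; lra.
    + apply Rmult_le_compat_l; [lra|].
      apply Rmult_le_compat; try apply Cmod_ge_0; [now apply Cmod_cauchy_kernel|apply HB].
  - apply Req_le. ring.
Qed.

Lemma power_series_of_cdiff (f f' : C -> C) (RR s B : R) :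
  0 < s < RR -> (forall z, Cmod z < RR -> cdiff f z (f' z)) ->
  (forall z, Cmod z < RR -> Cmod (f z) <= B) ->
  exists c : nat -> C, (forall n, Cmod (c n) <= 2 * B / s ^ n) /\
    forall z, Cmod z < s -> Clim (fun m => Csum m (fun n => c n * z ^ n)%C) (f z).
Proof.
  intros Hs Hf HB. assert (pi := PI_RGT_0).
  assert (Hp : 0 < 2 * PI) by lra.
  set (h := fun t => f (circle s t)).
  assert (h_cont : forall t, ccont h t).
  { intros t. eapply ccont_comp; [apply ccont_circle|]. apply Hf. rewrite Cmod_circle; lra. }
  assert (h_B : forall t, Cmod (h t) <= B) by (intros t; apply HB; rewrite Cmod_circle; lra).
  set (b := fun n : nat => CI (fun t => circle 1 (- INR n * t)%R * h t)%C).
  assert (Ns : RtoC s <> 0%C) by (apply RtoC_neq0; lra).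
  assert (Npi : RtoC (2 * PI) <> 0%C) by (apply RtoC_neq0; lra).
  (* The Cauchy coefficients, with [b n] the Fourier integral over the circle of radius [s]. *)
  exists (fun n => / RtoC (2 * PI) * / RtoC s ^ n * b n)%C. split.
  - intros n. rewrite !Cmod_mult, !Cmod_inv, Cmod_pow, !Cmod_R, !Rabs_pos_eq
      by (lra || assumption || (apply Cpow_nz; assumption)).
    assert (L : Cmod (b n) <= 4 * PI * B).
    { apply CI_bound.
      - intros t. apply ccont_mult; [apply ccont_harmonic|apply h_cont].
      - intros t. rewrite Cmod_mult, Cmod_circle, Rmult_1_l by lra. apply h_B. }
    assert (S : 0 < s ^ n) by (apply pow_lt; lra).
    apply Rle_trans with (/ (2 * PI) * / s ^ n * (4 * PI * B)).
    + apply Rmult_le_compat_l; [|exact L].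
      apply Rmult_le_pos; left; now apply Rinv_0_lt_compat.
    + apply Req_le. field. lra.
  - intros z Hz. assert (P := Cmod_ge_0 z).
    assert (Hq : 0 <= Cmod z / s < 1) by now apply div_unit.
    assert (K_cont : forall t, ccont (cauchy_kernel z s) t) by (intros; now apply ccont_cauchy_kernel).
    (* Only the harmonic of order 0 has a nonzero integral, so every nonempty partial sum of the
       expansion already equals [2 * PI]. *)
    assert (K1 : CI (cauchy_kernel z s) = RtoC (2 * PI)).
    { apply Clim_unique with (fun m => Csum m (fun n => (z / RtoC s) ^ n
          * CI (fun t => circle 1 (- INR n * t)%R * 1))%C).
      - apply Clim_geom with (4 * PI * (s / (s - Cmod z)) * 1) (Cmod z / s); [exact Hq|].
        intros m. rewrite Cmod_minus_sym.
        rewrite (CI_ext _ (fun t => cauchy_kernel z s t * 1)%C) by (intros; ring).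
        apply CI_kernel_expansion; [exact Hz|intros; apply ccont_const|intros; rewrite Cmod_1; lra].
      - assert (E : forall m, Csum (S m) (fun n => (z / RtoC s) ^ n
          * CI (fun t => circle 1 (- INR n * t)%R * 1))%C = RtoC (2 * PI)).
        { induction m as [|m IH].
          - simpl. rewrite (CI_ext _ (fun t => circle 1 (0 * t)))
              by (intros; rewrite Ropp_0; ring). rewrite CI_harmonic_0. ring.
          - change (Csum (S (S m)) ?g) with (Csum (S m) g + g (S m))%C. rewrite IH.
            rewrite (CI_ext _ (fun t => circle 1 (IZR (- Z.of_nat (S m)) * t)))
              by (intros; rewrite opp_IZR, <- INR_IZR_INZ; ring).
            rewrite CI_harmonic by lia. ring. }
        unfold Clim. apply is_lim_seq_incr_1.
        apply is_lim_seq_ext with (fun _ => 0); [|apply is_lim_seq_const].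
        intros m. rewrite E. unfold Cminus. now rewrite Cplus_opp_r, Cmod_0. }
    assert (Kf : CI (fun t => cauchy_kernel z s t * h t)%C = (RtoC (2 * PI) * f z)%C).
    { assert (D_cont : forall t, ccont (fun t => cauchy_kernel z s t * (h t - f z))%C t).
      { intros t. apply ccont_mult; [apply K_cont|].
        apply ccont_minus; [apply h_cont|apply ccont_const]. }
      rewrite (CI_ext _ (fun t => cauchy_kernel z s t * (h t - f z) + f z * cauchy_kernel z s t)%C)
        by (intros; ring).
      rewrite CI_plus, CI_scal, K1; [| exact K_cont | exact D_cont |].
      2:{ intros t. apply ccont_mult; [apply ccont_const|apply K_cont]. }
      replace (CI (fun t => cauchy_kernel z s t * (h t - f z))%C) with (RtoC 0); [ring|].
      (* The real part vanishes by [cauchy_re]; the imaginary part of the integral is the real part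
         of [- Ci] times it. *)
      symmetry. unfold CI. apply injective_projections.
      - apply (cauchy_re f f' RR); [exact Hf|lra|exact Hz].
      - simpl fst; simpl snd.
        transitivity (RInt (fun t => fst (cauchy_kernel z s t * (- Ci * f (circle s t) - - Ci * f z))%C) 0 (2 * PI)).
        + apply RInt_ext. intros t _. unfold h. simpl. ring.
        + apply (cauchy_re (fun w => - Ci * f w)%C (fun w => - Ci * f' w)%C RR s z);
            [intros w Hw eps Heps|lra|exact Hz].
          destruct (Hf w Hw eps Heps) as [d [Hd E]]. exists d. split; [exact Hd|]. intros y Hy.
          replace (- Ci * f y - - Ci * f w - - Ci * f' w * (y - w))%C
            with (- Ci * (f y - f w - f' w * (y - w)))%C by ring.
          rewrite Cmod_mult, Cmod_opp, Cmod_Ci, Rmult_1_l. now apply E. }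
    apply Clim_geom with (/ (2 * PI) * (4 * PI * (s / (s - Cmod z)) * B)) (Cmod z / s); [exact Hq|].
    intros m. rewrite Rmult_assoc.
    replace (Csum m (fun n => / RtoC (2 * PI) * / RtoC s ^ n * b n * z ^ n) - f z)%C
      with (/ RtoC (2 * PI) * (Csum m (fun n => (z / RtoC s) ^ n * b n) - RtoC (2 * PI) * f z))%C.
    + rewrite Cmod_mult, Cmod_inv, Cmod_R, Rabs_pos_eq by (assumption || lra).
      apply Rmult_le_compat_l; [left; now apply Rinv_0_lt_compat|].
      rewrite <- Kf, Cmod_minus_sym. now apply CI_kernel_expansion.
    + rewrite (Csum_ext _ (fun n => / RtoC (2 * PI) * / RtoC s ^ n * b n * z ^ n)%C
        (fun n => / RtoC (2 * PI) * ((z / RtoC s) ^ n * b n))%C).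
      * rewrite Csum_scal. now field.
      * intros n _. unfold Cdiv. rewrite Cpow_mult_l, Cpow_inv by exact Ns. ring.
Qed.

(** * Powers of holomorphic functions and termwise differentiation *)

Lemma cdiff_const c z : cdiff (fun _ => c) z 0.
Proof.
  intros eps Heps. exists 1. split; [lra|]. intros y _.
  replace (c - c - 0 * (y - z))%C with (RtoC 0) by ring.
  rewrite Cmod_0. apply Rmult_le_pos; [lra|apply Cmod_ge_0].
Qed.

Lemma cdiff_mult f g z l l' : cdiff f z l -> cdiff g z l' ->
  cdiff (fun y => f y * g y)%C z (l * g z + f z * l')%C.
Proof.
  intros Hf Hg eps Heps.
  set (k := 1 + Cmod (g z) + Cmod l + Cmod (f z)).
  assert (G0 := Cmod_ge_0 (g z)). assert (L0 := Cmod_ge_0 l). assert (F0 := Cmod_ge_0 (f z)).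
  assert (Hk : 0 < k) by (unfold k; lra).
  assert (Hek : 0 < eps / k) by now apply Rdiv_lt_0_compat.
  destruct (Hf _ Hek) as [d1 [D1 E1]]. destruct (Hg _ Hek) as [d2 [D2 E2]].
  destruct (cdiff_cont _ _ _ Hg (Rmin 1 (eps / k))) as [d3 [D3 E3]];
    [apply Rmin_glb_lt; [lra|exact Hek]|].
  exists (Rmin d1 (Rmin d2 d3)). split; [repeat apply Rmin_glb_lt; assumption|].
  intros y Hy.
  assert (Y1 := Rlt_le_trans _ _ _ Hy (Rmin_l _ _)).
  assert (Y' := Rlt_le_trans _ _ _ Hy (Rmin_r _ _)).
  assert (Y2 := Rlt_le_trans _ _ _ Y' (Rmin_l _ _)).
  assert (Y3 := Rlt_le_trans _ _ _ Y' (Rmin_r _ _)).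
  specialize (E1 y Y1). specialize (E2 y Y2). specialize (E3 y Y3).
  assert (E3a := Rlt_le_trans _ _ _ E3 (Rmin_l _ _)).
  assert (E3b := Rlt_le_trans _ _ _ E3 (Rmin_r _ _)).
  assert (W := Cmod_ge_0 (y - z)).
  replace (f y * g y - f z * g z - (l * g z + f z * l') * (y - z))%C
    with ((f y - f z - l * (y - z)) * g y + (l * (y - z) * (g y - g z) + f z * (g y - g z - l' * (y - z))))%C
    by ring.
  eapply Rle_trans; [apply Cmod_triangle|].
  assert (T2 := Cmod_triangle (l * (y - z) * (g y - g z)) (f z * (g y - g z - l' * (y - z)))).
  rewrite !Cmod_mult in *.
  assert (Gy : Cmod (g y) <= 1 + Cmod (g z)).
  { replace (g y) with (g y - g z + g z)%C by ring.
    eapply Rle_trans; [apply Cmod_triangle|lra]. }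
  assert (A1 : Cmod (f y - f z - l * (y - z)) * Cmod (g y) <= eps / k * Cmod (y - z) * (1 + Cmod (g z)))
    by (apply Rmult_le_compat; auto using Cmod_ge_0).
  assert (A2 : Cmod l * Cmod (y - z) * Cmod (g y - g z) <= Cmod l * Cmod (y - z) * (eps / k))
    by (apply Rmult_le_compat_l; [now apply Rmult_le_pos|lra]).
  assert (A3 : Cmod (f z) * Cmod (g y - g z - l' * (y - z)) <= Cmod (f z) * (eps / k * Cmod (y - z)))
    by (now apply Rmult_le_compat_l).
  replace (eps * Cmod (y - z)) with (eps / k * Cmod (y - z) * (1 + Cmod (g z))
    + Cmod l * Cmod (y - z) * (eps / k) + Cmod (f z) * (eps / k * Cmod (y - z)))
    by (unfold k; field; unfold k in Hk; lra).
  lra.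
Qed.

Lemma cdiff_pow f z l n : cdiff f z l ->
  cdiff (fun y => f y ^ S n)%C z (RtoC (INR (S n)) * (l * f z ^ n))%C.
Proof.
  intros H. induction n as [|n IH].
  - simpl. assert (A := cdiff_mult f (fun _ => RtoC 1) z l 0 H (cdiff_const 1 z)).
    replace (1 * (l * 1))%C with (l * 1 + f z * 0)%C by ring. exact A.
  - assert (A := cdiff_mult f _ z l _ H IH).
    replace (RtoC (INR (S (S n))) * (l * f z ^ S n))%C
      with (l * f z ^ S n + f z * (RtoC (INR (S n)) * (l * f z ^ n)))%C; [exact A|].
    rewrite (S_INR (S n)), RtoC_plus. simpl Cpow. ring.
Qed.

(** Bernoulli's inequality for [(q1 / q) ^ n]: a slightly larger ratio absorbs one factor [n]. *)
Lemma INR_geom_bound q q1 n : 0 < q < q1 -> INR n * q ^ n <= q / (q1 - q) * q1 ^ n.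
Proof.
  intros Hq. assert (P : 0 < q1 / q - 1).
  { replace (q1 / q - 1) with ((q1 - q) / q) by (field; lra). apply Rdiv_lt_0_compat; lra. }
  assert (B := poly n (q1 / q - 1) P). replace (1 + (q1 / q - 1)) with (q1 / q) in B by ring.
  unfold Rdiv in B. rewrite Rpow_mult_distr, pow_inv in B.
  assert (Q : 0 < q ^ n) by (apply pow_lt; lra).
  apply Rmult_le_reg_l with (q1 / q - 1); [exact P|].
  replace ((q1 / q - 1) * (q / (q1 - q) * q1 ^ n)) with (q1 ^ n * / q ^ n * q ^ n) by (field; split; lra).
  unfold Rdiv. rewrite <- Rmult_assoc. apply Rmult_le_compat_r; [lra|].
  apply Rle_trans with (2 := B). lra.
Qed.

(** Second-order Taylor remainder of a power, by induction on [n]. Both sides carry [rho0 ^ 2] so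
    that the natural exponent [n - 2] never appears; [n ^ 2] majorises [n (n - 1) / 2]. *)
Lemma Cpow_taylor1 (z w : C) rho0 n : Cmod z <= rho0 -> Cmod w <= rho0 ->
  rho0 ^ 2 * Cmod (w ^ n - z ^ n - RtoC (INR n) * z ^ pred n * (w - z))
  <= INR n ^ 2 * rho0 ^ n * Cmod (w - z) ^ 2.
Proof.
  intros Hz Hw. assert (Z := Cmod_ge_0 z). assert (W := Cmod_ge_0 w).
  assert (H := Cmod_ge_0 (w - z)).
  induction n as [|n IH].
  - simpl. replace (1 - 1 - 0 * 1 * (w - z))%C with (RtoC 0) by ring. rewrite Cmod_0. lra.
  - replace (w ^ S n - z ^ S n - RtoC (INR (S n)) * z ^ pred (S n) * (w - z))%C
      with (w * (w ^ n - z ^ n - RtoC (INR n) * z ^ pred n * (w - z))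
            + RtoC (INR n) * z ^ pred n * ((w - z) * (w - z)))%C.
    2:{ rewrite S_INR, RtoC_plus. simpl pred. destruct n as [|n].
        - simpl. ring.
        - simpl pred. simpl Cpow. ring. }
    assert (T := Cmod_triangle (w * (w ^ n - z ^ n - RtoC (INR n) * z ^ pred n * (w - z)))
       (RtoC (INR n) * z ^ pred n * ((w - z) * (w - z)))).
    rewrite !Cmod_mult, Cmod_R, Cmod_pow, (Rabs_pos_eq _ (pos_INR n)) in T.
    set (X := Cmod (w ^ n - z ^ n - RtoC (INR n) * z ^ pred n * (w - z))) in *.
    assert (X0 : 0 <= X) by apply Cmod_ge_0.
    assert (R0 : 0 <= rho0) by lra.
    apply Rle_trans with (rho0 * (rho0 ^ 2 * X) + INR n * rho0 ^ S n * Cmod (w - z) ^ 2).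
    + apply Rle_trans with (rho0 ^ 2 * (Cmod w * X + INR n * Cmod z ^ pred n * (Cmod (w - z) * Cmod (w - z)))).
      * apply Rmult_le_compat_l; [apply pow2_ge_0|exact T].
      * assert (A : Cmod w * X <= rho0 * X) by now apply Rmult_le_compat_r.
        assert (B : rho0 ^ 2 * (INR n * Cmod z ^ pred n) <= INR n * rho0 ^ S n).
        { destruct n as [|n]; [simpl; lra|]. simpl pred.
          replace (rho0 ^ S (S n)) with (rho0 ^ 2 * rho0 ^ n) by (simpl; ring).
          replace (rho0 ^ 2 * (INR (S n) * Cmod z ^ n)) with (INR (S n) * (rho0 ^ 2 * Cmod z ^ n)) by ring.
          apply Rmult_le_compat_l; [apply pos_INR|]. apply Rmult_le_compat_l; [apply pow2_ge_0|].
          now apply pow_incr. }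
        assert (C1 : rho0 ^ 2 * (INR n * Cmod z ^ pred n) * Cmod (w - z) ^ 2
                <= INR n * rho0 ^ S n * Cmod (w - z) ^ 2)
          by (apply Rmult_le_compat_r; [apply pow2_ge_0|exact B]).
        assert (rho0 ^ 2 * (Cmod w * X) <= rho0 ^ 2 * (rho0 * X))
          by (apply Rmult_le_compat_l; [apply pow2_ge_0|exact A]).
        lra.
    + rewrite S_INR. assert (N := pos_INR n).
      assert (Q : 0 <= rho0 ^ S n * Cmod (w - z) ^ 2)
        by (apply Rmult_le_pos; [now apply pow_le|apply pow2_ge_0]).
      assert (M : rho0 * (rho0 ^ 2 * X) <= rho0 * (INR n ^ 2 * rho0 ^ n * Cmod (w - z) ^ 2))
        by now apply Rmult_le_compat_l.
      replace (rho0 * (INR n ^ 2 * rho0 ^ n * Cmod (w - z) ^ 2))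
        with (INR n ^ 2 * (rho0 ^ S n * Cmod (w - z) ^ 2)) in M by (simpl; ring).
      nra.
Qed.

Lemma Clim_eps u l : Clim u l <->
  forall eps, 0 < eps -> exists m0, forall m, (m0 <= m)%nat -> Cmod (u m - l) < eps.
Proof.
  unfold Clim. rewrite <- is_lim_seq_spec. split.
  - intros H eps Heps. destruct (H (mkposreal eps Heps)) as [m0 Hm]. exists m0. intros m Hle.
    specialize (Hm m Hle). simpl in Hm. rewrite Rminus_0_r, Rabs_pos_eq in Hm; [exact Hm|apply Cmod_ge_0].
  - intros H eps. destruct (H eps (cond_pos eps)) as [m0 Hm]. exists m0. intros m Hle.
    rewrite Rminus_0_r, Rabs_pos_eq; [now apply Hm|apply Cmod_ge_0].
Qed.

(** The partial sums obey a first-order Taylor estimate whose remainder [M * |w - z| ^ 2] is uniform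
    in [m]. At one suitable [w] near [z], the differentiated sum is compared with the difference
    quotient of the partial sum, this one with that of [f], and the latter with [f' z]. *)
Lemma Clim_derive_series (f f' : C -> C) (c : nat -> C) (A s : R) :
  0 < s -> (forall n, Cmod (c n) <= A / s ^ n) ->
  (forall z, Cmod z < s -> Clim (fun m => Csum m (fun n => c n * z ^ n)%C) (f z)) ->
  (forall z, Cmod z < s -> cdiff f z (f' z)) ->
  forall z, Cmod z < s ->
    Clim (fun m => Csum m (fun n => RtoC (INR (S n)) * c (S n) * z ^ n)%C) (f' z).
Proof.
  intros Hs Hc Hf Hd z Hz. assert (Z0 := Cmod_ge_0 z).
  assert (A0 : 0 <= A).
  { generalize (Rle_trans _ _ _ (Cmod_ge_0 _) (Hc O)). simpl. unfold Rdiv. rewrite Rinv_1. lra. }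
  set (rho0 := (Cmod z + s) / 2). assert (R0 : Cmod z < rho0 < s) by (unfold rho0; lra).
  set (q := rho0 / s).
  assert (Hq : 0 < q < 1).
  { split; [apply Rdiv_lt_0_compat; lra|]. apply Rmult_lt_reg_r with s; [exact Hs|].
    unfold q, Rdiv. rewrite Rmult_assoc, Rinv_l, Rmult_1_r, Rmult_1_l; lra. }
  (* The Taylor remainder of the [n]-th term carries [n ^ 2]; each of the steps [q < q1 < q2]
     absorbs one factor [n]. *)
  set (q1 := (2 * q + 1) / 3). set (q2 := (q + 2) / 3).
  assert (Hq1 : 0 < q < q1) by (unfold q1; lra). assert (Hq2 : 0 < q1 < q2 /\ q2 < 1) by (unfold q1, q2; lra).
  set (k1 := q / (q1 - q)). set (k2 := q1 / (q2 - q1)).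
  assert (K1 : 0 < k1) by (unfold k1; apply Rdiv_lt_0_compat; lra).
  assert (K2 : 0 < k2) by (unfold k2; apply Rdiv_lt_0_compat; lra).
  set (M := A / rho0 ^ 2 * (k1 * k2 * / (1 - q2))).
  assert (M0 : 0 <= M).
  { unfold M. apply Rmult_le_pos; [apply Rdiv_le_0_compat; [exact A0|apply pow_lt; lra]|].
    apply Rmult_le_pos; [nra|]. left; apply Rinv_0_lt_compat; lra. }
  assert (Taylor : forall w m, Cmod w <= rho0 ->
    Cmod (Csum m (fun n => c n * w ^ n)%C - Csum m (fun n => c n * z ^ n)%C
          - Csum m (fun n => RtoC (INR n) * c n * z ^ pred n)%C * (w - z)) <= M * Cmod (w - z) ^ 2).
  { intros w m Hw. rewrite (Cmult_comm _ (w - z)), <- Csum_scal, <- !Csum_minus.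
    eapply Rle_trans; [apply Cmod_Csum|].
    apply Rle_trans with (rsum m (fun n => A / rho0 ^ 2 * (k1 * k2) * Cmod (w - z) ^ 2 * q2 ^ n)).
    - apply rsum_le. intros n _.
      replace (c n * w ^ n - c n * z ^ n - (w - z) * (RtoC (INR n) * c n * z ^ pred n))%C
        with (c n * (w ^ n - z ^ n - RtoC (INR n) * z ^ pred n * (w - z)))%C by ring.
      rewrite Cmod_mult.
      assert (T := Cpow_taylor1 z w rho0 n (Rlt_le _ _ (proj1 R0)) Hw).
      assert (P2 : 0 < rho0 ^ 2) by (apply pow_lt; lra).
      assert (T' : Cmod (w ^ n - z ^ n - RtoC (INR n) * z ^ pred n * (w - z))
        <= / rho0 ^ 2 * (INR n ^ 2 * rho0 ^ n * Cmod (w - z) ^ 2)).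
      { apply Rmult_le_reg_l with (rho0 ^ 2); [exact P2|].
        rewrite <- Rmult_assoc, Rinv_r, Rmult_1_l by lra. exact T. }
      apply Rle_trans with (A / s ^ n * (/ rho0 ^ 2 * (INR n ^ 2 * rho0 ^ n * Cmod (w - z) ^ 2))).
      { apply Rmult_le_compat; auto using Cmod_ge_0. }
      replace (A / s ^ n * (/ rho0 ^ 2 * (INR n ^ 2 * rho0 ^ n * Cmod (w - z) ^ 2)))
        with (A / rho0 ^ 2 * Cmod (w - z) ^ 2 * (INR n * (INR n * q ^ n))).
      2:{ unfold q, Rdiv. rewrite Rpow_mult_distr, pow_inv. field.
          split; [apply Rgt_not_eq; lra|]. apply pow_nonzero; lra. }
      replace (A / rho0 ^ 2 * (k1 * k2) * Cmod (w - z) ^ 2 * q2 ^ n)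
        with (A / rho0 ^ 2 * Cmod (w - z) ^ 2 * (k1 * (k2 * q2 ^ n))) by ring.
      apply Rmult_le_compat_l.
      { apply Rmult_le_pos; [apply Rdiv_le_0_compat; lra|apply pow2_ge_0]. }
      apply Rle_trans with (INR n * (k1 * q1 ^ n)).
      { apply Rmult_le_compat_l; [apply pos_INR|]. now apply INR_geom_bound. }
      replace (INR n * (k1 * q1 ^ n)) with (k1 * (INR n * q1 ^ n)) by ring.
      apply Rmult_le_compat_l; [lra|]. now apply INR_geom_bound.
    - rewrite rsum_scal. unfold M.
      replace (A / rho0 ^ 2 * (k1 * k2 * / (1 - q2)) * Cmod (w - z) ^ 2)
        with (A / rho0 ^ 2 * (k1 * k2) * Cmod (w - z) ^ 2 * / (1 - q2)) by ring.
      apply Rmult_le_compat_l.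
      { apply Rmult_le_pos; [|apply pow2_ge_0].
        apply Rmult_le_pos; [apply Rdiv_le_0_compat; [lra|apply pow_lt; lra]|nra]. }
      apply rsum_geom_lt1. lra. }
  assert (Shift : forall m, Csum (S m) (fun n => RtoC (INR n) * c n * z ^ pred n)%C
                   = Csum m (fun n => RtoC (INR (S n)) * c (S n) * z ^ n)%C).
  { induction m as [|m IH]; [simpl; ring|].
    change (Csum (S (S m)) ?g) with (Csum (S m) g + g (S m))%C. rewrite IH. reflexivity. }
  apply Clim_eps. intros eps Heps.
  destruct (Hd z Hz (eps / 5)) as [d [Hd0 E]]; [lra|].
  (* The three bounds keep [w] where [f] is affine up to [eps / 5], keep it in the disc of radius
     [rho0], and make [M * eta] at most [eps / 5]. *)
  set (eta := Rmin (d / 2) (Rmin (rho0 - Cmod z) (eps / (5 * (M + 1))))).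
  assert (Q5 : 0 < eps / (5 * (M + 1))) by (apply Rdiv_lt_0_compat; lra).
  assert (eta0 : 0 < eta) by (unfold eta; repeat apply Rmin_glb_lt; lra).
  assert (eta1 : eta <= d / 2) by apply Rmin_l.
  assert (eta' : eta <= Rmin (rho0 - Cmod z) (eps / (5 * (M + 1)))) by apply Rmin_r.
  assert (eta2 := Rle_trans _ _ _ eta' (Rmin_l _ _)).
  assert (eta3 := Rle_trans _ _ _ eta' (Rmin_r _ _)).
  assert (Meta : M * eta <= eps / 5).
  { apply Rle_trans with ((M + 1) * (eps / (5 * (M + 1)))); [apply Rmult_le_compat; lra|].
    apply Req_le. field. lra. }
  set (w := (z + RtoC eta)%C).
  assert (Wz : (w - z)%C = RtoC eta) by (unfold w; ring).
  assert (Wabs : Cmod (w - z) = eta) by (rewrite Wz, Cmod_R, Rabs_pos_eq; lra).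
  assert (Hw : Cmod w <= rho0).
  { unfold w. eapply Rle_trans; [apply Cmod_triangle|]. rewrite Cmod_R, Rabs_pos_eq; lra. }
  (* The series errors are taken relative to [eta], by which the comparison is divided in the
     end. *)
  destruct (proj1 (Clim_eps _ _) (Hf z Hz) (eps / 5 * eta)) as [m1 Hm1]; [nra|].
  destruct (proj1 (Clim_eps _ _) (Hf w ltac:(lra)) (eps / 5 * eta)) as [m2 Hm2]; [nra|].
  exists (Nat.max m1 m2). intros m Hm.
  specialize (Hm1 (S m) ltac:(lia)). specialize (Hm2 (S m) ltac:(lia)).
  assert (T := Taylor w (S m) Hw). rewrite Shift in T.
  assert (E' := E w ltac:(lra)).
  rewrite Wabs in T, E'.
  set (Pw := Csum (S m) (fun n => c n * w ^ n)%C) in *.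
  set (Pz := Csum (S m) (fun n => c n * z ^ n)%C) in *.
  set (D := Csum m (fun n => RtoC (INR (S n)) * c (S n) * z ^ n)%C) in *.
  assert (X : Cmod (D - f' z) * eta < eps * eta).
  { rewrite <- Wabs at 1. rewrite <- Cmod_mult.
    replace ((D - f' z) * (w - z))%C
      with (- (Pw - Pz - D * (w - z)) + ((f w - f z - f' z * (w - z)) + ((Pw - f w) - (Pz - f z))))%C by ring.
    eapply Rle_lt_trans; [apply Cmod_triangle|]. rewrite Cmod_opp.
    assert (T1 := Cmod_triangle (f w - f z - f' z * (w - z)) ((Pw - f w) - (Pz - f z))).
    assert (T2 := Cmod_triangle (Pw - f w) (- (Pz - f z))). rewrite Cmod_opp in T2.
    fold ((Pw - f w) - (Pz - f z))%C in T2.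
    assert (M * eta ^ 2 <= eps / 5 * eta).
    { replace (M * eta ^ 2) with (M * eta * eta) by ring. apply Rmult_le_compat_r; lra. }
    nra. }
  now apply Rmult_lt_reg_r in X.
Qed.

(** * Matrix entries of the transfer operator *)

Lemma Clim_tail (a : nat -> C) l A q m : 0 <= q < 1 -> (forall j, Cmod (a j) <= A * q ^ j) ->
  Clim (fun m => Csum m a) l -> Cmod (l - Csum m a) <= A / (1 - q) * q ^ m.
Proof.
  intros Hq Ha Hl.
  assert (A0 : 0 <= A).
  { generalize (Rle_trans _ _ _ (Cmod_ge_0 _) (Ha O)). simpl. lra. }
  apply le_epsilon. intros eps Heps.
  destruct (proj1 (Clim_eps _ _) Hl eps Heps) as [m0 Hm0].
  set (n := Nat.max m m0). specialize (Hm0 n (Nat.le_max_r _ _)).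
  replace (l - Csum m a)%C with ((Csum n a - Csum m a) + - (Csum n a - l))%C by ring.
  eapply Rle_trans; [apply Cmod_triangle|]. rewrite Cmod_opp.
  apply Rplus_le_compat; [|lra].
  replace n with (m + (n - m))%nat by (unfold n; lia).
  rewrite Csum_split. match goal with |- Cmod (?x + ?y - ?x) <= _ => replace (x + y - x)%C with y by ring end.
  eapply Rle_trans; [apply Cmod_Csum|].
  apply Rle_trans with (rsum (n - m) (fun i => A * q ^ m * q ^ i)).
  - apply rsum_le. intros i _. rewrite Rmult_assoc, <- pow_add. apply Ha.
  - rewrite rsum_scal. replace (A / (1 - q) * q ^ m) with (A * q ^ m * / (1 - q)) by (unfold Rdiv; ring).
    apply Rmult_le_compat_l; [apply Rmult_le_pos; [exact A0|apply pow_le; lra]|].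
    apply rsum_geom_lt1. exact Hq.
Qed.

Lemma Clim_plus u v l l' : Clim u l -> Clim v l' -> Clim (fun m => u m + v m)%C (l + l')%C.
Proof.
  intros H H'. apply is_lim_seq_le_le with (fun _ => 0) (fun m => Cmod (u m - l) + Cmod (v m - l')).
  - intros m. split; [apply Cmod_ge_0|].
    replace (u m + v m - (l + l'))%C with ((u m - l) + (v m - l'))%C by ring. apply Cmod_triangle.
  - apply is_lim_seq_const.
  - rewrite <- (Rplus_0_r 0). now apply is_lim_seq_plus'.
Qed.

Lemma Clim_scal c u l : Clim u l -> Clim (fun m => c * u m)%C (c * l)%C.
Proof.
  intros H. unfold Clim. apply is_lim_seq_ext with (fun m => Cmod c * Cmod (u m - l)).
  - intros m. rewrite <- Cmod_mult. f_equal. ring.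
  - replace (Finite 0) with (Rbar_mult (Cmod c) 0) by (simpl; f_equal; ring).
    now apply is_lim_seq_scal_l.
Qed.

Lemma Clim_ext u v l : (forall m, u m = v m) -> Clim u l -> Clim v l.
Proof. intros E. unfold Clim. apply is_lim_seq_ext. intros m. now rewrite E. Qed.

Lemma Clim_Csum d (u : nat -> nat -> C) (l : nat -> C) :
  (forall i, (i < d)%nat -> Clim (u i) (l i)) ->
  Clim (fun m => Csum d (fun i => u i m)) (Csum d l).
Proof.
  induction d as [|d IH]; intros H; simpl.
  - apply Clim_geom with 0 0; [lra|]. intros m.
    replace (0 - 0)%C with (RtoC 0) by ring. rewrite Cmod_0. lra.
  - apply Clim_plus; auto.
Qed.

Lemma ccont_uniform_limit h t :
  (forall eps, 0 < eps -> exists p, ccont p t /\ forall x, Cmod (h x - p x) <= eps) -> ccont h t.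
Proof.
  intros H. apply eps_ccont. intros eps Heps.
  destruct (H (eps / 4)) as [p [Hp E]]; [lra|].
  destruct (ccont_eps p t Hp (eps / 4)) as [d [Hd F]]; [lra|].
  exists d. split; [exact Hd|]. intros y Hy.
  replace (h y - h t)%C with ((h y - p y) + ((p y - p t) + - (h t - p t)))%C by ring.
  eapply Rle_lt_trans; [apply Cmod_triangle|].
  assert (T := Cmod_triangle (p y - p t) (- (h t - p t))). rewrite Cmod_opp in T.
  generalize (E y) (E t) (F y Hy). lra.
Qed.

(** * Fourier series with nonnegative frequencies and geometric decay *)

Section Fourier.

Variables (h : R -> C) (a : nat -> C) (A q : R).
Hypothesis q_lt : 0 <= q < 1.
Hypothesis a_le : forall j, Cmod (a j) <= A * q ^ j.
Hypothesis h_lim : forall t, Clim (fun m => Csum m (fun j => a j * circle 1 (INR j * t))%C) (h t).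

Lemma fourier_tail m t : Cmod (h t - Csum m (fun j => a j * circle 1 (INR j * t))%C) <= A / (1 - q) * q ^ m.
Proof.
  apply (Clim_tail (fun j => a j * circle 1 (INR j * t))%C); [exact q_lt| |apply h_lim].
  intros j. rewrite Cmod_mult, Cmod_circle, Rmult_1_r by lra. apply a_le.
Qed.

Lemma fourier_cont t : ccont h t.
Proof.
  apply ccont_uniform_limit. intros eps Heps.
  assert (L := is_lim_seq_geom_scal (A / (1 - q)) q q_lt).
  destruct (proj2 (is_lim_seq_spec _ 0) L (mkposreal eps Heps)) as [m Hm].
  specialize (Hm m (Nat.le_refl m)). simpl in Hm. rewrite Rminus_0_r in Hm.
  exists (fun t => Csum m (fun j => a j * circle 1 (INR j * t))%C). split.
  - apply (ccont_Csum m (fun j t => a j * circle 1 (INR j * t))%C). intros j.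
    apply ccont_mult; [apply ccont_const|apply ccont_harmonic].
  - intros x. eapply Rle_trans; [apply fourier_tail|].
    left. eapply Rle_lt_trans; [apply Rle_abs|exact Hm].
Qed.

Lemma fourier_coeff k :
  CI (fun t => h t * circle 1 (- INR k * t)%R)%C = (RtoC (2 * PI) * a k)%C.
Proof.
  assert (pi := PI_RGT_0).
  apply Clim_unique with (fun m => CI (fun t => Csum m (fun j => a j * circle 1 (INR j * t)%R)
       * circle 1 (- INR k * t)%R)%C).
  - apply Clim_geom with (4 * PI * (A / (1 - q))) q; [exact q_lt|].
    intros m.
    set (p := fun t => Csum m (fun j => a j * circle 1 (INR j * t)%R)%C).
    assert (Hp : forall t, ccont p t).
    { intros t. apply (ccont_Csum m (fun j t => a j * circle 1 (INR j * t)%R)%C). intros j.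
      apply ccont_mult; [apply ccont_const|apply ccont_harmonic]. }
    assert (E : (CI (fun t => h t * circle 1 (- INR k * t)%R)%C
       = CI (fun t => p t * circle 1 (- INR k * t)%R)%C
         + CI (fun t => (h t - p t) * circle 1 (- INR k * t)%R)%C)%C).
    { rewrite <- CI_plus.
      - apply CI_ext. intros t. ring.
      - intros t. apply ccont_mult; [apply Hp|apply ccont_harmonic].
      - intros t. apply ccont_mult; [|apply ccont_harmonic].
        apply ccont_minus; [apply fourier_cont|apply Hp]. }
    change (Cmod (CI (fun t => p t * circle 1 (- INR k * t)%R)%C
      - CI (fun t => h t * circle 1 (- INR k * t)%R)%C)
      <= 4 * PI * (A / (1 - q)) * q ^ m).
    rewrite E, Cmod_minus_sym.
    match goal with |- Cmod (?x + ?y - ?x) <= _ => replace (x + y - x)%C with y by ring end.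
    rewrite Rmult_assoc. apply CI_bound.
    + intros t. apply ccont_mult; [|apply ccont_harmonic].
      apply ccont_minus; [apply fourier_cont|apply Hp].
    + intros t. rewrite Cmod_mult, Cmod_circle, Rmult_1_r by lra. apply fourier_tail.
  (* By orthogonality the partial sums acquire their only nonzero contribution when [m] passes
     [k]. *)
  - assert (E : forall m, CI (fun t => Csum m (fun j => a j * circle 1 (INR j * t)%R)
       * circle 1 (- INR k * t)%R)%C
       = if le_lt_dec m k then RtoC 0 else (RtoC (2 * PI) * a k)%C).
    { intros m.
      assert (T : forall j : nat, CI (fun t => a j * circle 1 (IZR (Z.of_nat j - Z.of_nat k) * t)%R)%C
              = (a j * if Nat.eq_dec j k then RtoC (2 * PI) else RtoC 0)%C).
      { intros j. rewrite CI_scal by (intros; apply ccont_harmonic). f_equal.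
        destruct (Nat.eq_dec j k) as [->|N].
        - rewrite Z.sub_diag. apply CI_harmonic_0.
        - apply CI_harmonic. lia. }
      rewrite (CI_ext _ (fun t => Csum m (fun j => a j * circle 1 (IZR (Z.of_nat j - Z.of_nat k) * t)%R)%C)).
      2:{ intros t. rewrite Cmult_comm, <- Csum_scal. apply Csum_ext. intros j _.
          rewrite minus_IZR, <- !INR_IZR_INZ.
          replace ((INR j - INR k) * t) with (INR j * t + - INR k * t) by ring.
          rewrite <- circle_add. ring. }
      rewrite (CI_Csum m (fun j t => a j * circle 1 (IZR (Z.of_nat j - Z.of_nat k) * t)%R)%C).
      2:{ intros j t. apply ccont_mult; [apply ccont_const|apply ccont_harmonic]. }
      induction m as [|m IH]; [reflexivity|].
      change (Csum (S m) ?g) with (Csum m g + g m)%C. cbv beta. rewrite IH, T.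
      destruct (Nat.eq_dec m k) as [->|N].
      - destruct (le_lt_dec k k); [|lia]. destruct (le_lt_dec (S k) k); [lia|]. ring.
      - destruct (le_lt_dec m k); destruct (le_lt_dec (S m) k); (lia || ring). }
    apply Clim_eps. intros eps Heps. exists (S k). intros m Hm. rewrite E.
    destruct (le_lt_dec m k); [lia|]. unfold Cminus. now rewrite Cplus_opp_r, Cmod_0.
Qed.

End Fourier.

Lemma RInt_CI (h : R -> C) : (forall t, ccont h t) ->
  @RInt C_R_CompleteNormedModule h 0 (2 * PI) = CI h.
Proof.
  intros H. apply is_RInt_unique. unfold CI.
  apply (is_RInt_fct_extend_pair (U := R_NormedModule) (V := R_NormedModule));
    apply (RInt_correct (V := R_CompleteNormedModule)); [now apply ex_RInt_fst|now apply ex_RInt_snd].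
Qed.

(** [lim] is specified only through the balls around it. These separate the points of the plane, so
    convergence to [L] in modulus forces it to be [L]. *)
Lemma lim_CCS (F : (C -> Prop) -> Prop) (L : C) : ProperFilter F ->
  (forall eps, 0 < eps -> F (fun z => Cmod (z - L) < eps)) -> @lim CCS F = L.
Proof.
  intros HF H.
  assert (FL : forall eps : posreal, F (@ball CCS L eps)).
  { intros eps. apply filter_imp with (2 := H eps (cond_pos eps)). intros z Hz.
    split; (eapply Rle_lt_trans; [|exact Hz]).
    - apply (fst_le_Cmod (z - L)%C).
    - apply (snd_le_Cmod (z - L)%C). }
  assert (Cau : cauchy (T := CCS) F) by (intros eps; exists L; apply FL).
  assert (E : forall eps : posreal, @ball CCS (@lim CCS F) eps L).
  { intros eps.
    assert (B := complete_cauchy (T := CCS) F HF Cau (pos_div_2 eps)).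
    assert (B' := filter_and _ _ B (FL (pos_div_2 eps))).
    destruct (filter_ex _ B') as [z [Hz1 Hz2]].
    replace (pos eps) with (pos_div_2 eps + pos_div_2 eps) by (simpl; field).
    apply ball_triangle with z; [exact Hz1|apply ball_sym; exact Hz2]. }
  assert (Z : forall x y : R, (forall eps : posreal, Rabs (y - x) < eps) -> x = y).
  { intros x y Hxy. destruct (Req_dec x y) as [e|n]; [exact e|exfalso].
    assert (P : 0 < Rabs (y - x)) by (apply Rabs_pos_lt; lra).
    specialize (Hxy (mkposreal _ P)). simpl in Hxy. lra. }
  apply injective_projections; apply Z; intros eps; apply (E eps).
Qed.

Lemma ebasis_eq rho n z : rho <> 0 -> ebasis rho n z = (RtoC (/ rho ^ n) * z ^ n)%C.
Proof.
  intros H. unfold ebasis. rewrite Cpow_Defs. unfold Cdiv.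
  rewrite Cpow_mult_l, <- RtoC_inv, <- RtoC_pow, pow_inv by exact H. ring.
Qed.

(** On the circle of radius [s' < rho] the conjugate of [e_k] is [(s' / rho) ^ k] times the harmonic
    of order [-k], which extracts [a k * s' ^ k]. The left limit at [rho] turns
    [s' ^ k * (s' / rho) ^ k] into [rho ^ k]. *)
Lemma hardy_ip_power_series (g : C -> C) (a : nat -> C) A s rho k : 0 < rho < s ->
  (forall j, Cmod (a j) <= A / s ^ j) ->
  (forall z, Cmod z < s -> Clim (fun m => Csum m (fun j => a j * z ^ j)%C) (g z)) ->
  hardy_ip rho g (ebasis rho k) = (a k * RtoC (rho ^ k))%C.
Proof.
  intros Hs Ha Hg. assert (pi := PI_RGT_0).
  assert (V : forall s', 0 < s' < rho ->
    Cmult (RtoC (/ (2 * PI))) (@RInt C_R_CompleteNormedModule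
       (fun t => Cmult (g (circle s' t)) (Cconj (ebasis rho k (circle s' t)))) 0 (2 * PI))
    = (a k * RtoC (s' ^ k * (s' / rho) ^ k))%C).
  { intros s' Hs'.
    set (h := fun t => g (circle s' t)).
    assert (Hb : forall j, Cmod (a j * RtoC (s' ^ j))%C <= A * (s' / s) ^ j).
    { intros j. rewrite Cmod_mult, Cmod_R, Rabs_pos_eq by (apply pow_le; lra).
      unfold Rdiv. rewrite Rpow_mult_distr, pow_inv.
      replace (A * (s' ^ j * / s ^ j)) with (A / s ^ j * s' ^ j) by (unfold Rdiv; ring).
      apply Rmult_le_compat_r; [apply pow_le; lra|apply Ha]. }
    assert (Hq : 0 <= s' / s < 1) by (apply div_unit; lra).
    assert (Hh : forall t, Clim (fun m => Csum m (fun j => a j * RtoC (s' ^ j) * circle 1 (INR j * t)%R)%C) (h t)).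
    { intros t. apply Clim_ext with (2 := Hg (circle s' t) ltac:(rewrite Cmod_circle; lra)).
      intros m. apply Csum_ext. intros j _.
      rewrite circle_scal, Cpow_mult_l, circle_pow, RtoC_pow. ring. }
    assert (Hc := fourier_cont h _ A (s' / s) Hq Hb Hh).
    assert (E : forall t, Cconj (ebasis rho k (circle s' t))
       = (RtoC ((s' / rho) ^ k) * circle 1 (- INR k * t)%R)%C).
    { intros t. rewrite ebasis_eq by lra.
      rewrite circle_scal, Cpow_mult_l, circle_pow, <- RtoC_pow.
      unfold Rdiv. rewrite Rpow_mult_distr, pow_inv.
      replace (- INR k * t) with (- (INR k * t)) by ring.
      apply injective_projections; simpl; rewrite ?cos_neg, ?sin_neg; ring. }
    rewrite RInt_CI.
    2:{ intros t. apply ccont_mult; [apply Hc|].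
        assert (X : ccont (fun t => RtoC ((s' / rho) ^ k) * circle 1 (- INR k * t)%R)%C t)
          by (apply ccont_mult; [apply ccont_const|apply ccont_harmonic]).
        destruct X as [X1 X2]. split.
        - apply continuous_ext with (2 := X1). intros x. now rewrite E.
        - apply continuous_ext with (2 := X2). intros x. now rewrite E. }
    rewrite (CI_ext _ (fun t => RtoC ((s' / rho) ^ k) * (h t * circle 1 (- INR k * t)%R))%C)
      by (intros t; rewrite E; unfold h; ring).
    rewrite CI_scal by (intros t; apply ccont_mult; [apply Hc|apply ccont_harmonic]).
    rewrite (fourier_coeff h _ A (s' / s) Hq Hb Hh), (RtoC_mult (s' ^ k)), (RtoC_inv (2 * PI)) by lra.
    assert (N : RtoC (2 * PI) <> 0%C) by (apply RtoC_neq0; lra).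
    generalize dependent (RtoC (2 * PI)); intros X N. now field. }
  unfold hardy_ip. apply lim_CCS.
  - apply filtermap_proper_filter. apply at_left_proper_filter.
  - intros eps Heps. unfold filtermap.
    assert (cont : continuous (fun s' => s' ^ k * (s' / rho) ^ k) rho).
    { apply (ex_derive_continuous (fun s' => s' ^ k * (s' / rho) ^ k)). auto_derive. lra. }
    assert (P : 0 < eps / (Cmod (a k) + 1)).
    { apply Rdiv_lt_0_compat; [exact Heps|]. generalize (Cmod_ge_0 (a k)); lra. }
    destruct (proj1 (continuous_eps _ _) cont _ P) as [d [Hd E]].
    assert (Hm : 0 < Rmin d rho) by (apply Rmin_glb_lt; lra).
    exists (mkposreal _ Hm). intros s' Hs' Hlt.
    assert (D : Rabs (s' - rho) < Rmin d rho) by exact Hs'.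
    assert (D1 := Rlt_le_trans _ _ _ D (Rmin_l _ _)).
    assert (D2 := Rlt_le_trans _ _ _ D (Rmin_r _ _)). apply Rabs_def2 in D2.
    rewrite V by lra. specialize (E s' D1).
    replace (rho / rho) with 1 in E by (field; lra). rewrite pow1, Rmult_1_r in E.
    replace (a k * RtoC (s' ^ k * (s' / rho) ^ k) - a k * RtoC (rho ^ k))%C
      with (a k * RtoC (s' ^ k * (s' / rho) ^ k - rho ^ k))%C by (rewrite RtoC_minus; ring).
    rewrite Cmod_mult, Cmod_R.
    assert (A0 := Cmod_ge_0 (a k)).
    apply Rle_lt_trans with (Cmod (a k) * (eps / (Cmod (a k) + 1))).
    + apply Rmult_le_compat_l; lra.
    + apply Rmult_lt_reg_r with (Cmod (a k) + 1); [lra|].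
      replace (Cmod (a k) * (eps / (Cmod (a k) + 1)) * (Cmod (a k) + 1)) with (Cmod (a k) * eps) by (field; lra).
      nra.
Qed.

(** Powers of [Phi] are bounded by powers of [r], so Cauchy's estimate is applied to [Phi ^ (l + 1)]
    and differentiated termwise. [Phi'] itself is never bounded, and [K] is uniform in [l] and in
    the branch. *)
Lemma branch_expansion (r RR s : R) : 0 < r -> 0 < s < RR ->
  exists K, 0 < K /\ forall Phi Phi' : C -> C,
    (forall z, Cmod z < RR -> cdiff Phi z (Phi' z)) ->
    (forall z, Cmod z < RR -> Cmod (Phi z) < r) ->
    exists t : nat -> nat -> C, (forall k l, Cmod (t k l) <= K * r ^ l / s ^ k) /\
      forall l z, Cmod z < s ->
        Clim (fun m => Csum m (fun k => t k l * z ^ k)%C) (Phi' z * Phi z ^ l)%C.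
Proof.
  (* Cauchy's estimate is taken on the larger radius [s2]; passing down to [s] absorbs the factor
     [k + 1] produced by differentiation, at the price [k1]. *)
  intros Hr Hs. set (s2 := (s + RR) / 2).
  assert (Hs2 : s < s2 < RR) by (unfold s2; lra).
  set (k1 := / s2 / (/ s - / s2)).
  assert (I : 0 < / s2 < / s).
  { split; [apply Rinv_0_lt_compat; lra|]. apply Rinv_lt_contravar; [nra|lra]. }
  assert (K1 : 0 < k1) by (unfold k1; apply Rdiv_lt_0_compat; lra).
  exists (2 * r * k1 / s). split; [apply Rdiv_lt_0_compat; [nra|lra]|].
  intros Phi Phi' Hd Hb.
  assert (Ex : forall l, exists c : nat -> C, (forall n, Cmod (c n) <= 2 * r ^ S l / s2 ^ n) /\
    forall z, Cmod z < s2 -> Clim (fun m => Csum m (fun n => c n * z ^ n)%C) (Phi z ^ S l)%C).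
  { intros l. apply (power_series_of_cdiff (fun z => Phi z ^ S l)%C
      (fun z => RtoC (INR (S l)) * (Phi' z * Phi z ^ l))%C RR s2 (r ^ S l)); [lra| |].
    - intros z Hz. apply cdiff_pow, Hd, Hz.
    - intros z Hz. rewrite Cmod_pow. apply pow_incr. split; [apply Cmod_ge_0|left; now apply Hb]. }
  destruct (choice_fun _ Ex) as [c Hc].
  exists (fun k l => RtoC (/ INR (S l)) * (RtoC (INR (S k)) * c l (S k)))%C. split.
  - intros k l. destruct (Hc l) as [B _]. specialize (B (S k)).
    assert (L1 : 1 <= INR (S l)) by (rewrite S_INR; generalize (pos_INR l); lra).
    rewrite !Cmod_mult, !Cmod_R, !Rabs_pos_eq; [|apply pos_INR|left; apply Rinv_0_lt_compat; lra].
    apply Rle_trans with (1 * (INR (S k) * (2 * r ^ S l / s2 ^ S k))).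
    + apply Rmult_le_compat.
      * left; apply Rinv_0_lt_compat; lra.
      * apply Rmult_le_pos; [apply pos_INR|apply Cmod_ge_0].
      * rewrite <- Rinv_1. apply Rinv_le_contravar; lra.
      * apply Rmult_le_compat_l; [apply pos_INR|exact B].
    + assert (G := INR_geom_bound (/ s2) (/ s) (S k) I). fold k1 in G. rewrite !pow_inv in G.
      replace (1 * (INR (S k) * (2 * r ^ S l / s2 ^ S k)))
        with (2 * r ^ S l * (INR (S k) * / s2 ^ S k)) by (unfold Rdiv; ring).
      replace (2 * r * k1 / s * r ^ l / s ^ k) with (2 * r ^ S l * (k1 * / s ^ S k)).
      * apply Rmult_le_compat_l; [|exact G]. apply Rmult_le_pos; [lra|apply pow_le; lra].
      * simpl. field. split; [lra|apply pow_nonzero; lra].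
  - intros l z Hz. destruct (Hc l) as [B S0].
    assert (L1 : INR (S l) <> 0) by (apply not_0_INR; lia).
    assert (D := Clim_derive_series (fun z => Phi z ^ S l)%C
      (fun z => RtoC (INR (S l)) * (Phi' z * Phi z ^ l))%C (c l) (2 * r ^ S l) s2 ltac:(lra) B S0).
    assert (D' := D ltac:(intros w Hw; apply cdiff_pow, Hd; lra) z ltac:(lra)).
    apply (Clim_scal (RtoC (/ INR (S l)))) in D'.
    replace (Phi' z * Phi z ^ l)%C with (RtoC (/ INR (S l)) * (RtoC (INR (S l)) * (Phi' z * Phi z ^ l)))%C.
    + apply Clim_ext with (2 := D'). intros m. rewrite <- Csum_scal. apply Csum_ext. intros; ring.
    + rewrite RtoC_inv by exact L1. field. now apply RtoC_neq0.
Qed.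

(** [rho ^ k] comes from pairing with [e_k], the division by [rho ^ l] from the normalisation of
    [e_l]. *)
Lemma Lmat_eq d Phi Phi' rho s A (t : nat -> nat -> nat -> C) k l : 0 < rho < s ->
  (forall i k l, (i < d)%nat -> Cmod (t i k l) <= A l / s ^ k) ->
  (forall i l z, (i < d)%nat -> Cmod z < s ->
     Clim (fun m => Csum m (fun k => t i k l * z ^ k)%C) (Phi' i z * Phi i z ^ l)%C) ->
  Lmat d Phi Phi' rho k l
  = (RtoC (rho ^ k / rho ^ l) * Csum d (fun i => RtoC (sgnR (fst (Phi' i (RtoC 0)))) * t i k l))%C.
Proof.
  intros Hrho Ht Hlim.
  set (sg := fun i => RtoC (sgnR (fst (Phi' i (RtoC 0))))).
  assert (Hsg : forall i, Cmod (sg i) <= 1).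
  { intros i. unfold sg. rewrite Cmod_R. unfold sgnR.
    destruct (Rlt_dec 0 _); [|destruct (Rlt_dec _ 0)]; apply Rabs_le; simpl; lra. }
  set (T := fun j => Csum d (fun i => sg i * t i j l)%C).
  assert (P : 0 < rho ^ l) by (apply pow_lt; lra).
  unfold Lmat.
  rewrite (hardy_ip_power_series _ (fun j => RtoC (/ rho ^ l) * T j)%C (/ rho ^ l * (INR d * A l)) s).
  - unfold T, Rdiv, sg. rewrite RtoC_mult. ring.
  - exact Hrho.
  - intros j. rewrite Cmod_mult, Cmod_R, Rabs_pos_eq by (left; now apply Rinv_0_lt_compat).
    unfold Rdiv. rewrite Rmult_assoc. apply Rmult_le_compat_l; [left; now apply Rinv_0_lt_compat|].
    unfold T. eapply Rle_trans; [apply Cmod_Csum|].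
    rewrite Rmult_assoc, <- rsum_const. apply rsum_le. intros i Hi.
    rewrite Cmod_mult, <- (Rmult_1_l (A l * / s ^ j)).
    apply Rmult_le_compat; [apply Cmod_ge_0|apply Cmod_ge_0|apply Hsg|exact (Ht i j l Hi)].
  - intros z Hz.
    replace (transfer d Phi Phi' (ebasis rho l) z)
      with (RtoC (/ rho ^ l) * Csum d (fun i => sg i * (Phi' i z * Phi i z ^ l)))%C.
    + apply Clim_ext with (fun m => RtoC (/ rho ^ l) * Csum d (fun i => sg i * Csum m (fun k => t i k l * z ^ k)))%C.
      * intros m. rewrite (Csum_ext d _ (fun i => Csum m (fun k => sg i * (t i k l * z ^ k))%C))
          by (intros; symmetry; apply Csum_scal).
        rewrite Csum_swap, <- Csum_scal. apply Csum_ext. intros j _. unfold T.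
        rewrite (Csum_ext d (fun i => sg i * (t i j l * z ^ j))%C (fun i => z ^ j * (sg i * t i j l))%C)
          by (intros; ring). rewrite Csum_scal. ring.
      * apply Clim_scal. apply (Clim_Csum d (fun i m => sg i * Csum m (fun k => t i k l * z ^ k)%C)%C).
        intros i Hi. apply Clim_scal. now apply Hlim.
    + unfold transfer. rewrite <- Csum_scal. apply Csum_ext. intros i _.
      rewrite ebasis_eq by lra. unfold sg. ring.
Qed.

(** * Quadrature on equispaced nodes *)

Section Cell.

Variables (a b : R) (S f D : R -> R).
Hypothesis ab : a < b.
Hypothesis S_cont : forall x, continuous S x.
Hypothesis S_der : forall x, a < x < b -> is_derive S x (f x).
Hypothesis S_left : forall x, x <= a -> S x = S a.
Hypothesis S_right : forall x, b <= x -> S x = S b.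
Hypothesis f_out : forall x, x <= a \/ b <= x -> f x = 0.
Hypothesis f_D : forall x y, x <= y -> Rabs (f y - f x) <= D y - D x.

Lemma cell_derive t : t <> a -> t <> b -> is_derive S t (f t).
Proof.
  intros Ha Hb.
  destruct (Rlt_le_dec t a) as [L|L].
  - rewrite f_out by lra. apply is_derive_ext_loc with (fun _ => S a); [|apply is_derive_Reals, derivable_pt_lim_const].
    apply (locally_interval _ t m_infty a); try (simpl; lra || easy); simpl; intros y _ Hy. symmetry. apply S_left. lra.
  - destruct (Rlt_le_dec b t) as [L'|L'].
    + rewrite f_out by lra. apply is_derive_ext_loc with (fun _ => S b); [|apply is_derive_Reals, derivable_pt_lim_const].
      apply (locally_interval _ t b p_infty); try (simpl; lra || easy); simpl; intros y Hy _. symmetry. apply S_right. lra.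
    + apply S_der. lra.
Qed.

Lemma D_incr x y : x <= y -> D x <= D y.
Proof. intros H. generalize (f_D x y H) (Rabs_pos (f y - f x)). lra. Qed.

(** [D] increases and its increments dominate those of [f], jumps at [a] and [b] included. The mean
    value theorem needs derivatives only inside the segment, which may therefore end at [a] or [b].
    The comparison value is always [f x], at the left end of the whole cell, so the segments of a
    cell add up. *)
Lemma cell_segment x y u v : x <= u -> u <= v -> v <= y ->
  (forall t, u < t < v -> t <> a /\ t <> b) ->
  Rabs (S v - S u - (v - u) * f x) <= (v - u) * (D y - D x).
Proof.
  intros Hu Huv Hv Ht. destruct (MVT_gen S u v f) as [c [Hc E]].
  - rewrite Rmin_left, Rmax_right by lra. intros t H. apply cell_derive; apply (Ht t H).
  - intros t _. apply continuity_pt_filterlim, S_cont.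
  - rewrite Rmin_left, Rmax_right in Hc by lra.
    rewrite E. replace (f c * (v - u) - (v - u) * f x) with ((v - u) * (f c - f x)) by ring.
    rewrite Rabs_mult, Rabs_pos_eq by lra. apply Rmult_le_compat_l; [lra|].
    eapply Rle_trans; [apply f_D; lra|]. generalize (D_incr c y). lra.
Qed.

Lemma cell x y : x <= y -> Rabs (S y - S x - (y - x) * f x) <= (y - x) * (D y - D x).
Proof.
  intros Hxy.
  (* Clamping [a] and [b] to [[x, y]] cuts the cell into three pieces without a break point
     inside. *)
  set (p := Rmax x (Rmin a y)). set (q := Rmax x (Rmin b y)).
  assert (Hp : x <= p <= q /\ q <= y).
  { unfold p, q, Rmax, Rmin. repeat destruct (Rle_dec _ _); simpl in *; lra. }
  assert (A1 : Rabs (S p - S x - (p - x) * f x) <= (p - x) * (D y - D x)).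
  { apply cell_segment; try lra. intros t. unfold p, Rmax, Rmin.
    repeat destruct (Rle_dec _ _); simpl in *; lra. }
  assert (A2 : Rabs (S q - S p - (q - p) * f x) <= (q - p) * (D y - D x)).
  { apply cell_segment; try lra. intros t. unfold p, q, Rmax, Rmin.
    repeat destruct (Rle_dec _ _); simpl in *; lra. }
  assert (A3 : Rabs (S y - S q - (y - q) * f x) <= (y - q) * (D y - D x)).
  { apply cell_segment; try lra. intros t. unfold q, Rmax, Rmin.
    repeat destruct (Rle_dec _ _); simpl in *; lra. }
  apply Rabs_le_inv in A1. apply Rabs_le_inv in A2. apply Rabs_le_inv in A3.
  apply Rabs_le. lra.
Qed.

Lemma node_S M delta m : (0 < M)%nat -> node M delta (Datatypes.S m) = node M delta m + 2 / INR M.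
Proof.
  intros HM. assert (0 < INR M) by now apply lt_0_INR.
  unfold node. rewrite S_INR. field. lra.
Qed.

(* Cell errors are bounded by increments of D, hence they telescope. *)
Lemma cell_quadrature B M delta : (0 < M)%nat -> 0 <= delta <= 2 / INR M -> -1 <= a -> b <= 1 ->
  (forall x, - B <= D x <= B) ->
  Rabs (/ INR M * rsum M (fun m => f (node M delta m)) - (S b - S a) / 2) <= 4 * B / INR M.
Proof.
  intros HM Hd Ha Hb HB. assert (M0 : 0 < INR M) by now apply lt_0_INR.
  set (h := 2 / INR M) in *. assert (h0 : 0 < h) by (apply Rdiv_lt_0_compat; lra).
  assert (A1 : Rabs (rsum M (fun m => S (node M delta (Datatypes.S m)) - S (node M delta m)
       - h * f (node M delta m))) <= h * (D (node M delta M) - D (node M delta 0))).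
  { rewrite <- (rsum_telescope M (fun m => D (node M delta m))), <- rsum_scal.
    eapply Rle_trans; [apply rsum_abs|]. apply rsum_le. intros m _.
    rewrite node_S by exact HM. fold h.
    assert (E := cell (node M delta m) (node M delta m + h) ltac:(lra)).
    replace (node M delta m + h - node M delta m) with h in E by ring. exact E. }
  rewrite rsum_minus, (rsum_telescope M (fun m => S (node M delta m))), rsum_scal in A1.
  assert (x0 : node M delta 0 = -1 + delta) by (unfold node; simpl; field; lra).
  assert (xM : node M delta M = 1 + delta) by (unfold node; field; lra).
  rewrite x0, xM in A1. rewrite (S_right (1 + delta)) in A1 by lra.
  (* The cells of the nodes cover [[-1 + delta, 1 + delta]]. The missing piece has length at most
     [h] and, as [f] vanishes at [-1], costs one more oscillation [2 * B] of [D]. *)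
  assert (A2 := cell (-1) (-1 + delta) ltac:(lra)).
  rewrite (S_left (-1)), (f_out (-1)) in A2 by lra.
  assert (B1 := HB (1 + delta)). assert (B2 := HB (-1 + delta)). assert (B3 := HB (-1)).
  replace (/ INR M * rsum M (fun m => f (node M delta m)))
    with (h * rsum M (fun m => f (node M delta m)) / 2) by (unfold h; field; lra).
  replace (4 * B / INR M) with (2 * B * h) by (unfold h; field; lra).
  set (X := h * rsum M (fun m => f (node M delta m))) in *.
  apply Rabs_le_inv in A1. apply Rabs_le_inv in A2.
  assert (C1 : h * (D (1 + delta) - D (-1 + delta)) <= h * (2 * B)) by (apply Rmult_le_compat_l; lra).
  assert (C2 : (-1 + delta - -1) * (D (-1 + delta) - D (-1)) <= h * (2 * B)).
  { apply Rmult_le_compat; try lra. generalize (D_incr (-1) (-1 + delta)); lra. }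
  apply Rabs_le. lra.
Qed.

End Cell.

(** For [n > 0] this is the variation of [u ^ n] measured from 0 with the sign of [u]; for [n = 0]
    it is a step at 0. It serves as the increasing function whose increments dominate those of
    [u ^ n]. *)
Definition spow (n : nat) (u : R) : R := if Rle_dec 0 u then u ^ n else - (- u) ^ n.

Lemma spow_variation n u v : u <= v -> Rabs (v ^ n - u ^ n) <= spow n v - spow n u.
Proof.
  intros H. unfold spow.
  assert (N : forall w, Rabs (w ^ n) = Rabs w ^ n) by (intros; now rewrite RPow_abs).
  destruct (Rle_dec 0 v) as [V|V]; destruct (Rle_dec 0 u) as [U|U]; simpl.
  - rewrite Rabs_pos_eq; [lra|]. assert (u ^ n <= v ^ n) by (apply pow_incr; lra). lra.
  - unfold Rminus at 1. eapply Rle_trans; [apply Rabs_triang|]. rewrite Rabs_Ropp, !N.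
    rewrite (Rabs_pos_eq v), (Rabs_left u) by lra. lra.
  - lra.
  - assert (L : (- v) ^ n <= (- u) ^ n) by (apply pow_incr; lra).
    replace (v ^ n - u ^ n) with ((-1) ^ n * ((- v) ^ n - (- u) ^ n)).
    + rewrite Rabs_mult, pow_1_abs, Rabs_left1; lra.
    + rewrite Rmult_minus_distr_l, <- !Rpow_mult_distr. f_equal; [|f_equal]; f_equal; ring.
Qed.

Lemma spow_bound n u : -1 <= u <= 1 -> -1 <= spow n u <= 1.
Proof.
  intros H. assert (P : forall w, 0 <= w <= 1 -> 0 <= w ^ n <= 1).
  { intros w Hw. split; [apply pow_le; lra|]. rewrite <- (pow1 n). apply pow_incr. lra. }
  unfold spow. destruct (Rle_dec 0 u); simpl.
  - generalize (P u). lra.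
  - generalize (P (- u)). lra.
Qed.

Lemma Rabs_pow_le1 n u : -1 <= u <= 1 -> Rabs (u ^ n) <= 1.
Proof.
  intros H. rewrite <- RPow_abs, <- (pow1 n). apply pow_incr.
  split; [apply Rabs_pos|apply Rabs_le; lra].
Qed.

(** [sg] is the orientation: [sg * T] increases from -1 to 1 on the open interval. Fullness is
    phrased by approach to these limits, since [T] may jump at [a] and [b]. *)
Record full_branch (a b : R) (T : R -> R) (sg : R) : Prop := {
  fb_lt : a < b;
  fb_lo : -1 <= a;
  fb_hi : b <= 1;
  fb_sg : sg = 1 \/ sg = -1;
  fb_range : forall x, a < x < b -> -1 <= T x <= 1;
  fb_mono : forall x y, a < x -> x <= y -> y < b -> sg * T x <= sg * T y;
  fb_inf : forall eps, 0 < eps -> exists x, a < x < b /\ sg * T x < -1 + eps;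
  fb_sup : forall eps, 0 < eps -> exists x, a < x < b /\ 1 - eps < sg * T x }.

Definition branch_fun (a b : R) (T : R -> R) (j l : nat) (x : R) : R :=
  if Rlt_dec a x then if Rlt_dec x b then T x ^ j * x ^ l else 0 else 0.

(** The substitution [y = T x] is made on primitives: [sg * W (T x)] differentiates to the integrand
    and becomes continuous on the line when extended by its limits [sg * W (- sg)] and [sg * W sg].
    For either orientation its total increment is [W 1 - W (-1)]. *)
Lemma branch_quadrature a b T sg W j l M delta : full_branch a b T sg ->
  (0 < M)%nat -> 0 <= delta <= 2 / INR M ->
  continuous W 1 -> continuous W (-1) ->
  (forall x, a < x < b -> is_derive (fun x => sg * W (T x)) x (T x ^ j * x ^ l)) ->
  Rabs (/ INR M * rsum M (fun m => branch_fun a b T j l (node M delta m)) - (W 1 - W (-1)) / 2)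
  <= 12 / INR M.
Proof.
  intros [ab lo hi sg1 range mono inf sup] HM Hd W1 W2 der.
  set (S := fun x => if Rle_dec x a then sg * W (- sg) else if Rlt_dec x b then sg * W (T x) else sg * W sg).
  set (D := fun x => if Rle_dec x a then -3 else
              if Rlt_dec x b then spow j (sg * T x) + spow l x else 3).
  assert (Wsg : continuous W sg) by (destruct sg1 as [->| ->]; assumption).
  assert (Wsg' : continuous W (- sg)).
  { destruct sg1 as [->| ->]; [assumption|]. now replace (- -1) with 1 by ring. }
  assert (sg_abs : Rabs sg = 1).
  { destruct sg1 as [->| ->]; [apply Rabs_R1|]. rewrite Rabs_left; lra. }
  assert (sg_sqr : sg * sg = 1) by (destruct sg1 as [->| ->]; ring).
  assert (range' : forall x, a < x < b -> -1 <= sg * T x <= 1).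
  { intros x Hx. specialize (range x Hx). destruct sg1 as [->| ->]; lra. }
  assert (S_in : forall x, a < x < b -> S x = sg * W (T x)).
  { intros x Hx. unfold S. destruct (Rle_dec x a); simpl; [lra|]. destruct (Rlt_dec x b); simpl; [easy|lra]. }
  assert (S_l : forall x, x <= a -> S x = sg * W (- sg)).
  { intros x Hx. unfold S. destruct (Rle_dec x a); simpl; [easy|lra]. }
  assert (S_r : forall x, b <= x -> S x = sg * W sg).
  { intros x Hx. unfold S. destruct (Rle_dec x a); simpl; [lra|]. destruct (Rlt_dec x b); simpl; [lra|easy]. }
  replace ((W 1 - W (-1)) / 2) with ((S b - S a) / 2).
  2:{ rewrite S_r, S_l by lra. destruct sg1 as [->| ->]; [replace (- (1)) with (-1) by ring|replace (- -1) with 1 by ring]; field. }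
  replace (12 / INR M) with (4 * 3 / INR M) by (unfold Rdiv; ring).
  apply (cell_quadrature a b S (branch_fun a b T j l) D ab); try assumption.
  - intros x. destruct (Rtotal_order x a) as [L|[L|L]].
    + apply continuous_ext_loc with (fun _ => sg * W (- sg)); [|apply continuous_const].
      apply (locally_interval _ x m_infty a); try (simpl; lra || easy); simpl; intros y _ Hy. symmetry. apply S_l. lra.
    + subst x. apply continuous_eps. intros eps Heps.
      destruct (proj1 (continuous_eps _ _) Wsg' eps Heps) as [d [Hd0 E]].
      destruct (inf d Hd0) as [x0 [Hx0 I0]].
      exists (x0 - a). split; [lra|]. intros y Hy. apply Rabs_def2 in Hy.
      rewrite (S_l a) by lra. destruct (Rle_dec y a) as [Hya|Hya].
      * rewrite S_l by exact Hya. now rewrite Rminus_diag, Rabs_R0.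
      * assert (Y : a < y < b) by lra. rewrite S_in by exact Y.
        rewrite <- Rmult_minus_distr_l, Rabs_mult, sg_abs, Rmult_1_l. apply E.
        replace (T y - - sg) with (sg * (sg * T y + 1)) by (rewrite Rmult_plus_distr_l, <- Rmult_assoc, sg_sqr; ring).
        rewrite Rabs_mult, sg_abs, Rmult_1_l. specialize (range' y Y).
        assert (Mo := mono y x0 ltac:(lra) ltac:(lra) ltac:(lra)).
        rewrite Rabs_pos_eq; lra.
    + destruct (Rtotal_order x b) as [L'|[L'|L']].
      * apply continuous_ext_loc with (fun x => sg * W (T x)).
        { apply (locally_interval _ x a b); try (simpl; lra); simpl; intros y Hlo Hhi. symmetry. apply S_in. lra. }
        apply (ex_derive_continuous (fun x => sg * W (T x))). eexists. apply der. lra.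
      * subst x. apply continuous_eps. intros eps Heps.
        destruct (proj1 (continuous_eps _ _) Wsg eps Heps) as [d [Hd0 E]].
        destruct (sup d Hd0) as [x0 [Hx0 I0]].
        exists (b - x0). split; [lra|]. intros y Hy. apply Rabs_def2 in Hy.
        rewrite (S_r b) by lra. destruct (Rle_dec b y) as [Hyb|Hyb].
        -- rewrite S_r by exact Hyb. now rewrite Rminus_diag, Rabs_R0.
        -- assert (Y : a < y < b) by lra. rewrite S_in by exact Y.
           rewrite <- Rmult_minus_distr_l, Rabs_mult, sg_abs, Rmult_1_l. apply E.
           replace (T y - sg) with (sg * (sg * T y - 1)) by (rewrite Rmult_minus_distr_l, <- Rmult_assoc, sg_sqr; ring).
           rewrite Rabs_mult, sg_abs, Rmult_1_l. specialize (range' y Y).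
           assert (Mo := mono x0 y ltac:(lra) ltac:(lra) ltac:(lra)).
           rewrite Rabs_left1; lra.
      * apply continuous_ext_loc with (fun _ => sg * W sg); [|apply continuous_const].
        apply (locally_interval _ x b p_infty); try (simpl; lra || easy); simpl; intros y Hy _. symmetry. apply S_r. lra.
  - intros x Hx. unfold branch_fun. destruct (Rlt_dec a x); [|lra]. destruct (Rlt_dec x b); [|lra]. simpl.
    apply is_derive_ext_loc with (2 := der x Hx).
    apply (locally_interval _ x a b); try (simpl; lra); simpl; intros y Hlo Hhi. symmetry. apply S_in. lra.
  - intros x Hx. rewrite !S_l; lra.
  - intros x Hx. rewrite !S_r; lra.
  - intros x Hx. unfold branch_fun.
    destruct (Rlt_dec a x); simpl; [|easy]. destruct (Rlt_dec x b); simpl; [lra|easy].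
  - intros x y Hxy. unfold D, branch_fun.
    assert (F : forall z, a < z < b -> Rabs (T z ^ j * z ^ l) <= 1).
    { intros z Hz. rewrite Rabs_mult, <- (Rmult_1_l 1).
      apply Rmult_le_compat; try apply Rabs_pos; apply Rabs_pow_le1; [now apply range|lra]. }
    assert (G : forall z, a < z < b -> -2 <= spow j (sg * T z) + spow l z <= 2).
    { intros z Hz. generalize (spow_bound j (sg * T z) (range' z Hz)) (spow_bound l z ltac:(lra)). lra. }
    destruct (Rlt_dec a x) as [Xa|Xa]; destruct (Rlt_dec x b) as [Xb|Xb];
    destruct (Rlt_dec a y) as [Ya|Ya]; destruct (Rlt_dec y b) as [Yb|Yb];
    destruct (Rle_dec x a) as [Xc|Xc]; destruct (Rle_dec y a) as [Yc|Yc]; simpl; try lra;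
      rewrite ?Rminus_diag, ?Rminus_0_r, ?Rminus_0_l, ?Rabs_Ropp, ?Rabs_R0; try lra.
    + assert (Hx : a < x < b) by lra. assert (Hy : a < y < b) by lra.
      assert (V1 := spow_variation l x y Hxy).
      assert (V2 := spow_variation j (sg * T x) (sg * T y) (mono x y Xa Hxy Yb)).
      rewrite !Rpow_mult_distr, <- Rmult_minus_distr_l, Rabs_mult in V2.
      rewrite <- (RPow_abs sg), sg_abs, pow1, Rmult_1_l in V2.
      replace (T y ^ j * y ^ l - T x ^ j * x ^ l)
        with ((T y ^ j - T x ^ j) * y ^ l + T x ^ j * (y ^ l - x ^ l)) by ring.
      eapply Rle_trans; [apply Rabs_triang|]. rewrite !Rabs_mult.
      assert (P1 := Rabs_pow_le1 l y ltac:(lra)). assert (P2 := Rabs_pow_le1 j (T x) (range x Hx)).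
      assert (Q1 := Rabs_pos (T y ^ j - T x ^ j)). assert (Q2 := Rabs_pos (y ^ l - x ^ l)).
      nra.
    + generalize (F x ltac:(lra)) (G x ltac:(lra)). lra.
    + generalize (F y ltac:(lra)) (G y ltac:(lra)). lra.
  - intros x. unfold D.
    destruct (Rle_dec x a); simpl; [lra|]. destruct (Rlt_dec x b); simpl; [|lra].
    generalize (spow_bound j (sg * T x) (range' x ltac:(lra))) (spow_bound l x ltac:(lra)). lra.
Qed.

Definition indic (x c : R) : R := if Req_EM_T x c then 1 else 0.

(** The nodes increase strictly. A hit of [c] at node [m] is an increment of the step function [J]
    between node [m] and the next, and these increments telescope. *)
Lemma indic_nodes M delta c : (0 < M)%nat -> rsum M (fun m => indic (node M delta m) c) <= 1.
Proof.
  intros HM. assert (M0 : 0 < INR M) by now apply lt_0_INR.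
  assert (h0 : 0 < 2 / INR M) by (apply Rdiv_lt_0_compat; lra).
  set (J := fun x => if Rlt_dec c x then 1 else 0).
  apply Rle_trans with (rsum M (fun m => J (node M delta (S m)) - J (node M delta m))).
  - apply rsum_le. intros m _. rewrite node_S by exact HM. unfold J, indic.
    destruct (Req_EM_T _ c); destruct (Rlt_dec c _); destruct (Rlt_dec c _); simpl; lra.
  - rewrite (rsum_telescope M (fun m => J (node M delta m))). unfold J.
    destruct (Rlt_dec c _); destruct (Rlt_dec c _); simpl; lra.
Qed.

Lemma node_bound M delta m : (m < M)%nat -> 0 <= delta <= 2 / INR M -> -1 <= node M delta m <= 1.
Proof.
  intros Hm Hd. assert (M0 : 0 < INR M) by (apply lt_0_INR; lia).
  assert (H1 : INR m + 1 <= INR M) by (rewrite <- S_INR; apply le_INR; lia).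
  assert (P := pos_INR m). unfold node.
  assert (Q : 0 <= 2 * INR m / INR M) by (apply Rdiv_le_0_compat; lra).
  assert (Q' : 2 * INR m / INR M + 2 / INR M <= 2).
  { apply Rmult_le_reg_r with (INR M); [exact M0|].
    replace ((2 * INR m / INR M + 2 / INR M) * INR M) with (2 * (INR m + 1)) by (field; lra). lra. }
  lra.
Qed.

Record full_branch_map (d : nat) (a b : nat -> R) (T : R -> R) (sg : nat -> R) : Prop := {
  fbm_branch : forall i, (i < d)%nat -> full_branch (a i) (b i) T (sg i);
  fbm_range : forall x, -1 <= x <= 1 -> -1 <= T x <= 1;
  fbm_cover : forall x, -1 <= x <= 1 -> exists i, (i < d)%nat /\ a i <= x <= b i;
  fbm_disjoint : forall i i', (i < d)%nat -> (i' < d)%nat -> i <> i' ->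
     forall x, ~ (a i < x < b i /\ a i' < x < b i') }.

(** Each branch contributes 12. Its two endpoints, where [branch_fun] is zero, are each hit by at
    most one node with a value of modulus at most 1, which adds 2. *)
Lemma quadrature d (a b : nat -> R) T (sg : nat -> R) (W : nat -> R -> R) j l M delta :
  full_branch_map d a b T sg ->
  (0 < M)%nat -> 0 <= delta <= 2 / INR M ->
  (forall i, (i < d)%nat -> continuous (W i) 1 /\ continuous (W i) (-1)) ->
  (forall i x, (i < d)%nat -> a i < x < b i ->
     is_derive (fun x => sg i * W i (T x)) x (T x ^ j * x ^ l)) ->
  Rabs (/ INR M * rsum M (fun m => T (node M delta m) ^ j * node M delta m ^ l)
        - rsum d (fun i => (W i 1 - W i (-1)) / 2)) <= INR d * 14 / INR M.
Proof.
  intros [Hfb HT Hcov Hdis] HM Hd HW Hder. assert (M0 : 0 < INR M) by now apply lt_0_INR.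
  set (x := node M delta).
  assert (A1 : Rabs (rsum d (fun i => / INR M * rsum M (fun m => branch_fun (a i) (b i) T j l (x m))
     - (W i 1 - W i (-1)) / 2)) <= INR d * (12 / INR M)).
  { eapply Rle_trans; [apply rsum_abs|]. rewrite <- rsum_const. apply rsum_le. intros i Hi.
    destruct (HW i Hi). apply (branch_quadrature (a i) (b i) T (sg i)); auto. }
  assert (A2 : forall y, -1 <= y <= 1 ->
    Rabs (T y ^ j * y ^ l - rsum d (fun i => branch_fun (a i) (b i) T j l y))
    <= rsum d (fun i => indic y (a i) + indic y (b i))).
  { intros y Hy.
    assert (IP : forall c, 0 <= indic y c) by (intros c; unfold indic; destruct (Req_EM_T y c); simpl; lra).
    assert (IP' : forall i, 0 <= indic y (a i) + indic y (b i)) by (intros i; generalize (IP (a i)) (IP (b i)); lra).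
    assert (out : forall i, ~ (a i < y < b i) -> branch_fun (a i) (b i) T j l y = 0).
    { intros i Hi. unfold branch_fun. destruct (Rlt_dec (a i) y); simpl; [|easy].
      destruct (Rlt_dec y (b i)); simpl; [|easy]. exfalso; apply Hi; lra. }
    destruct (Classical_Prop.classic (exists i, (i < d)%nat /\ a i < y < b i)) as [[i [Hi Hin]]|N].
    - replace (rsum d (fun i => branch_fun (a i) (b i) T j l y)) with (T y ^ j * y ^ l).
      + rewrite Rminus_diag, Rabs_R0. apply rsum_pos. auto.
      + symmetry. replace d with (i + S (d - S i))%nat by lia.
        rewrite rsum_split, (rsum_ext i _ (fun _ => 0)), rsum_const.
        2:{ intros k Hk. apply out. intros F. apply (Hdis k i ltac:(lia) Hi ltac:(lia) y). now split. }
        rewrite rsum_S_l, (rsum_ext (d - S i) _ (fun _ => 0)), rsum_const.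
        2:{ intros k Hk. apply out. intros F.
            apply (Hdis (i + S k)%nat i ltac:(lia) Hi ltac:(lia) y). now split. }
        rewrite Nat.add_0_r. unfold branch_fun. destruct (Rlt_dec (a i) y); [|lra].
        destruct (Rlt_dec y (b i)); [|lra]. simpl. ring.
    - rewrite (rsum_ext d _ (fun _ => 0)), rsum_const.
      2:{ intros k Hk. apply out. intros F. apply N. now exists k. }
      destruct (Hcov y Hy) as [i [Hi Hin]].
      apply Rle_trans with (indic y (a i) + indic y (b i)).
      + rewrite Rmult_0_r, Rminus_0_r, Rabs_mult.
        assert (F : 1 <= indic y (a i) + indic y (b i)).
        { assert (E : y = a i \/ y = b i).
          { destruct (Req_dec y (a i)) as [e|n]; [now left|]. right.
            destruct (Req_dec y (b i)) as [e|n']; [exact e|]. exfalso. apply N. exists i. split; [exact Hi|lra]. }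
          generalize (IP (a i)) (IP (b i)).
          destruct E as [E|E].
          - intros _ Q. assert (indic y (a i) = 1) by (unfold indic; destruct (Req_EM_T y (a i)); easy). lra.
          - intros Q _. assert (indic y (b i) = 1) by (unfold indic; destruct (Req_EM_T y (b i)); easy). lra. }
        apply Rle_trans with (2 := F). rewrite <- (Rmult_1_l 1).
        apply Rmult_le_compat; try apply Rabs_pos; apply Rabs_pow_le1; auto.
      + apply (rsum_term_le d (fun i => indic y (a i) + indic y (b i))); auto. }
  assert (A3 : Rabs (rsum M (fun m => T (x m) ^ j * x m ^ l
      - rsum d (fun i => branch_fun (a i) (b i) T j l (x m)))) <= INR d * 2).
  { eapply Rle_trans; [apply rsum_abs|].
    apply Rle_trans with (rsum M (fun m => rsum d (fun i => indic (x m) (a i) + indic (x m) (b i)))).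
    - apply rsum_le. intros m Hm. apply A2. now apply node_bound.
    - rewrite rsum_swap, <- rsum_const. apply rsum_le. intros i _. rewrite rsum_plus.
      generalize (indic_nodes M delta (a i) HM) (indic_nodes M delta (b i) HM). unfold x. lra. }
  rewrite rsum_minus, rsum_swap in A3. rewrite rsum_minus, rsum_scal in A1.
  set (P := rsum M (fun m => T (x m) ^ j * x m ^ l)) in *.
  set (Q := rsum d (fun i => rsum M (fun m => branch_fun (a i) (b i) T j l (x m)))) in *.
  set (I := rsum d (fun i => (W i 1 - W i (-1)) / 2)) in *.
  replace (/ INR M * P - I) with (/ INR M * (P - Q) + (/ INR M * Q - I)) by ring.
  eapply Rle_trans; [apply Rabs_triang|].
  rewrite Rabs_mult, (Rabs_pos_eq (/ INR M)) by (left; now apply Rinv_0_lt_compat).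
  apply Rle_trans with (/ INR M * (INR d * 2) + INR d * (12 / INR M)).
  - apply Rplus_le_compat; [|exact A1]. apply Rmult_le_compat_l; [left; now apply Rinv_0_lt_compat|exact A3].
  - apply Req_le. field. lra.
Qed.

(** The mean of [x ^ n] over [[-1, 1]]: half the integral, to match the factor [/ INR M] of the
    discrete sums. *)
Definition moment (n : nat) : R := (1 - (-1) ^ S n) / INR (S n) / 2.

(** The identity is a full branch map with the single branch [(-1, 1)], so the general quadrature
    bound applies with [d = 1] and [j = 0]. *)
Lemma moment_quadrature n M delta : (0 < M)%nat -> 0 <= delta <= 2 / INR M ->
  Rabs (/ INR M * rsum M (fun m => node M delta m ^ n) - moment n) <= 14 / INR M.
Proof.
  intros HM Hd. assert (N : INR (S n) <> 0) by (apply not_0_INR; lia).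
  assert (D : forall y, is_derive (fun y => y ^ S n / INR (S n)) y (y ^ n)).
  { intros y. assert (E : forall p k, k <> 0 -> is_derive (fun y => y ^ p / k) y (INR p * y ^ pred p / k)).
    { intros p k Hk. auto_derive; [easy|]. field. exact Hk. }
    replace (y ^ n) with (INR (S n) * y ^ pred (S n) / INR (S n)) by (simpl pred; now field). now apply E. }
  assert (C : forall y, continuous (fun y => y ^ S n / INR (S n)) y).
  { intros y. apply (ex_derive_continuous (fun y => y ^ S n / INR (S n))). eexists; apply D. }
  assert (Q := quadrature 1 (fun _ => -1) (fun _ => 1) (fun x => x) (fun _ => 1)
    (fun _ y => y ^ S n / INR (S n)) 0 n M delta).
  cbn [rsum] in Q. change (INR 1) with 1 in Q. cbv beta in Q.
  replace (/ INR M * rsum M (fun m => node M delta m ^ n) - moment n)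
    with (/ INR M * rsum M (fun m => node M delta m ^ 0 * node M delta m ^ n)
          - (0 + (1 ^ S n / INR (S n) - (-1) ^ S n / INR (S n)) / 2)).
  2:{ rewrite pow1. unfold moment. rewrite (rsum_ext M (fun m => node M delta m ^ 0 * node M delta m ^ n) (fun m => node M delta m ^ n))
        by (intros; simpl; ring).
      field. split; [exact N|apply not_0_INR; lia]. }
  replace (14 / INR M) with (1 * 14 / INR M) by (unfold Rdiv; ring).
  apply Q; clear Q; auto.
  - split; auto.
    + intros i _. split; try lra; intros; try lra.
      * exists (-1 + Rmin 1 (eps / 2)). assert (A := Rmin_l 1 (eps / 2)). assert (B := Rmin_r 1 (eps / 2)).
        assert (0 < Rmin 1 (eps / 2)) by (apply Rmin_glb_lt; lra). lra.
      * exists (1 - Rmin 1 (eps / 2)). assert (A := Rmin_l 1 (eps / 2)). assert (B := Rmin_r 1 (eps / 2)).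
        assert (0 < Rmin 1 (eps / 2)) by (apply Rmin_glb_lt; lra). lra.
    + intros x Hx. exists O. split; [lia|lra].
    + intros i i' Hi Hi'. lia.
  - intros i x _ _. replace (x ^ 0 * x ^ n) with (x ^ n) by (simpl; ring).
    apply is_derive_ext with (2 := D x). intros t. simpl. ring.
Qed.

(** * Lower bound for the moment form *)

Lemma is_derive_rsum n (f f' : nat -> R -> R) x :
  (forall i, (i < n)%nat -> is_derive (f i) x (f' i x)) ->
  is_derive (fun x => rsum n (fun i => f i x)) x (rsum n (fun i => f' i x)).
Proof.
  induction n as [|n IH]; intros H; simpl.
  - apply is_derive_Reals, derivable_pt_lim_const.
  - apply (is_derive_plus (fun x => rsum n (fun i => f i x))); auto.
Qed.

Lemma rsum_rsum_mult n m f g :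
  rsum n (fun i => rsum m (fun j => f i * g j)) = rsum n f * rsum m g.
Proof.
  rewrite (rsum_ext n _ (fun i => rsum m g * f i)); [rewrite rsum_scal; ring|].
  intros i _. rewrite rsum_scal. ring.
Qed.

(* Coefficients of the Chebyshev polynomials of the second kind (U_n, U_(n-1)). *)
Definition shift (p : nat -> R) (k : nat) : R := match k with O => 0 | S k' => p k' end.

Fixpoint chebU (n : nat) : (nat -> R) * (nat -> R) :=
  match n with
  | O => (fun k => match k with O => 1 | S _ => 0 end, fun _ => 0)
  | S m => (fun k => 2 * shift (fst (chebU m)) k - snd (chebU m) k, fst (chebU m))
  end.

Lemma chebU_support n k : ((n < k)%nat -> fst (chebU n) k = 0) /\ ((n <= k)%nat -> snd (chebU n) k = 0).
Proof.
  revert k. induction n as [|n IH]; intros k.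
  - split; [|easy]. destruct k; [lia|easy].
  - split; intros H; simpl.
    + destruct k as [|k]; [lia|]. simpl. rewrite (proj1 (IH k)), (proj2 (IH (S k))) by lia. ring.
    + apply IH. lia.
Qed.

Lemma chebU_lead n : fst (chebU n) n = 2 ^ n.
Proof.
  induction n as [|n IH]; [easy|]. simpl. rewrite IH, (proj2 (chebU_support n (S n))) by lia. ring.
Qed.

(** By [U_(n+1) = 2 x U_n - U_(n-1)] the l1 norms grow at most like solutions of
    [v_(n+1) = 2 v_n + v_(n-1)], whose dominant root is [1 + sqrt 2]. Its square is [gamma]. *)
Lemma chebU_l1 n K : rsum K (fun k => Rabs (fst (chebU n) k)) <= (1 + sqrt 2) ^ n
  /\ (1 + sqrt 2) * rsum K (fun k => Rabs (snd (chebU n) k)) <= (1 + sqrt 2) ^ n.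
Proof.
  set (s := 1 + sqrt 2). assert (s2 : s * s = 2 * s + 1).
  { unfold s. generalize (sqrt_sqrt 2 ltac:(lra)). nra. }
  assert (s1 : 1 <= s) by (unfold s; generalize (sqrt_pos 2); lra).
  revert K. induction n as [|n IH]; intros K.
  - simpl. split.
    + destruct K as [|K]; [simpl; lra|]. rewrite rsum_S_l, Rabs_R1, Rabs_R0, rsum_const. lra.
    + rewrite Rabs_R0, rsum_const. lra.
  - destruct (IH K) as [I1 I2]. simpl pow. simpl fst. simpl snd. split.
    + assert (sh : rsum K (fun k => Rabs (shift (fst (chebU n)) k)) <= s ^ n).
      { destruct K as [|K]; [simpl; apply pow_le; lra|].
        rewrite rsum_S_l. simpl shift. rewrite Rabs_R0, Rplus_0_l. apply (IH K). }
      apply Rle_trans with (2 * rsum K (fun k => Rabs (shift (fst (chebU n)) k))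
                            + rsum K (fun k => Rabs (snd (chebU n) k))).
      * rewrite <- rsum_scal, <- rsum_plus. apply rsum_le. intros k _. unfold Rminus.
        eapply Rle_trans; [apply Rabs_triang|]. rewrite Rabs_Ropp, Rabs_mult, (Rabs_pos_eq 2); lra.
      * apply Rmult_le_reg_l with s; [lra|].
        replace (s * (s * s ^ n)) with (s * s * s ^ n) by ring. rewrite s2. nra.
    + apply Rmult_le_compat_l; [lra|exact I1].
Qed.

(** The recurrence of [chebU] mirrors the addition formula for [sin ((n + 1) theta)]. The cutoff [K]
    is any number beyond the degree, because [shift] moves it by one in the induction. *)
Lemma chebU_eval n K theta : (n < K)%nat ->
  sin theta * rsum K (fun k => fst (chebU n) k * cos theta ^ k) = sin (INR (S n) * theta)
  /\ sin theta * rsum K (fun k => snd (chebU n) k * cos theta ^ k) = sin (INR n * theta).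
Proof.
  revert K. induction n as [|n IH]; intros K HK.
  - destruct K as [|K]; [lia|]. split.
    + rewrite rsum_S_l, (rsum_ext K _ (fun _ => 0)) by (intros; simpl; ring).
      rewrite rsum_const. simpl. rewrite !Rmult_1_l. ring.
    + rewrite (rsum_ext _ _ (fun _ => 0)) by (intros; simpl; ring).
      rewrite rsum_const. simpl. rewrite Rmult_0_l, sin_0. ring.
  - split; [|apply IH; lia]. destruct K as [|K]; [lia|].
    destruct (IH K ltac:(lia)) as [I1 _]. destruct (IH (S K) ltac:(lia)) as [_ I2].
    simpl fst.
    rewrite (rsum_ext _ _ (fun k => 2 * (shift (fst (chebU n)) k * cos theta ^ k) - snd (chebU n) k * cos theta ^ k))
      by (intros; ring).
    rewrite rsum_minus, rsum_scal.
    replace (rsum (S K) (fun k => shift (fst (chebU n)) k * cos theta ^ k))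
      with (cos theta * rsum K (fun k => fst (chebU n) k * cos theta ^ k)).
    + transitivity (2 * cos theta * (sin theta * rsum K (fun k => fst (chebU n) k * cos theta ^ k))
        - sin theta * rsum (S K) (fun k => snd (chebU n) k * cos theta ^ k)); [ring|].
      rewrite I1, I2, !S_INR.
      replace ((INR n + 1 + 1) * theta) with ((INR n + 1) * theta + theta) by ring.
      replace (INR n * theta) with ((INR n + 1) * theta - theta) by ring.
      rewrite sin_plus, sin_minus. ring.
    + rewrite rsum_S_l, <- rsum_scal. simpl shift. rewrite Rmult_0_l, Rplus_0_l.
      apply rsum_ext. intros k _. simpl. ring.
Qed.

(** The leading coefficients [2 ^ n] are nonzero, so the top degree can be eliminated repeatedly. *)
Lemma chebU_basis N (c : nat -> R) : (forall k, (N <= k)%nat -> c k = 0) ->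
  exists a : nat -> R, forall k, c k = rsum N (fun n => a n * fst (chebU n) k).
Proof.
  revert c. induction N as [|N IH]; intros c Hc.
  - exists (fun _ => 0). intros k. simpl. apply Hc. lia.
  - destruct (IH (fun k => c k - c N / 2 ^ N * fst (chebU N) k)) as [a Ha].
    + intros k Hk. destruct (Nat.eq_dec k N) as [->|E].
      * rewrite chebU_lead. field. apply pow_nonzero. lra.
      * rewrite Hc, (proj1 (chebU_support N k)) by lia. ring.
    + exists (fun n => if Nat.eq_dec n N then c N / 2 ^ N else a n). intros k. simpl.
      destruct (Nat.eq_dec N N) as [_|E]; [|easy].
      rewrite (rsum_ext N _ (fun n => a n * fst (chebU n) k)).
      * rewrite <- Ha. simpl. ring.
      * intros n Hn. destruct (Nat.eq_dec n N); [lia|easy].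
Qed.

(** A primitive of [sin ((n + 1) t) * sin ((m + 1) t)] by the product formula; the diagonal is
    separate because [n - m] is a denominator. *)
Definition sin_prod (n m : nat) (t : R) : R :=
  if Nat.eq_dec n m then t / 2 - sin (2 * INR (S n) * t) / (4 * INR (S n))
  else (sin ((INR n - INR m) * t) / (INR n - INR m) - sin ((INR n + INR m + 2) * t) / (INR n + INR m + 2)) / 2.

Lemma sin_prod_derive n m t : is_derive (sin_prod n m) t (sin (INR (S n) * t) * sin (INR (S m) * t)).
Proof.
  unfold sin_prod. rewrite !S_INR. assert (P := pos_INR n). assert (Q := pos_INR m).
  destruct (Nat.eq_dec n m) as [->|E].
  - generalize dependent (INR m); intros x _ Hx. auto_derive; [lra|].
    replace (2 * (x + 1) * t) with (2 * ((x + 1) * t)) by ring.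
    rewrite cos_2a_sin. field. lra.
  - assert (D : INR n - INR m <> 0).
    { intros F. apply E, INR_eq. lra. }
    generalize dependent (INR n); intros x Hx. generalize dependent (INR m); intros y Hy D.
    auto_derive; [lra|].
    replace ((x - y) * t) with ((x + 1) * t - (y + 1) * t) by ring.
    replace ((x + y + 2) * t) with ((x + 1) * t + (y + 1) * t) by ring.
    replace ((x + - y) * t) with ((x + 1) * t - (y + 1) * t) by ring.
    rewrite cos_minus, cos_plus. field. lra.
Qed.

Lemma sin_INR_PI (x : Z) : sin (IZR x * PI) = 0.
Proof. apply sin_eq_0_1. now exists x. Qed.

Lemma sin_prod_PI n m : sin_prod n m PI - sin_prod n m 0 = if Nat.eq_dec n m then PI / 2 else 0.
Proof.
  assert (P := pos_INR n). assert (Q := pos_INR m).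
  unfold sin_prod. destruct (Nat.eq_dec n m) as [->|E].
  - rewrite Rmult_0_r, sin_0.
    replace (2 * INR (S m) * PI) with (IZR (2 * Z.of_nat (S m)) * PI)
      by (rewrite mult_IZR, <- INR_IZR_INZ; ring).
    rewrite sin_INR_PI. field. apply not_0_INR. lia.
  - assert (D : INR n - INR m <> 0) by (intros F; apply E, INR_eq; lra).
    rewrite !Rmult_0_r, sin_0.
    replace ((INR n - INR m) * PI) with (IZR (Z.of_nat n - Z.of_nat m) * PI)
      by (rewrite minus_IZR, <- !INR_IZR_INZ; ring).
    replace ((INR n + INR m + 2) * PI) with (IZR (Z.of_nat n + Z.of_nat m + 2) * PI)
      by (rewrite !plus_IZR, <- !INR_IZR_INZ; ring).
    rewrite !sin_INR_PI. field. lra.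
Qed.

(* Substituting x = cos theta, int p^2 dx dominates int p(cos theta)^2 sin^2 theta dtheta;
   both sides are compared through their antiderivatives. *)
Lemma chebU_bessel N (c a : nat -> R) :
  (forall k, c k = rsum N (fun n => a n * fst (chebU n) k)) ->
  PI / 2 * rsum N (fun n => a n ^ 2)
  <= 2 * rsum N (fun j => rsum N (fun k => c j * c k * moment (j + k))).
Proof.
  intros Ha. assert (pi := PI_RGT_0).
  set (p := fun x => rsum N (fun k => c k * x ^ k)).
  set (q := fun t => rsum N (fun n => a n * sin (INR (S n) * t))).
  assert (pq : forall t, sin t * p (cos t) = q t).
  { intros t. unfold p, q.
    rewrite (rsum_ext N (fun k => c k * cos t ^ k) (fun k => rsum N (fun n => a n * (fst (chebU n) k * cos t ^ k)))).
    - rewrite rsum_swap, <- rsum_scal. apply rsum_ext. intros n Hn.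
      rewrite rsum_scal, <- (proj1 (chebU_eval n N t Hn)). ring.
    - intros k _. rewrite Ha, Rmult_comm, <- rsum_scal. apply rsum_ext. intros; ring. }
  set (A := fun x => rsum N (fun j => rsum N (fun k => c j * c k * (x ^ S (j + k) / INR (S (j + k)))))).
  assert (dA : forall x, is_derive A x (p x ^ 2)).
  { intros x. unfold A.
    replace (p x ^ 2) with (rsum N (fun j => rsum N (fun k => c j * c k * x ^ (j + k)))).
    - apply (is_derive_rsum N (fun j x => rsum N (fun k => c j * c k * (x ^ S (j + k) / INR (S (j + k)))))
         (fun j x => rsum N (fun k => c j * c k * x ^ (j + k)))). intros j _.
      apply (is_derive_rsum N (fun k x => c j * c k * (x ^ S (j + k) / INR (S (j + k))))
         (fun k x => c j * c k * x ^ (j + k))). intros k _.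
      assert (Nz : INR (S (j + k)) <> 0) by (apply not_0_INR; lia).
      assert (E : forall w e z, z <> 0 -> is_derive (fun y => w * (y ^ e / z)) x (w * (INR e * x ^ pred e / z))).
      { intros w e z Hz. auto_derive; [easy|]. field. exact Hz. }
      replace (c j * c k * x ^ (j + k)) with (c j * c k * (INR (S (j + k)) * x ^ pred (S (j + k)) / INR (S (j + k))))
        by (simpl pred; now field). now apply E.
    - replace (p x ^ 2) with (p x * p x) by ring. unfold p. rewrite <- rsum_rsum_mult. apply rsum_ext. intros j _.
      apply rsum_ext. intros k _. rewrite pow_add. ring. }
  set (B := fun t => rsum N (fun n => rsum N (fun m => a n * a m * sin_prod n m t))).
  assert (dB : forall t, is_derive B t (q t ^ 2)).
  { intros t. unfold B.
    replace (q t ^ 2) with (rsum N (fun n => rsum N (fun m => a n * a m * (sin (INR (S n) * t) * sin (INR (S m) * t))))).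
    - apply (is_derive_rsum N (fun n t => rsum N (fun m => a n * a m * sin_prod n m t))
         (fun n t => rsum N (fun m => a n * a m * (sin (INR (S n) * t) * sin (INR (S m) * t))))). intros n _.
      apply (is_derive_rsum N (fun m t => a n * a m * sin_prod n m t)
         (fun m t => a n * a m * (sin (INR (S n) * t) * sin (INR (S m) * t)))). intros m _.
      apply is_derive_scal, sin_prod_derive.
    - replace (q t ^ 2) with (q t * q t) by ring. unfold q. rewrite <- rsum_rsum_mult. apply rsum_ext. intros n _.
      apply rsum_ext. intros m _. ring. }
  (* This derivative is [sin t * (sin t - 1) * p (cos t) ^ 2], nonpositive on [[0, PI]]. So the
     increment of [B] there is at most that of [A] from -1 to 1. *)
  assert (D : forall t, is_derive (fun t => A (cos t) + B t) t (- sin t * p (cos t) ^ 2 + q t ^ 2)).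
  { intros t. apply (is_derive_plus (fun t => A (cos t)) B); [|apply dB].
    apply (is_derive_comp A cos); [apply dA|]. auto_derive; [easy|ring]. }
  destruct (MVT_gen (fun t => A (cos t) + B t) 0 PI (fun t => - sin t * p (cos t) ^ 2 + q t ^ 2)) as [t [Ht E]].
  - intros t _. apply D.
  - intros t _. apply continuity_pt_filterlim, (ex_derive_continuous (fun t => A (cos t) + B t)). eexists; apply D.
  - rewrite Rmin_left, Rmax_right in Ht by lra.
    assert (L : - sin t * p (cos t) ^ 2 + q t ^ 2 <= 0).
    { rewrite <- pq. assert (S0 := sin_ge_0 t (proj1 Ht) (proj2 Ht)). assert (S1 := SIN_bound t).
      assert (P2 := pow2_ge_0 (p (cos t))). set (P := p (cos t) ^ 2) in *.
      replace (- sin t * P + (sin t * p (cos t)) ^ 2) with (- (P * (sin t * (1 - sin t)))) by (unfold P; ring).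
      assert (0 <= P * (sin t * (1 - sin t))) by (apply Rmult_le_pos; [exact P2|apply Rmult_le_pos; lra]). lra. }
    assert (BB : B PI - B 0 = PI / 2 * rsum N (fun n => a n ^ 2)).
    { unfold B. rewrite <- rsum_minus, <- rsum_scal. apply rsum_ext. intros n Hn. rewrite <- rsum_minus.
      rewrite (rsum_ext N _ (fun m => if Nat.eq_dec n m then PI / 2 * a n ^ 2 else 0)).
      - replace N with (n + S (N - S n))%nat by lia.
        rewrite rsum_split, (rsum_ext n _ (fun _ => 0)), rsum_const.
        2:{ intros m Hm. destruct (Nat.eq_dec n m); [lia|easy]. }
        rewrite rsum_S_l, (rsum_ext (N - S n) _ (fun _ => 0)), rsum_const.
        2:{ intros m Hm. destruct (Nat.eq_dec n (n + S m)); [lia|easy]. }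
        destruct (Nat.eq_dec n (n + 0)); [ring|lia].
      - intros m _. rewrite <- Rmult_minus_distr_l, sin_prod_PI.
        destruct (Nat.eq_dec n m) as [->|_]; ring. }
    assert (AA : A 1 - A (-1) = 2 * rsum N (fun j => rsum N (fun k => c j * c k * moment (j + k)))).
    { unfold A. rewrite <- rsum_minus, <- rsum_scal. apply rsum_ext. intros j _.
      rewrite <- rsum_minus, <- rsum_scal. apply rsum_ext. intros k _.
      unfold moment. rewrite pow1. field. apply not_0_INR. lia. }
    rewrite cos_PI, cos_0 in E. rewrite <- BB, <- AA.
    assert ((- sin t * p (cos t) ^ 2 + q t ^ 2) * (PI - 0) <= 0) by nra. lra.
Qed.

Lemma gamma_ge_5 : 5 <= gamma.
Proof.
  unfold gamma. assert (A := sqrt_sqrt 2 ltac:(lra)). assert (B := sqrt_pos 2).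
  assert (1 <= sqrt 2) by nra. nra.
Qed.

(** The l2 norm of [c] is at most its l1 norm, hence at most the sum of [|a n| (1 + sqrt 2) ^ n],
    and Cauchy-Schwarz produces a geometric sum of [gamma ^ n]. Its divisor [gamma - 1 >= 4]
    outweighs the constant lost in [chebU_bessel]. *)
Lemma moment_lower N (c : nat -> R) :
  rsum N (fun k => c k ^ 2)
  <= gamma ^ N * rsum N (fun j => rsum N (fun k => c j * c k * moment (j + k))).
Proof.
  set (c' := fun k => if lt_dec k N then c k else 0).
  assert (Ec : forall k, (k < N)%nat -> c k = c' k) by (intros k Hk; unfold c'; destruct (lt_dec k N); easy).
  rewrite (rsum_ext N (fun k => c k ^ 2) (fun k => c' k ^ 2)) by (intros; now rewrite Ec).
  rewrite (rsum_ext N (fun j => rsum N (fun k => c j * c k * moment (j + k)))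
    (fun j => rsum N (fun k => c' j * c' k * moment (j + k)))).
  2:{ intros j Hj. apply rsum_ext. intros k Hk. now rewrite (Ec j Hj), (Ec k Hk). }
  destruct (chebU_basis N c') as [a Ha].
  { intros k Hk. unfold c'. destruct (lt_dec k N); [lia|easy]. }
  assert (Bs := chebU_bessel N c' a Ha).
  set (Q := rsum N (fun j => rsum N (fun k => c' j * c' k * moment (j + k)))) in *.
  set (X := rsum N (fun n => a n ^ 2)) in *.
  assert (X0 : 0 <= X) by (apply rsum_pos; intros; apply pow2_ge_0).
  assert (g5 := gamma_ge_5). assert (pi := PI2_1).
  set (s := 1 + sqrt 2). assert (s1 : 1 <= s) by (unfold s; generalize (sqrt_pos 2); lra).
  assert (L1 : rsum N (fun k => Rabs (c' k)) <= rsum N (fun n => Rabs (a n) * s ^ n)).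
  { apply Rle_trans with (rsum N (fun k => rsum N (fun n => Rabs (a n) * Rabs (fst (chebU n) k)))).
    - apply rsum_le. intros k _. rewrite Ha. eapply Rle_trans; [apply rsum_abs|].
      apply Req_le, rsum_ext. intros; apply Rabs_mult.
    - rewrite rsum_swap. apply rsum_le. intros n _. rewrite rsum_scal.
      apply Rmult_le_compat_l; [apply Rabs_pos|apply chebU_l1]. }
  assert (L0 : 0 <= rsum N (fun k => Rabs (c' k))) by (apply rsum_pos; intros; apply Rabs_pos).
  assert (CS := rsum_CS N (fun n => Rabs (a n)) (fun n => s ^ n)). cbv beta in CS.
  rewrite (rsum_ext N (fun i => Rabs (a i) ^ 2) (fun n => a n ^ 2)) in CS by (intros; apply pow2_abs).
  rewrite (rsum_ext N (fun i => (s ^ i) ^ 2) (fun n => gamma ^ n)) in CS.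
  2:{ intros n _. unfold gamma. fold s. now rewrite <- !pow_mult, Nat.mul_comm. }
  fold X in CS. assert (G := rsum_geom_gt1 N gamma ltac:(lra)).
  assert (gN : 0 < gamma ^ N) by (apply pow_lt; lra).
  assert (G' : gamma ^ N / (gamma - 1) <= gamma ^ N / 4).
  { apply Rmult_le_compat_l; [lra|]. apply Rinv_le_contravar; lra. }
  apply Rle_trans with (X * (gamma ^ N / 4)).
  - eapply Rle_trans; [apply rsum_sqr_abs|].
    apply Rle_trans with (rsum N (fun n => Rabs (a n) * s ^ n) ^ 2); [apply pow_incr; lra|].
    apply Rle_trans with (1 := CS). apply Rmult_le_compat_l; lra.
  - assert (X <= 2 * Q) by nra. nra.
Qed.

(** * Operator norm and entrywise sums *)

Lemma is_lim_seq_rsum n (u : nat -> nat -> R) (l : nat -> R) :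
  (forall i, (i < n)%nat -> is_lim_seq (u i) (l i)) ->
  is_lim_seq (fun m => rsum n (fun i => u i m)) (rsum n l).
Proof.
  induction n as [|n IH]; intros H; simpl; [apply is_lim_seq_const|].
  apply is_lim_seq_plus'; auto.
Qed.

Lemma ex_series_bounded (a : nat -> R) B : (forall n, 0 <= a n) ->
  (forall n, rsum n a <= B) -> ex_series a.
Proof.
  intros Ha HB. destruct (ex_finite_lim_seq_incr (fun n => rsum n a) B) as [l Hl].
  - intros n. simpl. generalize (Ha n). lra.
  - exact HB.
  - exists l. now apply is_series_rsum.
Qed.

Lemma Series_abs_le (a b : nat -> R) : (forall n, Rabs (a n) <= b n) -> ex_series b ->
  Rabs (Series a) <= Series b.
Proof.
  intros H Hb.
  assert (Ha : ex_series (fun n => Rabs (a n))).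
  { apply (ex_series_le (fun n => Rabs (a n)) b); [|exact Hb].
    intros n. unfold norm; simpl; unfold abs; simpl. rewrite Rabs_Rabsolu. apply H. }
  eapply Rle_trans; [apply Series_Rabs; exact Ha|].
  apply Series_le; [|exact Hb]. intros n. split; [apply Rabs_pos|apply H].
Qed.

Lemma l2_unit_ball x : l2 x -> Rbar_le (l2norm x) 1 -> forall l, Cmod (x l) <= 1.
Proof.
  intros [s Hs] Hn l. apply is_series_rsum in Hs.
  assert (L : is_lim_seq (fun K => sum_n (fun n => Cmod (x n) ^ 2) K) s).
  { apply is_lim_seq_ext with (fun K => rsum (S K) (fun n => Cmod (x n) ^ 2)).
    - intros n. symmetry. apply sum_n_rsum.
    - now apply is_lim_seq_incr_1 in Hs. }
  assert (P : forall i, 0 <= Cmod (x i) ^ 2) by (intros; apply pow2_ge_0).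
  assert (B : Cmod (x l) ^ 2 <= s).
  { apply Rle_trans with (rsum (S l) (fun n => Cmod (x n) ^ 2)).
    - apply (rsum_term_le (S l) (fun n => Cmod (x n) ^ 2)); [lia|auto].
    - apply (is_lim_seq_incr_compare (fun K => rsum K (fun n => Cmod (x n) ^ 2)) s Hs).
      intros n. simpl. generalize (P n). simpl. lra. }
  unfold l2norm in Hn. rewrite (is_lim_seq_unique _ _ L) in Hn. simpl in Hn.
  assert (s0 : 0 <= s) by (generalize (P l); lra).
  assert (s1 : s <= 1).
  { rewrite <- (sqrt_sqrt s s0). generalize (sqrt_pos s). nra. }
  assert (A := Cmod_ge_0 (x l)). nra.
Qed.

(** Entries of a vector in the unit ball are at most 1, so its image is dominated by the row sums,
    whose l2 norm is at most their l1 norm. The factor 2 arises because [matapp] sums real and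
    imaginary parts separately. *)
Lemma opnorm_le_l1 (A : nat -> nat -> C) B :
  (forall K L, rsum K (fun k => rsum L (fun l => Cmod (A k l))) <= B) ->
  Rbar_le (opnorm A) (2 * B).
Proof.
  intros HB.
  assert (B0 : 0 <= B) by exact (HB O O).
  assert (row : forall k, ex_series (fun l => Cmod (A k l))).
  { intros k. apply ex_series_bounded with B; [intros; apply Cmod_ge_0|]. intros L.
    apply Rle_trans with (2 := HB (S k) L).
    apply (rsum_term_le (S k) (fun k => rsum L (fun l => Cmod (A k l)))); [lia|].
    intros i _. apply rsum_pos. intros; apply Cmod_ge_0. }
  set (R_ := fun k => Series (fun l => Cmod (A k l))).
  assert (R_sum : forall K, rsum K R_ <= B).
  { intros K.
    apply (is_lim_seq_le (fun L => rsum K (fun k => rsum L (fun l => Cmod (A k l)))) (fun _ => B)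
      (rsum K R_) B); [intros; apply HB| |apply is_lim_seq_const].
    apply (is_lim_seq_rsum K (fun k L => rsum L (fun l => Cmod (A k l)))). intros k _.
    apply is_series_rsum, Series_correct, row. }
  unfold opnorm. apply (proj2 (Lub_Rbar_correct _)). intros t [x [Hx [Hx1 Ht]]].
  apply Rbar_le_trans with (1 := Ht). clear t Ht.
  assert (x1 := l2_unit_ball x Hx Hx1).
  assert (app : forall k, Cmod (matapp A x k) <= 2 * R_ k).
  { intros k. eapply Rle_trans; [apply Cmod_fst_snd|]. unfold matapp. simpl fst; simpl snd.
    assert (T : forall l, Cmod (A k l * x l) <= Cmod (A k l)).
    { intros l. rewrite Cmod_mult. rewrite <- (Rmult_1_r (Cmod (A k l))) at 2.
      apply Rmult_le_compat_l; [apply Cmod_ge_0|apply x1]. }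
    assert (Rabs (Series (fun l => fst (A k l * x l)%C)) <= R_ k).
    { apply Series_abs_le; [|apply row]. intros l. eapply Rle_trans; [apply fst_le_Cmod|apply T]. }
    assert (Rabs (Series (fun l => snd (A k l * x l)%C)) <= R_ k).
    { apply Series_abs_le; [|apply row]. intros l. eapply Rle_trans; [apply snd_le_Cmod|apply T]. }
    simpl in *. lra. }
  assert (L : Rbar_le (Lim_seq (fun K => sum_n (fun n => Cmod (matapp A x n) ^ 2) K)) ((2 * B) ^ 2)).
  { rewrite <- (Lim_seq_const ((2 * B) ^ 2)). apply Lim_seq_le_loc. exists O. intros n _. rewrite sum_n_rsum.
    eapply Rle_trans; [apply rsum_sqr_abs|]. apply pow_incr. split.
    - apply rsum_pos. intros; apply Rabs_pos.
    - apply Rle_trans with (rsum (S n) (fun k => 2 * R_ k)).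
      + apply rsum_le. intros k _. rewrite Rabs_pos_eq by apply Cmod_ge_0. apply app.
      + rewrite rsum_scal. generalize (R_sum (S n)). lra. }
  unfold l2norm. destruct (Lim_seq _) as [s| |]; simpl in L |- *; [|easy|easy].
  rewrite <- (sqrt_pow2 (2 * B)) by lra. apply sqrt_le_1_alt. simpl. lra.
Qed.

(** * A single branch *)

Lemma CV_radius_ge (a : nat -> R) x : ex_pseries a x -> Rbar_le (Rabs x) (CV_radius a).
Proof.
  intros H. apply Rbar_not_lt_le. intros L. apply (CV_disk_outside a x L).
  apply ex_pseries_R in H. now apply ex_series_lim_0.
Qed.

Lemma analytic_derivable f y : real_analytic_at f y -> ex_derive f y.
Proof.
  intros [c [eps [Heps H]]].
  assert (R0 : Rbar_le (eps / 2) (CV_radius c)).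
  { rewrite <- (Rabs_pos_eq (eps / 2)) by lra. apply CV_radius_ge.
    assert (X : is_pseries c (y + eps / 2 - y) (f (y + eps / 2))).
    { apply H. replace (y + eps / 2 - y) with (eps / 2) by ring. rewrite Rabs_pos_eq; lra. }
    replace (y + eps / 2 - y) with (eps / 2) in X by ring. now exists (f (y + eps / 2)). }
  assert (D : is_derive (PSeries c) (y - y) (PSeries (PS_derive c) (y - y))).
  { apply is_derive_PSeries. rewrite Rminus_diag, Rabs_R0.
    apply Rbar_lt_le_trans with (eps / 2); [simpl; lra|exact R0]. }
  apply ex_derive_ext_loc with (fun x => PSeries c (x - y)).
  - exists (mkposreal _ Heps). intros x Hx. apply is_pseries_unique, H, Hx.
  - exists (1 * PSeries (PS_derive c) (y - y)).
    apply (is_derive_comp (PSeries c) (fun x => x - y)); [exact D|]. auto_derive; [easy|ring].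
Qed.

Lemma cdiff_real f y l : cdiff f (RtoC y) l ->
  is_derive (fun x => fst (f (RtoC x))) y (fst l) /\ is_derive (fun x => snd (f (RtoC x))) y (snd l).
Proof.
  intros H.
  assert (E : forall eps, 0 < eps -> exists d, 0 < d /\ forall h, h <> 0 -> Rabs h < d ->
     Cmod ((f (RtoC (y + h)) - f (RtoC y)) / RtoC h - l) < eps).
  { intros eps Heps. destruct (H (eps / 2)) as [d [Hd Hf]]; [lra|].
    exists d. split; [exact Hd|]. intros h Hh Hhd.
    assert (Nh : RtoC h <> 0%C) by now apply RtoC_neq0.
    assert (Eh : (RtoC (y + h) - RtoC y)%C = RtoC h) by (rewrite RtoC_plus; ring).
    specialize (Hf (RtoC (y + h))). rewrite Eh, Cmod_R in Hf. specialize (Hf Hhd).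
    replace ((f (RtoC (y + h)) - f (RtoC y)) / RtoC h - l)%C
      with ((f (RtoC (y + h)) - f (RtoC y) - l * RtoC h) / RtoC h)%C by now field.
    rewrite Cmod_div, Cmod_R by exact Nh.
    assert (P : 0 < Rabs h) by now apply Rabs_pos_lt.
    apply Rle_lt_trans with (eps / 2); [|lra].
    apply Rmult_le_reg_r with (Rabs h); [exact P|]. unfold Rdiv at 1.
    rewrite Rmult_assoc, Rinv_l, Rmult_1_r by lra. exact Hf. }
  split; apply is_derive_Reals; intros eps Heps; destruct (E eps Heps) as [d [Hd F]];
    exists (mkposreal d Hd); intros h Hh Hhd; (eapply Rle_lt_trans; [|apply (F h Hh Hhd)]).
  - replace ((fst (f (RtoC (y + h))) - fst (f (RtoC y))) / h - fst l)
      with (fst ((f (RtoC (y + h)) - f (RtoC y)) / RtoC h - l)%C); [apply fst_le_Cmod|].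
    simpl. field. exact Hh.
  - replace ((snd (f (RtoC (y + h))) - snd (f (RtoC y))) / h - snd l)
      with (snd ((f (RtoC (y + h)) - f (RtoC y)) / RtoC h - l)%C); [apply snd_le_Cmod|].
    simpl. field. exact Hh.
Qed.

(* Stands in for the integral of T^j x^l over the branch, at whose endpoints T is unconstrained. *)
Definition branch_primitive (a b : R) (T : R -> R) (sg : R) (c : nat -> R) (j l : nat) (W : R -> R) : Prop :=
  continuous W 1 /\ continuous W (-1) /\
  (forall x, a < x < b -> is_derive (fun x => sg * W (T x)) x (T x ^ j * x ^ l)) /\
  is_series (fun k => sg * c k * moment (j + k)) ((W 1 - W (-1)) / 2).

Section Branch.

Variables (a b : R) (T : R -> R) (Phi Phi' : C -> C) (RR s K r : R) (t : nat -> nat -> C).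
Hypothesis s_lt : 1 < s < RR.
Hypothesis r_pos : 0 < r.
Hypothesis ab : -1 <= a /\ a <= b /\ b <= 1.
Hypothesis T_range : forall x, -1 <= x <= 1 -> -1 <= T x <= 1.
Hypothesis T_an : forall x, a < x < b -> real_analytic_at T x.
Hypothesis T_inv : forall x, a < x < b -> Phi (RtoC (T x)) = RtoC x.
Hypothesis T_full : forall y, in_closure (fun t => exists x, a < x < b /\ t = T x) y <-> -1 <= y <= 1.
Hypothesis Phi_diff : forall z, Cmod z < RR -> cdiff Phi z (Phi' z).
Hypothesis t_le : forall k l, Cmod (t k l) <= K * r ^ l / s ^ k.
Hypothesis t_lim : forall l z, Cmod z < s ->
  Clim (fun m => Csum m (fun k => t k l * z ^ k)%C) (Phi' z * Phi z ^ l)%C.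

Let th (y : R) : R := fst (Phi (RtoC y)).
Let th' (y : R) : R := fst (Phi' (RtoC y)).
Let sg : R := sgnR (fst (Phi' (RtoC 0))).

Let lt_ab : a < b.
Proof.
  destruct (proj2 (T_full 0) ltac:(lra) 1 Rlt_0_1) as [u [[x [Hx _]] _]]. lra.
Qed.

Let T_in x : a < x < b -> -1 <= T x <= 1.
Proof. intros Hx. apply T_range. lra. Qed.

Let th_derive y : -1 <= y <= 1 -> is_derive th y (th' y).
Proof.
  intros Hy. apply cdiff_real, Phi_diff. rewrite Cmod_R.
  apply Rle_lt_trans with 1; [apply Rabs_le; lra|lra].
Qed.

(** The chain rule for [th (T x) = x]; in particular neither derivative vanishes. *)
Let T_derive x : a < x < b -> exists l, is_derive T x l /\ th' (T x) * l = 1.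
Proof.
  intros Hx. destruct (analytic_derivable T x (T_an x Hx)) as [l Hl].
  exists l. split; [exact Hl|].
  assert (D : is_derive (fun x => th (T x)) x (l * th' (T x))).
  { apply (is_derive_comp th T); [|exact Hl]. apply th_derive, T_in, Hx. }
  assert (D' : is_derive (fun x => th (T x)) x 1).
  { apply is_derive_ext_loc with (fun x => x); [|apply (is_derive_id (K := R_AbsRing))].
    apply (locally_interval _ x a b); try (simpl; lra); simpl; intros y Hlo Hhi. unfold th. rewrite T_inv by lra. easy. }
  rewrite Rmult_comm. apply is_derive_unique in D. apply is_derive_unique in D'. congruence.
Qed.

Let T_cont x : a < x < b -> continuity_pt T x.
Proof.
  intros Hx. destruct (T_derive x Hx) as [l [Hl _]].
  apply continuity_pt_filterlim, (ex_derive_continuous T). now exists l.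
Qed.

(** An interior value 1 or -1 would be an extremum of [T] and force a zero derivative. *)
Let T_open x : a < x < b -> -1 < T x < 1.
Proof.
  intros Hx. destruct (T_derive x Hx) as [l [Hl El]]. assert (R0 := T_in x Hx).
  apply is_derive_Reals in Hl.
  set (pr := exist _ l Hl : derivable_pt T x).
  assert (l0 : l <> 0) by (intros F; rewrite F in El; lra).
  split; apply Rnot_le_lt; intros F; apply l0.
  - apply (deriv_minimum T a b x pr); [lra|lra|]. intros y Hy1 Hy2.
    generalize (T_in y (conj Hy1 Hy2)). lra.
  - apply (deriv_maximum T a b x pr); [lra|lra|]. intros y Hy1 Hy2.
    generalize (T_in y (conj Hy1 Hy2)). lra.
Qed.

(** The image is dense, so it has points above and below [y], and the intermediate value theorem
    applies between their preimages. The sign in front of [T x - y] depends on the order of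
    these. *)
Let T_surj y : -1 < y < 1 -> exists x, a < x < b /\ T x = y.
Proof.
  intros Hy.
  destruct (proj2 (T_full 1) ltac:(lra) (1 - y) ltac:(lra)) as [u1 [[x1 [Hx1 ->]] U1]].
  destruct (proj2 (T_full (-1)) ltac:(lra) (y + 1) ltac:(lra)) as [u2 [[x2 [Hx2 ->]] U2]].
  apply Rabs_def2 in U1. apply Rabs_def2 in U2.
  assert (C1 : forall c x, a < x < b -> continuity_pt (fun x => c * (T x - y)) x).
  { intros c x Hx. apply continuity_pt_mult; [now apply continuity_pt_const|].
    apply continuity_pt_minus; [now apply T_cont|now apply continuity_pt_const]. }
  destruct (Rtotal_order x1 x2) as [L|[L|L]].
  - destruct (IVT_interv (fun x => -1 * (T x - y)) x1 x2) as [z [Hz Ez]]; [|exact L|lra|lra|].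
    + intros x Hx. apply C1. lra.
    + exists z. split; [lra|]. lra.
  - subst x2. lra.
  - destruct (IVT_interv (fun x => 1 * (T x - y)) x2 x1) as [z [Hz Ez]]; [|exact L|lra|lra|].
    + intros x Hx. apply C1. lra.
    + exists z. split; [lra|]. lra.
Qed.

Let radius l c : (forall k, Rabs (c k) <= Cmod (t k l)) -> Rbar_le s (CV_radius c).
Proof.
  intros Hc. apply (proj1 (CV_radius_bounded c)). exists (K * r ^ l). intros n.
  assert (P : 0 < s ^ n) by (apply pow_lt; lra).
  rewrite Rabs_mult, (Rabs_pos_eq (s ^ n)) by lra.
  apply Rle_trans with (K * r ^ l / s ^ n * s ^ n).
  - apply Rmult_le_compat_r; [lra|]. eapply Rle_trans; [apply Hc|apply t_le].
  - apply Req_le. field. lra.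
Qed.

Let lim_parts l (y : R) : Rabs y < s ->
  is_pseries (fun k => fst (t k l)) y (fst (Phi' (RtoC y) * Phi (RtoC y) ^ l)%C) /\
  is_pseries (fun k => snd (t k l)) y (snd (Phi' (RtoC y) * Phi (RtoC y) ^ l)%C).
Proof.
  intros Hy. assert (L := t_lim l (RtoC y) ltac:(rewrite Cmod_R; exact Hy)).
  set (w := (Phi' (RtoC y) * Phi (RtoC y) ^ l)%C) in *.
  assert (tk : forall k, (t k l * RtoC y ^ k)%C = (fst (t k l) * y ^ k, snd (t k l) * y ^ k)).
  { intros k. rewrite <- RtoC_pow. apply injective_projections; simpl; ring. }
  split; apply is_pseries_R; apply is_series_rsum;
    apply is_lim_seq_spec; intros eps;
    destruct (proj1 (Clim_eps _ _) L eps (cond_pos eps)) as [m0 Hm0]; exists m0; intros m Hm;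
    specialize (Hm0 m Hm); (eapply Rle_lt_trans; [|exact Hm0]).
  - replace (rsum m (fun n => fst (t n l) * y ^ n) - fst w)
      with (fst (Csum m (fun k => t k l * RtoC y ^ k)%C - w)%C); [apply fst_le_Cmod|].
    simpl. rewrite Csum_fst. unfold Rminus. f_equal. apply rsum_ext. intros k _. now rewrite tk.
  - replace (rsum m (fun n => snd (t n l) * y ^ n) - snd w)
      with (snd (Csum m (fun k => t k l * RtoC y ^ k)%C - w)%C); [apply snd_le_Cmod|].
    simpl. rewrite Csum_snd. unfold Rminus. f_equal. apply rsum_ext. intros k _. now rewrite tk.
Qed.

(** [Phi] inverts [T] on the image of the branch, which contains [(-1, 1)]; its derivative along the
    real axis is then real too. *)
Let Phi_real y : -1 < y < 1 -> Phi (RtoC y) = RtoC (th y) /\ Phi' (RtoC y) = RtoC (th' y).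
Proof.
  intros Hy.
  assert (E : forall y, -1 < y < 1 -> snd (Phi (RtoC y)) = 0).
  { intros u Hu. destruct (T_surj u Hu) as [x [Hx <-]]. now rewrite T_inv. }
  split; apply injective_projections; try reflexivity; simpl; [now apply E|].
  assert (D : is_derive (fun x => snd (Phi (RtoC x))) y (snd (Phi' (RtoC y)))).
  { apply cdiff_real, Phi_diff. rewrite Cmod_R. apply Rlt_trans with 1; [apply Rabs_def1; lra|lra]. }
  assert (D0 : is_derive (fun x => snd (Phi (RtoC x))) y 0).
  { apply is_derive_ext_loc with (fun _ => 0); [|apply is_derive_Reals, derivable_pt_lim_const].
    apply (locally_interval _ y (-1) 1); try (simpl; lra); simpl; intros u Hlo Hhi. symmetry. apply E. lra. }
  apply is_derive_unique in D. apply is_derive_unique in D0. congruence.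
Qed.

Let prod_real y l : -1 < y < 1 -> (Phi' (RtoC y) * Phi (RtoC y) ^ l)%C = RtoC (th' y * th y ^ l).
Proof.
  intros Hy. destruct (Phi_real y Hy) as [-> ->]. now rewrite RtoC_mult, RtoC_pow.
Qed.

(** The imaginary parts are the coefficients of a power series that vanishes on [(-1, 1)]. *)
Lemma branch_coef_real k l : t k l = RtoC (fst (t k l)).
Proof.
  apply injective_projections; [reflexivity|]. simpl.
  replace 0 with ((fun _ : nat => 0) k) by reflexivity.
  apply (PSeries_ext_recip (fun k => snd (t k l)) (fun _ => 0)).
  - apply Rbar_lt_le_trans with s; [simpl; lra|]. apply (radius l). intros; apply snd_le_Cmod.
  - rewrite CV_radius_const_0. easy.
  - exists (mkposreal _ Rlt_0_1). intros y Hy.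
    assert (Y : Rabs (y - 0) < 1) by exact Hy. rewrite Rminus_0_r in Y.
    assert (Y' := Rabs_def2 _ _ Y).
    rewrite PSeries_const_0.
    apply is_pseries_unique. destruct (lim_parts l y ltac:(lra)) as [_ H].
    rewrite prod_real in H by lra. exact H.
Qed.

Let th'_PSeries y : Rabs y < s -> th' y = PSeries (fun k => fst (t k 0)) y.
Proof.
  intros Hy. symmetry. apply is_pseries_unique. destruct (lim_parts 0 y Hy) as [H _].
  simpl Cpow in H. rewrite Cmult_1_r in H. exact H.
Qed.

Let th'_cont y : -1 < y < 1 -> continuity_pt th' y.
Proof.
  intros Hy. apply continuity_pt_filterlim.
  apply (continuous_ext_loc _ (PSeries (fun k => fst (t k 0)))).
  - apply (locally_interval _ y (-1) 1); try (simpl; lra); simpl; intros u Hlo Hhi. symmetry. apply th'_PSeries.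
    apply Rabs_def1; lra.
  - apply (ex_derive_continuous (PSeries (fun k => fst (t k 0)))).
    eexists. apply is_derive_PSeries. apply Rbar_lt_le_trans with s.
    + simpl. apply Rlt_trans with 1; [apply Rabs_def1; lra|lra].
    + apply (radius 0). intros; apply fst_le_Cmod.
Qed.

Let th'_neq0 y : -1 < y < 1 -> th' y <> 0.
Proof.
  intros Hy F. destruct (T_surj y Hy) as [x [Hx <-]].
  destruct (T_derive x Hx) as [l [_ E]]. rewrite F in E. lra.
Qed.

Let sg_val : (sg = 1 \/ sg = -1) /\ 0 < sg * th' 0.
Proof.
  assert (N := th'_neq0 0 ltac:(lra)). unfold sg, sgnR. fold (th' 0).
  destruct (Rlt_dec 0 (th' 0)) as [L|L]; simpl; [split; [now left|lra]|].
  destruct (Rlt_dec (th' 0) 0) as [L'|L']; simpl; [split; [now right|lra]|]. exfalso. lra.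
Qed.

(** A sign change of the continuous [th'] would give it a zero, so the sign at 0, which defines
    [sg], prevails on the whole interval. *)
Let th'_sign y : -1 < y < 1 -> 0 < sg * th' y.
Proof.
  intros Hy. destruct sg_val as [V V0]. apply Rnot_le_lt. intros F.
  assert (F' : sg * th' y < 0).
  { assert (N := th'_neq0 y Hy). destruct V as [V|V]; rewrite V in *; lra. }
  assert (C0 : forall c x, -1 < x < 1 -> continuity_pt (fun x => c * th' x) x).
  { intros c x Hx. apply continuity_pt_mult; [now apply continuity_pt_const|now apply th'_cont]. }
  assert (Z : exists z, -1 < z < 1 /\ th' z = 0).
  { destruct (Rtotal_order 0 y) as [L|[L|L]].
    - destruct (IVT_interv (fun x => - sg * th' x) 0 y) as [z [Hz Ez]]; [|exact L|lra|lra|].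
      + intros x Hx. apply C0. lra.
      + exists z. split; [lra|]. destruct V as [V|V]; rewrite V in Ez; lra.
    - subst y. lra.
    - destruct (IVT_interv (fun x => sg * th' x) y 0) as [z [Hz Ez]]; [|exact L|lra|lra|].
      + intros x Hx. apply C0. lra.
      + exists z. split; [lra|]. destruct V as [V|V]; rewrite V in Ez; lra. }
  destruct Z as [z [Hz Ez]]. now apply (th'_neq0 z).
Qed.

(** The derivative of [sg * T] is positive, being the reciprocal of [sg * th']. The limits come from
    density of the image at [sg] and [- sg]. *)
Lemma branch_full : full_branch a b T sg.
Proof.
  destruct sg_val as [V V0].
  split; try lra; try assumption.
  - intros x y Hx Hxy Hy.
    destruct (MVT_gen (fun x => sg * T x) x y (fun x => sg * Derive T x)) as [c [Hc E]];
      rewrite ?Rmin_left, ?Rmax_right in * by lra.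
    + intros z Hz. destruct (T_derive z ltac:(lra)) as [l [Hl _]].
      rewrite (is_derive_unique _ _ _ Hl). now apply is_derive_scal.
    + intros z Hz. apply continuity_pt_mult; [now apply continuity_pt_const|apply T_cont; lra].
    + destruct (T_derive c ltac:(lra)) as [l [Hl El]]. rewrite (is_derive_unique _ _ _ Hl) in E.
      assert (P := th'_sign (T c) (T_open c ltac:(lra))).
      assert (Q : 0 < sg * l).
      { assert (sg * th' (T c) * (sg * l) = 1).
        { transitivity (sg * sg * (th' (T c) * l)); [ring|]. rewrite El.
          destruct V as [V|V]; rewrite V; ring. }
        nra. }
      assert (0 <= sg * l * (y - x)) by (apply Rmult_le_pos; lra). lra.
  - intros eps Heps. destruct (proj2 (T_full (- sg))) with (eps := eps) as [u [[x [Hx ->]] U]].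
    + destruct V as [V|V]; rewrite V; lra.
    + exact Heps.
    + exists x. split; [exact Hx|]. apply Rabs_def2 in U. destruct V as [V|V]; rewrite V in *; lra.
  - intros eps Heps. destruct (proj2 (T_full sg)) with (eps := eps) as [u [[x [Hx ->]] U]].
    + destruct V as [V|V]; rewrite V; lra.
    + exact Heps.
    + exists x. split; [exact Hx|]. apply Rabs_def2 in U. destruct V as [V|V]; rewrite V in *; lra.
Qed.

Lemma branch_primitive_exists j l : exists W : R -> R,
  branch_primitive a b T sg (fun k => fst (t k l)) j l W.
Proof.
  set (c := fun k => sg * fst (t k l)).
  (* The series of a primitive of [y ^ j * (sg * th' y * th y ^ l)], the integrand after the
     substitution [y = T x], with [sg * th'] as Jacobian. *)
  set (w := PS_Int (PS_incr_n c j)).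
  assert (V := proj1 sg_val).
  assert (sg_abs : Rabs sg = 1) by (destruct V as [->| ->]; [apply Rabs_R1|rewrite Rabs_left; lra]).
  assert (c_le : forall k, Rabs (c k) <= Cmod (t k l)).
  { intros k. unfold c. rewrite Rabs_mult, sg_abs, Rmult_1_l. apply fst_le_Cmod. }
  assert (Rc := radius l c c_le).
  assert (Ri : CV_radius (PS_incr_n c j) = CV_radius c).
  { clear. induction j as [|j IH]; simpl; [reflexivity|]. rewrite <- IH. apply CV_radius_incr_1. }
  assert (Rw : Rbar_le s (CV_radius w)) by (unfold w; rewrite CV_radius_Int, Ri; exact Rc).
  assert (in_disc : forall y, -1 <= y <= 1 -> Rbar_lt (Rabs y) s).
  { intros y Hy. simpl. apply Rle_lt_trans with 1; [apply Rabs_le; lra|lra]. }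
  assert (dW : forall y, -1 <= y <= 1 -> is_derive (PSeries w) y (y ^ j * PSeries c y)).
  { intros y Hy. rewrite <- PSeries_incr_n, (PSeries_ext (PS_incr_n c j) (PS_derive w)).
    - apply is_derive_PSeries. apply Rbar_lt_le_trans with s; [now apply in_disc|exact Rw].
    - intros n. assert (E : forall e k : R, k <> 0 -> e = k * (e / k)) by (intros; now field).
      apply E, not_0_INR. lia. }
  exists (PSeries w). split; [|split; [|split]].
  - apply (ex_derive_continuous (PSeries w)). eexists; apply dW; lra.
  - apply (ex_derive_continuous (PSeries w)). eexists; apply dW; lra.
  - intros x Hx. destruct (T_derive x Hx) as [u [Hu Eu]].
    assert (O := T_open x Hx).
    replace (T x ^ j * x ^ l) with (sg * (u * (T x ^ j * PSeries c (T x)))).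
    + apply (is_derive_scal (fun x => PSeries w (T x))).
      apply (is_derive_comp (PSeries w) T); [apply dW; lra|exact Hu].
    + assert (Ec : PSeries c (T x) = sg * (th' (T x) * x ^ l)).
      { unfold c. rewrite (PSeries_scal sg (fun k => fst (t k l))). f_equal.
        apply is_pseries_unique. destruct (lim_parts l (T x)) as [H _].
        - apply Rlt_trans with 1; [apply Rabs_def1; lra|lra].
        - rewrite (prod_real _ _ O) in H. unfold th in H. rewrite T_inv in H by exact Hx. exact H. }
      rewrite Ec. transitivity (sg * sg * (th' (T x) * u) * (T x ^ j * x ^ l)); [ring|].
      rewrite Eu. destruct V as [->| ->]; ring.
  (* The first [j + 1] coefficients of the primitive vanish. Half the difference of the remaining
     terms at 1 and -1 is [c k * moment (j + k)]. *)
  - assert (Sy : forall y, -1 <= y <= 1 ->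
      is_series (fun k => c k * y ^ S (j + k) / INR (S (j + k))) (PSeries w y)).
    { intros y Hy.
      assert (X : is_pseries w y (PSeries w y)).
      { apply PSeries_correct, CV_disk_correct, CV_disk_inside.
        apply Rbar_lt_le_trans with s; [now apply in_disc|exact Rw]. }
      apply is_pseries_R, is_series_rsum in X. apply is_series_rsum.
      apply (is_lim_seq_incr_n _ (S j)) in X.
      apply is_lim_seq_ext with (2 := X). intros n.
      rewrite Nat.add_comm, rsum_split, (rsum_ext (S j) _ (fun _ => 0)), rsum_const.
      - rewrite Rmult_0_r, Rplus_0_l. apply rsum_ext. intros k _.
        change (S j + k)%nat with (S (j + k)). unfold w.
        change (PS_Int (PS_incr_n c j) (S (j + k))) with (PS_incr_n c j (j + k)%nat / INR (S (j + k))).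
        rewrite PS_incr_n_simplify.
        destruct (le_lt_dec j (j + k)); [|lia]. replace (j + k - j)%nat with k by lia.
        unfold Rdiv. ring.
      - intros i Hi. unfold w. destruct i as [|i]; simpl PS_Int; [ring|].
        rewrite PS_incr_n_simplify. destruct (le_lt_dec j i); [lia|]. unfold zero; simpl. unfold Rdiv; ring. }
    assert (S1 := Sy 1 ltac:(lra)). assert (S2 := Sy (-1) ltac:(lra)).
    assert (D := is_series_scal (/ 2) _ _ (is_series_minus _ _ _ _ S1 S2)).
    replace ((PSeries w 1 - PSeries w (-1)) / 2) with (scal (/ 2) (minus (PSeries w 1) (PSeries w (-1)))).
    + apply is_series_ext with (2 := D). intros k. unfold moment, c.
      rewrite pow1. unfold scal, minus, plus, opp; simpl; unfold mult; simpl.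
      change (match (j + k)%nat with O => 1 | S _ => INR (j + k) + 1 end) with (INR (S (j + k))).
      field. apply not_0_INR. lia.
    + unfold scal, minus, plus, opp; simpl; unfold mult; simpl. field.
Qed.

End Branch.

(** * The discrete Gram matrix *)

Definition node_moment (M : nat) (delta : R) (n : nat) : R :=
  / INR M * rsum M (fun m => node M delta m ^ n).

Lemma quad_form_nodes N M delta y :
  rsum N (fun j => rsum N (fun k => y j * y k * node_moment M delta (j + k)))
  = / INR M * rsum M (fun m => rsum N (fun k => y k * node M delta m ^ k) ^ 2).
Proof.
  transitivity (/ INR M * rsum M (fun m => rsum N (fun j => rsum N (fun k =>
     y j * node M delta m ^ j * (y k * node M delta m ^ k))))).
  - rewrite (rsum_swap M N), <- (rsum_scal N). apply rsum_ext. intros j _.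
    rewrite (rsum_swap M N), <- (rsum_scal N). apply rsum_ext. intros k _.
    unfold node_moment. rewrite <- Rmult_assoc, (Rmult_comm _ (/ INR M)), Rmult_assoc, <- rsum_scal.
    f_equal. apply rsum_ext. intros m _. rewrite pow_add. ring.
  - f_equal. apply rsum_ext. intros m _. rewrite rsum_rsum_mult. simpl. ring.
Qed.

Section Gram.

Variables (N M : nat) (delta : R).
Hypothesis M_pos : (0 < M)%nat.
Hypothesis delta_in : 0 <= delta <= 2 / INR M.
Hypothesis M_large : 28 * INR N * gamma ^ N <= INR M.

Let M0 : 0 < INR M.
Proof. now apply lt_0_INR. Qed.

Let gN : 0 < gamma ^ N.
Proof. apply pow_lt. generalize gamma_ge_5; lra. Qed.

Let form (y : nat -> R) := rsum N (fun j => rsum N (fun k => y j * y k * node_moment M delta (j + k))).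

(** Every entry of the discrete Gram matrix is within [14 / M] of its limit, so the form moves by at
    most [14 N / M] times the squared norm. The 28 in the hypothesis on [M] makes this half of the
    bound in [moment_lower]. *)
Lemma gram_lower y : rsum N (fun k => y k ^ 2) <= 2 * gamma ^ N * form y.
Proof.
  assert (L := moment_lower N y). set (Y := rsum N (fun k => y k ^ 2)) in *.
  assert (Y0 : 0 <= Y) by (apply rsum_pos; intros; apply pow2_ge_0).
  set (Q := rsum N (fun j => rsum N (fun k => y j * y k * moment (j + k)))) in *.
  assert (D : Q - form y <= 14 / INR M * (INR N * Y)).
  { unfold Q, form. rewrite <- rsum_minus. eapply Rle_trans; [apply Rle_abs|].
    eapply Rle_trans; [apply rsum_abs|].
    apply Rle_trans with (rsum N (fun j => rsum N (fun k => Rabs (y j) * (14 / INR M * Rabs (y k))))).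
    - apply rsum_le. intros j _. rewrite <- rsum_minus. eapply Rle_trans; [apply rsum_abs|].
      apply rsum_le. intros k _. rewrite <- Rmult_minus_distr_l, Rabs_mult, Rabs_mult.
      replace (Rabs (y j) * (14 / INR M * Rabs (y k))) with (Rabs (y j) * Rabs (y k) * (14 / INR M)) by ring.
      apply Rmult_le_compat_l; [apply Rmult_le_pos; apply Rabs_pos|].
      rewrite Rabs_minus_sym. now apply moment_quadrature.
    - rewrite rsum_rsum_mult, rsum_scal.
      assert (CS := rsum_CS N (fun _ => 1) (fun k => Rabs (y k))). cbv beta in CS.
      rewrite (rsum_ext N (fun i => Rabs (y i) ^ 2) (fun k => y k ^ 2)) in CS by (intros; apply pow2_abs).
      rewrite (rsum_ext N (fun i => 1 ^ 2) (fun _ => 1)), rsum_const, Rmult_1_r in CS by (intros; ring).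
      rewrite (rsum_ext N (fun i => 1 * Rabs (y i)) (fun k => Rabs (y k))) in CS by (intros; ring).
      fold Y in CS. set (l1 := rsum N (fun k => Rabs (y k))) in *.
      replace (l1 * (14 / INR M * l1)) with (14 / INR M * l1 ^ 2) by ring.
      apply Rmult_le_compat_l; [apply Rdiv_le_0_compat; lra|exact CS]. }
  assert (E : gamma ^ N * (14 / INR M * (INR N * Y)) <= Y / 2).
  { replace (gamma ^ N * (14 / INR M * (INR N * Y))) with (28 * INR N * gamma ^ N * (Y / (2 * INR M))) by (field; lra).
    replace (Y / 2) with (INR M * (Y / (2 * INR M))) by (field; lra).
    apply Rmult_le_compat_r; [apply Rdiv_le_0_compat; lra|exact M_large]. }
  assert (gamma ^ N * (Q - form y) <= gamma ^ N * (14 / INR M * (INR N * Y)))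
    by (apply Rmult_le_compat_l; lra).
  lra.
Qed.

(** Testing the system with [y] gives [X ^ 2 <= Y * (sqrt N * e) + X * B], where [X] is the discrete
    L2 norm of the polynomial with coefficients [y], and [Y] the l2 norm of [y]. By [Y <= La * X]
    one factor [X] cancels. The data [g] meets only the energy norm and pays [La] once, on the way
    back from [X] to [Y]; [E] pays it twice. *)
Lemma gram_solve (y E : nat -> R) (g : R -> R) (e B : R) : 0 <= e -> 0 <= B ->
  (forall j, (j < N)%nat -> rsum N (fun k => node_moment M delta (j + k) * y k)
     = E j + / INR M * rsum M (fun m => node M delta m ^ j * g (node M delta m))) ->
  (forall j, (j < N)%nat -> Rabs (E j) <= e) ->
  (forall m, (m < M)%nat -> Rabs (g (node M delta m)) <= B) ->
  forall k, (k < N)%nat ->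
    Rabs (y k) <= 2 * gamma ^ N * (sqrt (INR N) * e) + sqrt (2 * gamma ^ N) * B.
Proof.
  intros He HB Hy HE Hg k Hk.
  set (Y := sqrt (rsum N (fun k => y k ^ 2))).
  assert (P : 0 <= rsum N (fun k => y k ^ 2)) by (apply rsum_pos; intros; apply pow2_ge_0).
  assert (Y0 : 0 <= Y) by apply sqrt_pos.
  assert (YY : Y ^ 2 = rsum N (fun k => y k ^ 2)) by (unfold Y; now apply pow2_sqrt).
  set (p := fun m => rsum N (fun k => y k * node M delta m ^ k)).
  assert (F : form y = / INR M * rsum M (fun m => p m ^ 2)) by apply quad_form_nodes.
  assert (F0 : 0 <= form y).
  { rewrite F. apply Rmult_le_pos; [left; now apply Rinv_0_lt_compat|].
    apply rsum_pos; intros; apply pow2_ge_0. }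
  set (X := sqrt (form y)). assert (X0 : 0 <= X) by apply sqrt_pos.
  assert (XX : X ^ 2 = form y) by (unfold X; now apply pow2_sqrt).
  set (La := sqrt (2 * gamma ^ N)). assert (La0 : 0 <= La) by apply sqrt_pos.
  assert (LaLa : La ^ 2 = 2 * gamma ^ N) by (unfold La; apply pow2_sqrt; lra).
  assert (sN : sqrt (INR N) ^ 2 = INR N) by (apply pow2_sqrt, pos_INR).
  assert (sN0 := sqrt_pos (INR N)).
  assert (sqr_le : forall u v, 0 <= v -> u ^ 2 <= v ^ 2 -> u <= v).
  { intros u v Hv H. apply Rsqr_incr_0_var; [|exact Hv]. unfold Rsqr. lra. }
  assert (YX : Y <= La * X).
  { apply sqr_le; [now apply Rmult_le_pos|].
    rewrite Rpow_mult_distr, YY, LaLa, XX. apply gram_lower. }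
  assert (eq1 : form y = rsum N (fun j => y j * E j)
      + / INR M * rsum M (fun m => p m * g (node M delta m))).
  { unfold form. transitivity (rsum N (fun j => y j * (E j
       + / INR M * rsum M (fun m => node M delta m ^ j * g (node M delta m))))).
    - apply rsum_ext. intros j Hj. rewrite <- (Hy j Hj), <- rsum_scal. apply rsum_ext. intros; ring.
    - rewrite (rsum_ext N _ (fun j => y j * E j + / INR M * rsum M (fun m => y j * node M delta m ^ j * g (node M delta m)))).
      + rewrite rsum_plus, rsum_scal, rsum_swap. f_equal. f_equal. apply rsum_ext. intros m _.
        unfold p. rewrite (Rmult_comm (rsum N _)), <- rsum_scal. apply rsum_ext. intros; ring.
      + intros j _. rewrite Rmult_plus_distr_l. f_equal.
        rewrite <- Rmult_assoc, (Rmult_comm (y j)), Rmult_assoc, <- rsum_scal. f_equal.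
        apply rsum_ext. intros; ring. }
  assert (b1 : rsum N (fun j => y j * E j) <= Y * (sqrt (INR N) * e)).
  { apply sqr_le; [repeat apply Rmult_le_pos; assumption|].
    eapply Rle_trans; [apply rsum_CS|]. rewrite <- YY, !Rpow_mult_distr, sN.
    apply Rmult_le_compat_l; [apply pow2_ge_0|]. rewrite <- rsum_const. apply rsum_le. intros j Hj.
    rewrite <- (pow2_abs (E j)). apply pow_incr. split; [apply Rabs_pos|now apply HE]. }
  assert (b2 : / INR M * rsum M (fun m => p m * g (node M delta m)) <= X * B).
  { apply sqr_le; [now apply Rmult_le_pos|].
    assert (CS := rsum_CS M p (fun m => g (node M delta m))). cbv beta in CS.
    assert (G : rsum M (fun m => g (node M delta m) ^ 2) <= INR M * B ^ 2).
    { rewrite <- rsum_const. apply rsum_le. intros m Hm. rewrite <- (pow2_abs (g _)).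
      apply pow_incr. split; [apply Rabs_pos|now apply Hg]. }
    rewrite !Rpow_mult_distr, XX, F.
    apply Rle_trans with ((/ INR M) ^ 2 * (rsum M (fun m => p m ^ 2) * (INR M * B ^ 2))).
    - apply Rmult_le_compat_l; [apply pow2_ge_0|]. apply Rle_trans with (1 := CS).
      apply Rmult_le_compat_l; [apply rsum_pos; intros; apply pow2_ge_0|exact G].
    - apply Req_le. field. lra. }
  assert (X1 : X <= La * (sqrt (INR N) * e) + B).
  { assert (0 <= sqrt (INR N) * e) by now apply Rmult_le_pos.
    destruct (Req_dec X 0) as [->|NX].
    - assert (0 <= La * (sqrt (INR N) * e)) by now apply Rmult_le_pos. lra.
    - apply Rmult_le_reg_l with X; [lra|].
      assert (Y * (sqrt (INR N) * e) <= La * X * (sqrt (INR N) * e)) by now apply Rmult_le_compat_r.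
      replace (X * X) with (form y) by (rewrite <- XX; ring). lra. }
  assert (yk : Rabs (y k) <= Y).
  { apply sqr_le; [exact Y0|]. rewrite YY, pow2_abs.
    apply (rsum_term_le N (fun k => y k ^ 2)); [exact Hk|intros; apply pow2_ge_0]. }
  apply Rle_trans with (La * X); [lra|].
  apply Rle_trans with (La * (La * (sqrt (INR N) * e) + B)); [now apply Rmult_le_compat_l|].
  apply Req_le. rewrite <- LaLa. unfold La. ring.
Qed.

End Gram.

Module MatrixBridge.
Import ssreflect ssrfun ssrbool eqtype ssrnat seq fintype bigop ssralg matrix mxalgebra Rstruct.
Import GRing.Theory.

Lemma sum_rsum n (F : nat -> R) : (\sum_(i < n) F i)%R = rsum n F.
Proof. by elim: n => [|n IH]; rewrite ?big_ord0 // big_ord_recr /= IH. Qed.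

Lemma Hhat_entry N M delta (i j : 'I_N) : Hhat N M delta i j = node_moment M delta (Nat.add i j).
Proof.
rewrite mxE /node_moment (sum_rsum M (fun m => Rmult (pow (node M delta m) i) (pow (node M delta m) j))).
by congr Rmult; apply: rsum_ext => m _; rewrite pow_add.
Qed.

Lemma Ghat_entry T N M delta (i j : 'I_N) : Ghat T N M delta i j
  = Rmult (/ INR M) (rsum M (fun m => Rmult (pow (T (node M delta m)) i) (pow (node M delta m) j))).
Proof.
by rewrite mxE (sum_rsum M (fun m => Rmult (pow (T (node M delta m)) i) (pow (node M delta m) j))).
Qed.

(** Translates matrices into functions on natural numbers that solve a linear system. Definiteness
    of the discrete form excludes kernel vectors of [Hhat], so [invmx] is its true inverse. *)
Lemma approx_mat_spec T (N M : nat) delta rho :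
  (forall y, rsum N (fun j => rsum N (fun k => Rmult (Rmult (y j) (y k)) (node_moment M delta (Nat.add j k)))) = R0 ->
     forall k, lt k N -> y k = R0) ->
  exists y : nat -> nat -> R,
    (forall k l, lt k N -> lt l N ->
       approx_mat T N M delta rho k l = RtoC (Rmult (Rmult (pow rho k) (y k l)) (/ pow rho l))) /\
    (forall k l, ~ (lt k N /\ lt l N) -> approx_mat T N M delta rho k l = RtoC R0) /\
    (forall j l, lt j N -> lt l N ->
       rsum N (fun k => Rmult (node_moment M delta (Nat.add j k)) (y k l))
       = Rmult (/ INR M) (rsum M (fun m => Rmult (pow (T (node M delta m)) j) (pow (node M delta m) l)))).
Proof.
move=> Hpos.
have unit : Hhat N M delta \in unitmx.
  rewrite unitmxE unitfE; apply/negP => /det0P [v v0 vA].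
  (* A kernel vector extended by zero, to which the hypothesis on functions applies. *)
  pose y (k : nat) := if insub k is Some i then v ord0 i else R0.
  have yE (i : 'I_N) : y i = v ord0 i by rewrite /y valK.
  have y0 : forall k, lt k N -> y k = R0.
    apply: Hpos; rewrite rsum_swap.
    rewrite (rsum_ext _ _ (fun _ => R0)) ?rsum_const ?Rmult_0_r // => k /ltP kN.
    have /matrixP /(_ ord0 (Ordinal kN)) := vA; rewrite !mxE => E.
    have -> : rsum N (fun i => Rmult (Rmult (y i) (y k)) (node_moment M delta (Nat.add i k)))
        = (y k * \sum_j v ord0 j * Hhat N M delta j (Ordinal kN))%R.
      rewrite -sum_rsum big_distrr /=; apply: eq_bigr => j _.
      rewrite Hhat_entry yE /=.
      change (Rmult (Rmult (v ord0 j) (y k)) (node_moment M delta (Nat.add j k))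
        = Rmult (y k) (Rmult (v ord0 j) (node_moment M delta (Nat.add j k)))); ring.
    by rewrite E mulr0.
  case/negP: v0; apply/eqP/rowP => i; rewrite mxE -yE; exact/y0/ltP.
pose Y := (invmx (Hhat N M delta) *m Ghat T N M delta)%R.
pose y (k l : nat) := match insub k, insub l with Some i, Some j => Y i j | _, _ => R0 end.
have yE (i j : 'I_N) : y i j = Y i j by rewrite /y !valK.
exists y; split; [|split].
- move=> k l /ltP kN /ltP lN; rewrite /approx_mat /y.
  by rewrite !insubT.
- move=> k l kl; rewrite /approx_mat; case: insubP => [i ik _|//].
  by case: insubP => [j jl _|//]; case: kl; split; apply/ltP.
- move=> j l /ltP jN /ltP lN.
  have := congr1 (fun A : 'M_N => A (Ordinal jN) (Ordinal lN)) (mulKVmx unit (Ghat T N M delta)).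
  rewrite -/Y mxE Ghat_entry /= => <-.
  rewrite -sum_rsum; apply: eq_bigr => k _.
  by rewrite Hhat_entry -(yE k (Ordinal lN)).
Qed.

End MatrixBridge.

(** * Proof of the theorem *)

Lemma Csum_RtoC n a : Csum n (fun k => RtoC (a k)) = RtoC (rsum n a).
Proof. apply injective_projections; [apply Csum_fst|]. rewrite Csum_snd, (rsum_ext n _ (fun _ => 0)), rsum_const by easy. simpl. ring. Qed.

Lemma Series_tail (a : nat -> R) A q N : 0 <= q < 1 -> (forall k, Rabs (a k) <= A * q ^ k) ->
  ex_series a /\ Rabs (Series a - rsum N a) <= A / (1 - q) * q ^ N.
Proof.
  intros Hq Ha.
  assert (ex : ex_series a).
  { assert (A0 : 0 <= A) by (generalize (Rle_trans _ _ _ (Rabs_pos _) (Ha O)); simpl; lra).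
    apply ex_series_Rabs, (ex_series_bounded _ (A * / (1 - q))); [intros; apply Rabs_pos|].
    intros n. apply Rle_trans with (rsum n (fun k => A * q ^ k)); [now apply rsum_le|].
    rewrite rsum_scal. apply Rmult_le_compat_l; [exact A0|now apply rsum_geom_lt1]. }
  split; [exact ex|].
  replace (Rabs (Series a - rsum N a)) with (Cmod (RtoC (Series a) - Csum N (fun k => RtoC (a k)))).
  - apply Clim_tail; [exact Hq|intros j; rewrite Cmod_R; apply Ha|].
    assert (L := proj1 (is_series_rsum a (Series a)) (Series_correct a ex)).
    apply Clim_eps. intros eps Heps.
    destruct (proj2 (is_lim_seq_spec _ _) L (mkposreal eps Heps)) as [m0 Hm0].
    exists m0. intros m Hm. rewrite Csum_RtoC, <- RtoC_minus, Cmod_R. now apply Hm0.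
  - now rewrite Csum_RtoC, <- RtoC_minus, Cmod_R.
Qed.

Lemma is_series_finsum n (a : nat -> nat -> R) (s : nat -> R) :
  (forall i, (i < n)%nat -> is_series (a i) (s i)) ->
  is_series (fun k => rsum n (fun i => a i k)) (rsum n s).
Proof.
  intros H. apply is_series_rsum.
  apply is_lim_seq_ext with (fun m => rsum n (fun i => rsum m (a i))).
  - intros m. apply rsum_swap.
  - apply (is_lim_seq_rsum n (fun i m => rsum m (a i))). intros i Hi. now apply is_series_rsum, H.
Qed.

Lemma is_series_mult_l (c s : R) (a : nat -> R) : is_series a s -> is_series (fun k => c * a k) (c * s).
Proof. exact (is_series_scal (K := R_AbsRing) (V := R_NormedModule) c a s). Qed.

Lemma is_series_abs_le (a b : nat -> R) s B : is_series a s -> (forall k, Rabs (a k) <= b k) ->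
  (forall n, rsum n b <= B) -> Rabs s <= B.
Proof.
  intros Ha Hb HB. apply is_series_rsum, is_lim_seq_abs in Ha.
  apply (is_lim_seq_le (fun n => Rabs (rsum n a)) (fun _ => B) (Rabs s) B) with (2 := Ha) (3 := is_lim_seq_const B).
  intros n. eapply Rle_trans; [apply rsum_abs|]. eapply Rle_trans; [|apply (HB n)].
  apply rsum_le. auto.
Qed.

Lemma rsum_below n N f : (forall k, 0 <= f k) ->
  rsum n (fun k => if lt_dec k N then f k else 0) <= rsum N f.
Proof.
  intros Hf. destruct (le_lt_dec n N) as [L|L].
  - apply Rle_trans with (rsum n f); [|now apply rsum_mono].
    apply rsum_le. intros k Hk. destruct (lt_dec k N); [apply Rle_refl|lia].
  - replace n with (N + (n - N))%nat by lia. rewrite rsum_split.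
    rewrite (rsum_ext (n - N) _ (fun _ => 0)), rsum_const.
    + rewrite Rmult_0_r, Rplus_0_r. apply rsum_le. intros k Hk.
      destruct (lt_dec k N); [apply Rle_refl|lia].
    + intros k Hk. destruct (lt_dec (N + k) N); [lia|easy].
Qed.

Lemma rsum_geom_above n N q : 0 <= q < 1 ->
  rsum n (fun k => if lt_dec k N then 0 else q ^ k) <= q ^ N / (1 - q).
Proof.
  intros Hq. assert (P : 0 <= q ^ N) by (apply pow_le; lra).
  destruct (le_lt_dec n N) as [L|L].
  - rewrite (rsum_ext n _ (fun _ => 0)), rsum_const.
    + rewrite Rmult_0_r. apply Rdiv_le_0_compat; lra.
    + intros k Hk. destruct (lt_dec k N); [easy|lia].
  - replace n with (N + (n - N))%nat by lia. rewrite rsum_split.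
    rewrite (rsum_ext N _ (fun _ => 0)), rsum_const.
    + rewrite Rmult_0_r, Rplus_0_l, (rsum_ext _ _ (fun k => q ^ N * q ^ k)), rsum_scal.
      * apply Rmult_le_compat_l; [exact P|now apply rsum_geom_lt1].
      * intros k Hk. destruct (lt_dec (N + k) N); [lia|]. apply pow_add.
    + intros k Hk. destruct (lt_dec k N); [easy|lia].
Qed.

(** The complement of the block is covered by the rows [k >= N] and the columns [l >= N], each with
    one geometric tail. All three majorants are products, so the double sums factor. *)
Lemma l1_blocks (A : nat -> nat -> C) N rho om p Z K : 1 < rho -> 0 <= om < 1 -> 0 <= p < 1 ->
  0 <= Z -> 0 <= K ->
  (forall k l, (k < N)%nat -> (l < N)%nat -> Cmod (A k l) <= Z * rho ^ k * om ^ l) ->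
  (forall k l, ~ ((k < N)%nat /\ (l < N)%nat) -> Cmod (A k l) <= K * p ^ k * om ^ l) ->
  forall m n, rsum m (fun k => rsum n (fun l => Cmod (A k l)))
    <= (Z * rho ^ N / (rho - 1) + K * p ^ N / (1 - p) + K * om ^ N / (1 - p)) / (1 - om).
Proof.
  intros Hrho Hom Hp HZ HK Hin Hout m n.
  set (al := fun k => if lt_dec k N then rho ^ k else 0).
  set (be := fun k => if lt_dec k N then 0 else p ^ k).
  set (de := fun l => if lt_dec l N then 0 else om ^ l).
  assert (P : forall q k, 0 <= q -> 0 <= q ^ k) by (intros; now apply pow_le).
  assert (Sal : rsum m al <= rho ^ N / (rho - 1)).
  { eapply Rle_trans; [apply (rsum_below m N (fun k => rho ^ k)); intros; apply P; lra|].
    now apply rsum_geom_gt1. }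
  assert (Sbe : rsum m be <= p ^ N / (1 - p)) by now apply rsum_geom_above.
  assert (Sde : rsum n de <= om ^ N / (1 - om)) by now apply rsum_geom_above.
  assert (Som : rsum n (fun l => om ^ l) <= / (1 - om)) by now apply rsum_geom_lt1.
  assert (Sp : rsum m (fun k => p ^ k) <= / (1 - p)) by now apply rsum_geom_lt1.
  assert (al0 : 0 <= rsum m al).
  { apply rsum_pos. intros k _. unfold al. destruct (lt_dec k N); [apply P; lra|apply Rle_refl]. }
  assert (be0 : 0 <= rsum m be).
  { apply rsum_pos. intros k _. unfold be. destruct (lt_dec k N); [apply Rle_refl|apply P; lra]. }
  assert (de0 : 0 <= rsum n de).
  { apply rsum_pos. intros k _. unfold de. destruct (lt_dec k N); [apply Rle_refl|apply P; lra]. }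
  assert (om0 : 0 <= rsum n (fun l => om ^ l)) by (apply rsum_pos; intros; apply P; lra).
  assert (p0 : 0 <= rsum m (fun l => p ^ l)) by (apply rsum_pos; intros; apply P; lra).
  apply Rle_trans with (Z * (rsum m al * rsum n (fun l => om ^ l)) + K * (rsum m be * rsum n (fun l => om ^ l))
     + K * (rsum m (fun k => p ^ k) * rsum n de)).
  - rewrite <- !rsum_rsum_mult, <- !rsum_scal, <- !rsum_plus. apply rsum_le. intros k _.
    rewrite <- !rsum_scal, <- !rsum_plus. apply rsum_le. intros l _.
    assert (Pp := P p k (proj1 Hp)). assert (Po := P om l (proj1 Hom)).
    assert (Q : 0 <= K * (p ^ k * om ^ l)) by (apply Rmult_le_pos; [exact HK|now apply Rmult_le_pos]).
    unfold al, be, de. destruct (lt_dec k N) as [Hk|Hk]; destruct (lt_dec l N) as [Hl|Hl]; simpl.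
    + generalize (Hin k l Hk Hl). lra.
    + assert (H := Hout k l ltac:(lia)).
      assert (0 <= Z * (rho ^ k * om ^ l)).
      { apply Rmult_le_pos; [exact HZ|apply Rmult_le_pos; [apply P; lra|exact Po]]. }
      lra.
    + generalize (Hout k l ltac:(lia)). lra.
    + generalize (Hout k l ltac:(lia)). lra.
  - replace ((Z * rho ^ N / (rho - 1) + K * p ^ N / (1 - p) + K * om ^ N / (1 - p)) / (1 - om))
      with (Z * (rho ^ N / (rho - 1) * / (1 - om)) + K * (p ^ N / (1 - p) * / (1 - om))
            + K * (/ (1 - p) * (om ^ N / (1 - om)))) by (field; lra).
    repeat apply Rplus_le_compat; (apply Rmult_le_compat_l; [assumption|]); apply Rmult_le_compat; assumption.
Qed.

(* Both sums approximate the same integral. *)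
Lemma duality_error d (a b : nat -> R) T (Phi' : nat -> C -> C) (t : nat -> nat -> nat -> C)
  (K r s : R) :
  let sg i := sgnR (fst (Phi' i (RtoC 0))) in
  let tau k l := rsum d (fun i => sg i * fst (t i k l)) in
  1 < s -> 1 < r ->
  full_branch_map d a b T sg ->
  (forall i j l, (i < d)%nat -> exists W : R -> R,
     branch_primitive (a i) (b i) T (sg i) (fun k => fst (t i k l)) j l W) ->
  0 <= K -> (forall k l, Rabs (tau k l) <= K * r ^ l * (/ s) ^ k) ->
  forall j l M delta, (0 < M)%nat -> 0 <= delta <= 2 / INR M ->
  Rabs (/ INR M * rsum M (fun m => T (node M delta m) ^ j * node M delta m ^ l)
    - / INR M * rsum M (fun m => node M delta m ^ j * Series (fun k => tau k l * node M delta m ^ k)))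
  <= (INR d * 14 + 14 * K / (1 - / s)) / INR M * r ^ l.
Proof.
  intros sg tau Hs Hr Hfb HW HK Htau j l M delta HM Hd.
  assert (M0 : 0 < INR M) by now apply lt_0_INR.
  assert (q_lt : 0 < / s < 1).
  { split; [apply Rinv_0_lt_compat; lra|]. rewrite <- Rinv_1. apply Rinv_lt_contravar; lra. }
  set (x := node M delta).
  assert (x_in : forall m, (m < M)%nat -> -1 <= x m <= 1) by (intros; now apply node_bound).
  assert (HW' : forall i, exists W : R -> R, (i < d)%nat ->
     branch_primitive (a i) (b i) T (sg i) (fun k => fst (t i k l)) j l W).
  { intros i. destruct (lt_dec i d) as [L|L]; [|exists (fun _ => 0); easy].
    destruct (HW i j l L) as [W HW0]. now exists W. }
  destruct (choice_fun _ HW') as [W WP].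
  set (I := rsum d (fun i => (W i 1 - W i (-1)) / 2)).
  assert (Q : Rabs (/ INR M * rsum M (fun m => T (x m) ^ j * x m ^ l) - I) <= INR d * 14 / INR M).
  { apply (quadrature d a b T sg W j l M delta); auto.
    - intros i Hi. split; apply (WP i Hi).
    - intros i y Hi Hy. now apply (WP i Hi). }
  (* [I] and [F] are the same series in [tau k l], against exact and discrete moments respectively;
     these differ by at most [14 / M]. *)
  assert (S1 : is_series (fun k => tau k l * moment (j + k)) I).
  { apply is_series_ext with (fun k => rsum d (fun i => sg i * fst (t i k l) * moment (j + k))).
    - intros k. unfold tau. rewrite Rmult_comm, <- rsum_scal. apply rsum_ext. intros; ring.
    - apply (is_series_finsum d (fun i k => sg i * fst (t i k l) * moment (j + k))).
      intros i Hi. apply (WP i Hi). }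
  set (F := / INR M * rsum M (fun m => x m ^ j * Series (fun k => tau k l * x m ^ k))).
  assert (S2 : is_series (fun k => tau k l * node_moment M delta (j + k)) F).
  { apply is_series_ext with (fun k => / INR M * rsum M (fun m => x m ^ j * (tau k l * x m ^ k))).
    - intros k. unfold node_moment. fold x. rewrite <- Rmult_assoc, (Rmult_comm (tau k l)), Rmult_assoc.
      f_equal. rewrite <- rsum_scal. apply rsum_ext. intros m _. rewrite pow_add. ring.
    - apply (is_series_mult_l (/ INR M)).
      apply (is_series_finsum M (fun m k => x m ^ j * (tau k l * x m ^ k))). intros m Hm.
      apply (is_series_mult_l (x m ^ j)). apply Series_correct.
      apply (Series_tail _ (K * r ^ l) (/ s) 0); [lra|]. intros k.
      rewrite Rabs_mult. rewrite <- (Rmult_1_r (K * r ^ l * (/ s) ^ k)).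
      apply Rmult_le_compat; try apply Rabs_pos; [apply Htau|apply Rabs_pow_le1, x_in, Hm]. }
  assert (D : Rabs (F - I) <= K * r ^ l * (14 / INR M) * / (1 - / s)).
  { apply (is_series_abs_le (fun k => tau k l * node_moment M delta (j + k) - tau k l * moment (j + k))
      (fun k => K * r ^ l * (14 / INR M) * (/ s) ^ k)).
    - exact (is_series_minus _ _ _ _ S2 S1).
    - intros k. rewrite <- Rmult_minus_distr_l, Rabs_mult.
      replace (K * r ^ l * (14 / INR M) * (/ s) ^ k) with (K * r ^ l * (/ s) ^ k * (14 / INR M)) by ring.
      apply Rmult_le_compat; try apply Rabs_pos; [apply Htau|now apply moment_quadrature].
    - intros n. rewrite rsum_scal. apply Rmult_le_compat_l.
      + apply Rmult_le_pos; [apply Rmult_le_pos; [exact HK|apply pow_le; lra]|apply Rdiv_le_0_compat; lra].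
      + apply rsum_geom_lt1. lra. }
  replace (/ INR M * rsum M (fun m => T (x m) ^ j * x m ^ l) - F)
    with ((/ INR M * rsum M (fun m => T (x m) ^ j * x m ^ l) - I) - (F - I)) by ring.
  eapply Rle_trans; [apply Rabs_triang|]. rewrite Rabs_Ropp.
  (* The quadrature error of [T ^ j x ^ l] does not grow with [l]; since [r > 1] it fits under the
     factor [r ^ l]. *)
  assert (rl : 1 <= r ^ l) by (apply pow_R1_Rle; lra).
  assert (dM : INR d * 14 / INR M <= INR d * 14 / INR M * r ^ l).
  { rewrite <- (Rmult_1_r (INR d * 14 / INR M)) at 1. apply Rmult_le_compat_l; [|exact rl].
    apply Rdiv_le_0_compat; [generalize (pos_INR d); lra|exact M0]. }
  replace ((INR d * 14 + 14 * K / (1 - / s)) / INR M * r ^ l)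
    with (INR d * 14 / INR M * r ^ l + K * r ^ l * (14 / INR M) * / (1 - / s)).
  - lra.
  - unfold Rdiv. ring.
Qed.

Lemma sqrt_gamma : sqrt gamma = 1 + sqrt 2.
Proof. unfold gamma. apply sqrt_pow2. generalize (sqrt_pos 2). lra. Qed.

Theorem theorem1
  (d : nat) (a b : nat -> R) (T : R -> R) (psi : nat -> R -> R)
  (Phi Phi' : nat -> C -> C) (r RR : R)
  (* 1 < r < R *)
  (Hr : 1 < r) (HrR : r < RR)
  (* T : [-1,1] -> [-1,1] *)
  (HT : forall x, -1 <= x <= 1 -> -1 <= T x <= 1)
  (* closed intervals I_l = [a l, b l] (l < d) with disjoint interiors covering [-1,1] *)
  (Hint : forall l, (l < d)%nat -> -1 <= a l /\ a l <= b l /\ b l <= 1)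
  (Hcov : forall x, -1 <= x <= 1 -> exists l, (l < d)%nat /\ a l <= x <= b l)
  (Hdisj : forall l l', (l < d)%nat -> (l' < d)%nat -> l <> l' ->
             forall x, ~ (a l < x < b l /\ a l' < x < b l'))
  (* T restricted to int(I_l) is an analytic diffeomorphism onto its image,
     with analytic inverse branch psi l *)
  (HTan : forall l x, (l < d)%nat -> a l < x < b l -> real_analytic_at T x)
  (Hinv : forall l x, (l < d)%nat -> a l < x < b l -> psi l (T x) = x)
  (Hpsian : forall l x, (l < d)%nat -> a l < x < b l -> real_analytic_at (psi l) (T x))
  (* closure of T(int I_l) is [-1,1] *)
  (Hfull : forall l y, (l < d)%nat ->
             (in_closure (fun t => exists x, a l < x < b l /\ t = T x) y <-> -1 <= y <= 1))
  (* the inverse branches extend to bounded holomorphic functions Phi l on D_R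
     (complex derivative Phi' l), with images in D_r *)
  (Hext : forall l x, (l < d)%nat -> a l < x < b l ->
             Phi l (RtoC (T x)) = RtoC (psi l (T x)))
  (Hhol : forall l z, (l < d)%nat -> Cmod z < RR ->
             @is_derive C_AbsRing C_NormedModule (Phi l) z (Phi' l z))
  (Hbdd : forall l, (l < d)%nat -> exists B, forall z, Cmod z < RR -> Cmod (Phi l z) <= B)
  (Himg : forall l z, (l < d)%nat -> Cmod z < RR -> Cmod (Phi l z) < r)
  (* r/R < 1/gamma *)
  (Hgam : r / RR < / gamma) :
  let rho := sqrt (r * RR / gamma) in
  exists C1 C2 : R, 0 < C1 /\ 0 < C2 /\
    forall (N M : nat) (delta : R),
      (0 < M)%nat ->
      C1 * INR N ^ 2 * gamma ^ N <= INR M ->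
      0 <= delta <= 2 / INR M ->
      Rbar_le
        (opnorm (fun k l => Cminus (approx_mat T N M delta rho k l) (Lmat d Phi Phi' rho k l)))
        (C2 * (sqrt (gamma * r * RR) ^ N * INR N ^ 2 / INR M + sqrt (gamma * r / RR) ^ N)).
Proof.
  intros rho.
  assert (g5 := gamma_ge_5).
  set (w := sqrt gamma).
  assert (ww : w * w = gamma) by (apply sqrt_sqrt; lra).
  assert (w1 : 1 < w) by (unfold w; rewrite sqrt_gamma; generalize (sqrt_lt_R0 2 ltac:(lra)); lra).
  assert (rg : r * gamma < RR).
  { apply Rmult_lt_reg_r with (/ RR * / gamma).
    - apply Rmult_lt_0_compat; apply Rinv_0_lt_compat; lra.
    - replace (r * gamma * (/ RR * / gamma)) with (r / RR) by (field; lra).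
      replace (RR * (/ RR * / gamma)) with (/ gamma) by (field; lra). exact Hgam. }
  assert (rR0 : 0 < r * RR / gamma) by (apply Rdiv_lt_0_compat; nra).
  assert (rho2 : rho * rho = r * RR / gamma) by (apply sqrt_sqrt; lra).
  assert (rho0 : 0 < rho) by now apply sqrt_lt_R0.
  assert (rho_r : r < rho).
  { apply Rnot_le_lt. intros F. assert (rho * rho <= r * r) by (apply Rmult_le_compat; lra).
    assert (r * r < r * RR / gamma); [|lra].
    apply Rmult_lt_reg_r with gamma; [lra|].
    replace (r * RR / gamma * gamma) with (r * RR) by (field; lra). nra. }
  (* The decay rate of the columns. The choice of [rho] makes it equal to [gamma * rho / RR], hence
     to [sqrt (gamma * r / RR)]. *)
  set (om := r / rho).
  assert (om_rho : om * rho = r) by (unfold om; field; lra).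
  assert (om0 : 0 < om < 1).
  { split; [apply Rdiv_lt_0_compat; lra|]. apply Rmult_lt_reg_r with rho; lra. }
  assert (omR : om * RR = rho * gamma).
  { apply Rmult_eq_reg_r with rho; [|lra].
    replace (om * RR * rho) with (om * rho * RR) by ring.
    replace (rho * gamma * rho) with (rho * rho * gamma) by ring.
    rewrite om_rho, rho2. field. lra. }
  assert (E1 : sqrt (gamma * r * RR) = gamma * rho).
  { apply sqrt_lem_1; [nra|nra|].
    replace (gamma * rho * (gamma * rho)) with (gamma * gamma * (rho * rho)) by ring.
    rewrite rho2. field. lra. }
  assert (E2 : sqrt (gamma * r / RR) = om).
  { apply sqrt_lem_1; [apply Rdiv_le_0_compat; nra|lra|].
    apply Rmult_eq_reg_r with RR; [|lra].
    replace (om * om * RR) with (om * (om * RR)) by ring. rewrite omR.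
    replace (om * (rho * gamma)) with (om * rho * gamma) by ring. rewrite om_rho. field. lra. }
  (* The radius must be below [RR] for Cauchy's estimates and above [RR / w] to ensure
     [w * p <= om]. *)
  set (s := (RR / w + RR) / 2).
  assert (Rw : RR / w < RR).
  { apply Rmult_lt_reg_r with w; [lra|]. unfold Rdiv. rewrite Rmult_assoc, Rinv_l, Rmult_1_r by lra. nra. }
  assert (s_in : RR / w < s < RR) by (unfold s; lra).
  assert (ws : RR < w * s).
  { replace RR with (w * (RR / w)) at 1 by (field; lra). apply Rmult_lt_compat_l; lra. }
  assert (rho_s : rho < RR / w).
  { apply Rnot_le_lt. intros F.
    assert (Rw0 : 0 < RR / w) by (apply Rdiv_lt_0_compat; lra).
    assert (RR / w * (RR / w) <= rho * rho) by (apply Rmult_le_compat; lra).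
    replace (RR / w * (RR / w)) with (RR * RR / gamma) in H by (rewrite <- ww; field; lra).
    rewrite rho2 in H. assert (RR * RR <= r * RR); [|nra].
    apply Rmult_le_reg_r with (/ gamma); [apply Rinv_0_lt_compat; lra|exact H]. }
  assert (s1 : 1 < s) by lra.
  set (q := / s).
  assert (q0 : 0 < q < 1).
  { unfold q. split; [apply Rinv_0_lt_compat; lra|]. rewrite <- Rinv_1. apply Rinv_lt_contravar; lra. }
  set (p := rho * q).
  assert (p0 : 0 < p).
  { unfold p. apply Rmult_lt_0_compat; lra. }
  assert (wp : w * p <= om).
  { unfold p, q. apply Rmult_le_reg_r with (RR * s); [nra|].
    replace (w * (rho * / s) * (RR * s)) with (w * rho * RR) by (field; lra).
    replace (om * (RR * s)) with (om * RR * s) by ring. rewrite omR, <- ww.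
    replace (rho * (w * w) * s) with (w * rho * (w * s)) by ring.
    apply Rmult_le_compat_l; [nra|lra]. }
  assert (p_om : p <= om) by nra.
  destruct (branch_expansion r RR s ltac:(lra) ltac:(lra)) as [K [K0 HK]].
  assert (Hd : forall l z, (l < d)%nat -> Cmod z < RR -> cdiff (Phi l) z (Phi' l z)).
  { intros l z Hl Hz. apply is_derive_cdiff. now apply Hhol. }
  assert (Ht : forall i, exists t : nat -> nat -> C, (i < d)%nat ->
     (forall k l, Cmod (t k l) <= K * r ^ l / s ^ k) /\
      forall l z, Cmod z < s ->
        Clim (fun m => Csum m (fun k => t k l * z ^ k)%C) (Phi' i z * Phi i z ^ l)%C).
  { intros i. destruct (lt_dec i d) as [L|L]; [|exists (fun _ _ => RtoC 0); easy].
    destruct (HK (Phi i) (Phi' i)) as [t Ht]; [intros z; now apply Hd|intros z; now apply Himg|].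
    now exists t. }
  destruct (choice_fun _ Ht) as [t tP]. clear Ht HK.
  set (sg := fun i => sgnR (fst (Phi' i (RtoC 0)))).
  set (tau := fun k l => rsum d (fun i => sg i * fst (t i k l))).
  assert (Tinv : forall i x, (i < d)%nat -> a i < x < b i -> Phi i (RtoC (T x)) = RtoC x).
  { intros i x Hi Hx. now rewrite Hext, Hinv. }
  assert (fb : full_branch_map d a b T sg).
  { split; [|exact HT|exact Hcov|exact Hdisj]. intros i Hi. apply (branch_full (a i) (b i) T (Phi i) (Phi' i) RR s K r (t i)); auto; try lra;
      try (now apply tP).
    intros x. now apply HTan. }
  assert (pot : forall i j l, (i < d)%nat -> exists W : R -> R,
     branch_primitive (a i) (b i) T (sg i) (fun k => fst (t i k l)) j l W).
  { intros i j l Hi. apply (branch_primitive_exists (a i) (b i) T (Phi i) (Phi' i) RR s K r (t i)); auto; try lra;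
      try (now apply tP).
    intros x. now apply HTan. }
  assert (treal : forall i k l, (i < d)%nat -> t i k l = RtoC (fst (t i k l))).
  { intros i k l Hi. apply (branch_coef_real (a i) (b i) T (Phi i) (Phi' i) RR s K r (t i)); auto; try lra;
      try (now apply tP).
    intros x. now apply HTan. }
  set (K' := INR d * K).
  assert (K'0 : 0 <= K') by (apply Rmult_le_pos; [apply pos_INR|lra]).
  assert (sg1 : forall i, Rabs (sg i) <= 1).
  { intros i. unfold sg, sgnR. destruct (Rlt_dec 0 _); [|destruct (Rlt_dec _ 0)];
      apply Rabs_le; simpl; lra. }
  assert (tau_le : forall k l, Rabs (tau k l) <= K' * r ^ l * q ^ k).
  { intros k l. unfold tau. eapply Rle_trans; [apply rsum_abs|].
    unfold K'. rewrite !Rmult_assoc, <- rsum_const. apply rsum_le. intros i Hi.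
    rewrite Rabs_mult, <- (Rmult_1_l (K * _)). apply Rmult_le_compat; try apply Rabs_pos; [apply sg1|].
    eapply Rle_trans; [apply fst_le_Cmod|]. eapply Rle_trans; [apply (tP i Hi)|].
    unfold q. rewrite pow_inv. apply Req_le. unfold Rdiv. ring. }
  (* The coefficients being real, [Lmat] is a rescaled real matrix, and the comparison with
     [approx_mat] takes place over the reals. *)
  assert (L_eq : forall k l, Lmat d Phi Phi' rho k l = RtoC (rho ^ k / rho ^ l * tau k l)).
  { intros k l. rewrite (Lmat_eq d Phi Phi' rho s (fun l => K * r ^ l) t k l); [|lra| |].
    - rewrite RtoC_mult. f_equal. unfold tau. rewrite <- Csum_RtoC. apply Csum_ext. intros i Hi.
      rewrite RtoC_mult, <- treal by exact Hi. reflexivity.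
    - intros i k' l' Hi. now apply tP.
    - intros i l' z Hi. now apply tP. }
  set (Ce := INR d * 14 + 14 * K' / (1 - q)).
  set (K1 := K' / (1 - q)).
  assert (K1_0 : 0 <= K1) by (unfold K1; apply Rdiv_le_0_compat; lra).
  assert (Ce0 : 0 <= Ce).
  { unfold Ce. apply Rplus_le_le_0_compat; [generalize (pos_INR d); lra|apply Rdiv_le_0_compat; lra]. }
  set (Kin := / (rho - 1) * / (1 - om)). set (Kout := / (1 - p) * / (1 - om)).
  assert (Kin0 : 0 < Kin) by (apply Rmult_lt_0_compat; apply Rinv_0_lt_compat; lra).
  assert (Kout0 : 0 < Kout) by (apply Rmult_lt_0_compat; apply Rinv_0_lt_compat; lra).
  (* 28 is the constant of [gram_lower]. In the second witness the outer 2 is the loss in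
     [opnorm_le_l1], [Kin] and [Kout] collect geometric sums inside and outside the block, and 1 is
     added for strict positivity. *)
  exists 28, (2 * ((2 * Ce + 2 * K1) * Kin + 2 * K' * Kout) + 1).
  split; [lra|]. split.
  { assert (0 <= (2 * Ce + 2 * K1) * Kin) by (apply Rmult_le_pos; lra).
    assert (0 <= 2 * K' * Kout) by (apply Rmult_le_pos; lra). lra. }
  intros N M delta HM HC Hdel. rewrite E1, E2.
  assert (M0 : 0 < INR M) by now apply lt_0_INR.
  assert (gN : 0 < gamma ^ N) by (apply pow_lt; lra).
  assert (N0 := pos_INR N).
  assert (N2 : INR N <= INR N ^ 2).
  { destruct N as [|N']; [simpl; lra|]. assert (1 <= INR (S N')) by (rewrite S_INR; generalize (pos_INR N'); lra). nra. }
  assert (sN : sqrt (INR N) <= INR N ^ 2).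
  { apply Rle_trans with (2 := N2). destruct N as [|N']; [simpl; rewrite sqrt_0; lra|].
    assert (1 <= INR (S N')) by (rewrite S_INR; generalize (pos_INR N'); lra).
    rewrite <- (sqrt_pow2 (INR (S N'))) at 2 by lra. apply sqrt_le_1_alt. nra. }
  assert (M_large : 28 * INR N * gamma ^ N <= INR M).
  { apply Rle_trans with (2 := HC). apply Rmult_le_compat_r; lra. }
  set (x := node M delta).
  assert (x_in : forall m, (m < M)%nat -> -1 <= x m <= 1) by (intros; now apply node_bound).
  destruct (MatrixBridge.approx_mat_spec T N M delta rho) as [y [y_in [y_out y_sys]]].
  { intros y Hy k Hk. assert (G := gram_lower N M delta HM Hdel M_large y). cbv zeta beta in G. rewrite Hy in G.
    assert (y k ^ 2 <= rsum N (fun k => y k ^ 2))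
      by (apply (rsum_term_le N (fun k => y k ^ 2)); [exact Hk|intros; apply pow2_ge_0]).
    rewrite Rmult_0_r in G. nra. }
  (* The transfer operator applied to [z ^ l], at real points. Its tail beyond [N] is the data [g]
     of [gram_solve]. *)
  set (f := fun l u => Series (fun k => tau k l * u ^ k)).
  assert (f_tail : forall l u, -1 <= u <= 1 ->
     Rabs (f l u - rsum N (fun k => tau k l * u ^ k)) <= K1 * r ^ l * q ^ N).
  { intros l u Hu.
    assert (Q := Series_tail (fun k => tau k l * u ^ k) (K' * r ^ l) q N ltac:(lra)).
    destruct Q as [_ Q].
    - intros k. rewrite Rabs_mult, <- (Rmult_1_r (K' * r ^ l * q ^ k)).
      apply Rmult_le_compat; try apply Rabs_pos; [apply tau_le|now apply Rabs_pow_le1].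
    - eapply Rle_trans; [exact Q|]. apply Req_le. unfold K1. field. lra. }
  (* The bound of [gram_solve] with the common factor [r ^ l] taken out. *)
  set (Z := 2 * gamma ^ N * (sqrt (INR N) * (Ce / INR M)) + sqrt (2 * gamma ^ N) * (K1 * q ^ N)).
  assert (qN : 0 < q ^ N) by (apply pow_lt; lra).
  assert (Z0 : 0 <= Z).
  { assert (CeM : 0 <= Ce / INR M) by (apply Rdiv_le_0_compat; lra).
    assert (S1 := sqrt_pos (INR N)). assert (S2 := sqrt_pos (2 * gamma ^ N)).
    assert (0 <= sqrt (INR N) * (Ce / INR M)) by now apply Rmult_le_pos.
    assert (0 <= K1 * q ^ N) by (apply Rmult_le_pos; lra).
    unfold Z. apply Rplus_le_le_0_compat; apply Rmult_le_pos; lra. }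
  assert (z_le : forall k l, (k < N)%nat -> (l < N)%nat -> Rabs (y k l - tau k l) <= Z * r ^ l).
  { intros k l Hk Hl. assert (rl : 0 < r ^ l) by (apply pow_lt; lra).
    set (E := fun j => / INR M * rsum M (fun m => T (x m) ^ j * x m ^ l)
      - / INR M * rsum M (fun m => x m ^ j * f l (x m))).
    (* [H] applied to [y - tau] is the quadrature defect [E] plus the discrete moments of the tail.
       The columns of [H] with [k >= N] thus enter only through values at the nodes. *)
    assert (G := gram_solve N M delta HM Hdel M_large (fun k => y k l - tau k l) E
      (fun u => f l u - rsum N (fun k => tau k l * u ^ k)) (Ce / INR M * r ^ l) (K1 * r ^ l * q ^ N)).
    eapply Rle_trans; [apply G; clear G|].
    - apply Rmult_le_pos; [apply Rdiv_le_0_compat; lra|lra].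
    - apply Rmult_le_pos; [apply Rmult_le_pos|]; lra.
    - intros j Hj. rewrite (rsum_ext N _ (fun k => node_moment M delta (j + k) * y k l
        - node_moment M delta (j + k) * tau k l)) by (intros; ring).
      rewrite rsum_minus, y_sys by assumption. unfold E. fold x.
      rewrite (rsum_ext M (fun m => x m ^ j * (f l (x m) - rsum N (fun k => tau k l * x m ^ k)))
        (fun m => x m ^ j * f l (x m) - x m ^ j * rsum N (fun k => tau k l * x m ^ k))) by (intros; ring).
      rewrite rsum_minus.
      replace (rsum N (fun k => node_moment M delta (j + k) * tau k l))
        with (/ INR M * rsum M (fun m => x m ^ j * rsum N (fun k => tau k l * x m ^ k))); [ring|].
      rewrite (rsum_ext M _ (fun m => rsum N (fun k => x m ^ (j + k) * tau k l))).
      + rewrite rsum_swap, <- rsum_scal. apply rsum_ext. intros i _. unfold node_moment. fold x.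
        rewrite Rmult_assoc. f_equal. rewrite Rmult_comm, <- rsum_scal. apply rsum_ext. intros; ring.
      + intros m _. rewrite <- rsum_scal. apply rsum_ext. intros i _. rewrite pow_add. ring.
    - intros j Hj.
      exact (duality_error d a b T Phi' t K' r s s1 Hr fb pot K'0 tau_le j l M delta HM Hdel).
    - intros m Hm. apply f_tail. now apply x_in.
    - exact Hk.
    - apply Req_le. unfold Z. ring. }
  set (B := (Z * rho ^ N / (rho - 1) + K' * p ^ N / (1 - p) + K' * om ^ N / (1 - p)) / (1 - om)).
  assert (ratio : forall k l, rho ^ k / rho ^ l * r ^ l = rho ^ k * om ^ l).
  { intros k l. unfold om, Rdiv. rewrite Rpow_mult_distr, pow_inv. ring. }
  assert (pos_ratio : forall k l, 0 < rho ^ k / rho ^ l) by (intros; apply Rdiv_lt_0_compat; now apply pow_lt).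
  apply Rbar_le_trans with (2 * B).
  - apply opnorm_le_l1. apply l1_blocks; try lra.
    + intros k l Hk Hl. rewrite y_in, L_eq, <- RtoC_minus, Cmod_R by assumption.
      replace (rho ^ k * y k l * / rho ^ l - rho ^ k / rho ^ l * tau k l)
        with (rho ^ k / rho ^ l * (y k l - tau k l)) by (unfold Rdiv; ring).
      rewrite Rabs_mult, (Rabs_pos_eq (rho ^ k / rho ^ l)) by (left; apply pos_ratio).
      replace (Z * rho ^ k * om ^ l) with (rho ^ k / rho ^ l * (Z * r ^ l))
        by (rewrite (Rmult_comm Z), <- Rmult_assoc, ratio; ring).
      apply Rmult_le_compat_l; [left; apply pos_ratio|now apply z_le].
    (* Outside the block the approximation is zero, and the error is the entry of [Lmat] itself. *)
    + intros k l Hkl. rewrite y_out, L_eq, <- RtoC_minus, Cmod_R by exact Hkl.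
      rewrite Rminus_0_l, Rabs_Ropp.
      rewrite Rabs_mult, (Rabs_pos_eq (rho ^ k / rho ^ l)) by (left; apply pos_ratio).
      replace (K' * p ^ k * om ^ l) with (rho ^ k / rho ^ l * (K' * r ^ l * q ^ k)).
      * apply Rmult_le_compat_l; [left; apply pos_ratio|apply tau_le].
      * replace (rho ^ k / rho ^ l * (K' * r ^ l * q ^ k)) with (K' * q ^ k * (rho ^ k / rho ^ l * r ^ l)) by ring.
        rewrite ratio. unfold p. rewrite Rpow_mult_distr. ring.
  - unfold Rbar_le. set (X := (gamma * rho) ^ N * INR N ^ 2 / INR M).
    assert (gr : 0 < (gamma * rho) ^ N) by (apply pow_lt; nra).
    assert (X0 : 0 <= X) by (unfold X; apply Rdiv_le_0_compat; [apply Rmult_le_pos; [lra|apply pow2_ge_0]|exact M0]).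
    assert (omN : 0 < om ^ N) by (apply pow_lt; lra).
    assert (pN : p ^ N <= om ^ N) by (apply pow_incr; lra).
    assert (ZX : Z * rho ^ N <= 2 * Ce * X + 2 * K1 * om ^ N).
    { unfold Z. rewrite Rmult_plus_distr_r. apply Rplus_le_compat.
      - replace (2 * gamma ^ N * (sqrt (INR N) * (Ce / INR M)) * rho ^ N)
          with (2 * Ce * ((gamma * rho) ^ N * sqrt (INR N) / INR M)) by (rewrite Rpow_mult_distr; unfold Rdiv; ring).
        apply Rmult_le_compat_l; [lra|]. unfold X. apply Rmult_le_compat_r; [left; now apply Rinv_0_lt_compat|].
        apply Rmult_le_compat_l; lra.
      (* The tail then contributes a multiple of [(w * p) ^ N], at most [om ^ N] by the choice of
         [s]. *)
      - assert (sg2 : sqrt (2 * gamma ^ N) <= 2 * w ^ N).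
        { assert (wN : 0 < w ^ N) by (apply pow_lt; lra).
          rewrite <- (sqrt_pow2 (2 * w ^ N)) by lra. apply sqrt_le_1_alt.
          rewrite <- ww, Rpow_mult_distr. nra. }
        assert (rN : 0 < rho ^ N) by (apply pow_lt; lra).
        apply Rle_trans with (2 * w ^ N * (K1 * q ^ N) * rho ^ N).
        + apply Rmult_le_compat_r; [lra|]. apply Rmult_le_compat_r; [|exact sg2].
          apply Rmult_le_pos; lra.
        + replace (2 * w ^ N * (K1 * q ^ N) * rho ^ N) with (2 * K1 * (w * p) ^ N)
            by (unfold p; rewrite !Rpow_mult_distr; ring).
          apply Rmult_le_compat_l; [lra|]. apply pow_incr. split; [nra|exact wp]. }
    assert (BB : B = Z * rho ^ N * Kin + K' * p ^ N * Kout + K' * om ^ N * Kout)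
      by (unfold B, Kin, Kout; field; lra).
    assert (T1 : Z * rho ^ N * Kin <= (2 * Ce * X + 2 * K1 * om ^ N) * Kin) by (apply Rmult_le_compat_r; lra).
    assert (T2 : K' * p ^ N * Kout <= K' * om ^ N * Kout).
    { apply Rmult_le_compat_r; [lra|]. apply Rmult_le_compat_l; lra. }
    rewrite BB.
    assert (U1 : 0 <= Ce * Kin) by (apply Rmult_le_pos; lra).
    assert (U2 : 0 <= K1 * Kin) by (apply Rmult_le_pos; lra).
    assert (U3 : 0 <= K' * Kout) by (apply Rmult_le_pos; lra).
    assert (V1 : 0 <= Ce * Kin * om ^ N) by (apply Rmult_le_pos; lra).
    assert (V2 : 0 <= K1 * Kin * X) by (apply Rmult_le_pos; lra).
    assert (V3 : 0 <= K' * Kout * X) by (apply Rmult_le_pos; lra).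
    lra.
Qed.
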